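(* Let $\varphi\in C^{\infty}_{0}(\mathbb{R})$ be a cut-off function such that $\varphi\equiv 1$ on $|x|\leq r_{0}$ with $r_{0}\geq 1$ and $\varphi\equiv 0$ on $|x|\geq r_{1}>r_{0}$, let $\psi:=1-\varphi$, and let $\lambda>0$. (i) Let $p>0$, $\tau\in\mathbb{R}$, $-1\leq\delta<p-1$ and $a\in\mathcal{A}^{\tau}_{\delta}(\mathbb{R})$. Then for any $N\in\mathbb{N}$, $$\tilde{I}_{p,1}^{\pm}[a](\lambda)=Os\text{-}\int_{0}^{\infty}e^{\pm i\lambda x^{p}}a(x)\,dx=\sum_{k=0}^{N-1}\tilde{I}_{p,k+1}^{\pm}\frac{a^{(k)}(0)}{k!}\lambda^{-\frac{k+1}{p}}+R^{\pm}_{p,N}(\lambda)$$ with $$R^{\pm}_{p,N}(\lambda)=\sum_{k=N}^{N+[p]-1}\tilde{I}_{p,k+1}^{\pm}\frac{a^{(k)}(0)}{k!}\lambda^{-\frac{k+1}{p}}+\tilde{I}_{p,N+[p]+1}^{\pm}[\tilde{a}](\lambda)+\tilde{I}_{p,1}^{\pm}[a\psi](\lambda),$$ $$\tilde{a}(x):=\frac{1}{(N+[p]-1)!}\int_{0}^{1}(1-\theta)^{N+[p]-1}(a\varphi)^{(N+[p])}(\theta x)\,d\theta,$$ where $$\tilde{I}_{p,k+1}^{\pm}:=Os\text{-}\int_{0}^{\infty}e^{\pm ix^{p}}x^{k}\,dx=p^{-1}e^{\pm i\frac{\pi}{2}\frac{k+1}{p}}\Gamma\left(\frac{k+1}{p}\right).$$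 Moreover there exists a positive constant $M_{p,N}$ such that for any $\lambda\geq 1$, $$|R^{\pm}_{p,N}(\lambda)|\leq M_{p,N}\,\lambda^{-\frac{N+1-(p-[p])}{p}}.$$ (ii) Let $m\in\mathbb{N}$, $\tau\in\mathbb{R}$, $-1\leq\delta<m-1$ and $a\in\mathcal{A}^{\tau}_{\delta}(\mathbb{R})$. Then for any $N\in\mathbb{N}$, $$\tilde{J}_{m,1}^{\pm}[a](\lambda)=Os\text{-}\int_{-\infty}^{\infty}e^{\pm i\lambda x^{m}}a(x)\,dx=\sum_{k=0}^{N-1}c_{m,k}^{\pm}\frac{a^{(k)}(0)}{k!}\lambda^{-\frac{k+1}{m}}+\tilde{R}^{\pm}_{m,N}(\lambda)$$ with $$\tilde{R}^{\pm}_{m,N}(\lambda)=\sum_{k=N}^{N+m-1}c_{m,k}^{\pm}\frac{a^{(k)}(0)}{k!}\lambda^{-\frac{k+1}{m}}+\tilde{J}_{m,N+m+1}^{\pm}[\tilde{a}](\lambda)+\tilde{J}_{m,1}^{\pm}[a\psi](\lambda),$$ where $\tilde{a}$ is given by the formula in (i) with $p=m$ (so $[p]=m$), and $$c_{m,k}^{\pm}:=\tilde{I}_{m,k+1}^{\pm}+(-1)^{k}\tilde{I}_{m,k+1}^{\pm\pm^{m}},\qquad \tilde{I}_{m,k+1}^{\pm\pm^{m}}:=Os\text{-}\int_{0}^{\infty}e^{\pm(-1)^{m}iy^{m}}y^{k}\,dy=m^{-1}e^{\pm(-1)^{m}i\frac{\pi}{2}\frac{k+1}{m}}\Gamma\left(\frac{k+1}{m}\right).$$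 Moreover there exists a positive constant $\tilde{M}_{m,N}$ such that for any $\lambda\geq 1$, $$|\tilde{R}^{\pm}_{m,N}(\lambda)|\leq\tilde{M}_{m,N}\,\lambda^{-\frac{N+1}{m}}.$$
   Context: $\mathbb{N}=\{1,2,\dots\}$; $[x]$ is the greatest integer $\leq x$; $\langle x\rangle:=(1+|x|^{2})^{1/2}$; the double signs $\pm$ are in the same order. $C^\infty(\mathbb{R})$ and $C^\infty_0(\mathbb{R})$ consist of complex-valued smooth functions (with compact support in the second case); $\mathcal{S}(\mathbb{R})$ is the Schwartz space. Amplitude class: for $\tau,\delta\in\mathbb{R}$, $a\in C^{\infty}(\mathbb{R})$ belongs to $\mathcal{A}^{\tau}_{\delta}(\mathbb{R})$ if for each $k\in\mathbb{Z}_{\geq 0}$ there is $C_{k}>0$ with $|a^{(k)}(x)|\leq C_{k}\langle x\rangle^{\tau+\delta k}$ for all $x\in\mathbb{R}$. Oscillatory integrals: for $\lambda>0$, $p>0$, $q>0$ and $b\in C^{\infty}(\mathbb{R})$, $$\tilde{I}^{\pm}_{p,q}[b](\lambda):=Os\text{-}\int_{0}^{\infty}e^{\pm i\lambda x^{p}}x^{q-1}b(x)\,dx:=\lim_{\varepsilon\to+0}\int_{0}^{\infty}e^{\pm i\lambda x^{p}}x^{q-1}b(x)\chi(\varepsilon x)\,dx,$$ and for $m,q\in\mathbb{N}$, $$\tilde{J}^{\pm}_{m,q}[b](\lambda):=Os\text{-}\int_{-\infty}^{\infty}e^{\pm i\lambda x^{m}}x^{q-1}b(x)\,dx:=\lim_{\varepsilon\to+0}\int_{-\infty}^{\infty}e^{\pm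 i\lambda x^{m}}x^{q-1}b(x)\chi(\varepsilon x)\,dx;$$ each is said to exist if the limit of improper integrals exists and is the same for every $\chi\in\mathcal{S}(\mathbb{R})$ with $\chi(0)=1$. The equalities in the claim include the assertion that the oscillatory integrals appearing exist. *)

(* Defs.v *)
From Stdlib Require Import Reals ZArith.
From Coquelicot Require Import Coquelicot.

Local Open Scope R_scope.

(** Complex-valued functions of a real variable, differentiated componentwise. *)

Definition smooth (f : R -> C) : Prop :=
  forall (n : nat) (x : R),
    ex_derive_n (fun y => Re (f y)) n x /\ ex_derive_n (fun y => Im (f y)) n x.

Definition CDerive_n (f : R -> C) (n : nat) (x : R) : C :=
  (Derive_n (fun y => Re (f y)) n x, Derive_n (fun y => Im (f y)) n x).

Definition compact_support (f : R -> C) : Prop :=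
  exists r : R, forall x : R, r <= Rabs x -> f x = RtoC 0.

Definition schwartz (f : R -> C) : Prop :=
  smooth f /\
  forall j k : nat, exists M : R, forall x : R,
    Rabs x ^ j * Cmod (CDerive_n f k x) <= M.

Definition japanese (x : R) : R := sqrt (1 + Rabs x ^ 2).

Definition amplitude (tau delta : R) (a : R -> C) : Prop :=
  smooth a /\
  forall k : nat, exists M : R, 0 < M /\ forall x : R,
    Cmod (CDerive_n a k x) <= M * Rpower (japanese x) (tau + delta * INR k).

(** [Cexpi t] is e^{it} for real [t]. *)
Definition Cexpi (t : R) : C := (cos t, sin t).

(** Euler's integral; meaningful for [0 < s]. *)
Definition Gamma (s : R) : R :=
  RInt_gen (fun t => Rpower t (s - 1) * exp (- t))
    (at_right 0) (Rbar_locally p_infty).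

(** The integer part of [x], as a natural number; meaningful for [0 <= x]. *)
Definition nat_part (x : R) : nat := Z.to_nat (Int_part x).

(** The filters [Fa] and [Fb] give the lower and upper ends of the improper
    integral.  [filterlimi] asks that the improper integrals of
    [f x * chi (eps * x)] exist for all small [eps > 0] and converge to [l],
    for one [l] that serves every [chi]. *)
Definition is_Os_int (Fa Fb : (R -> Prop) -> Prop) (f : R -> C) (l : C) : Prop :=
  forall chi : R -> C, schwartz chi -> chi 0 = RtoC 1 ->
    filterlimi
      (fun eps : R =>
         is_RInt_gen (V := C_R_NormedModule)
           (fun x : R => Cmult (f x) (chi (eps * x))) Fa Fb)
      (at_right 0) (locally (T := C_UniformSpace) l).

Definition ex_Os_int (Fa Fb : (R -> Prop) -> Prop) (f : R -> C) : Prop :=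
  exists l : C, is_Os_int Fa Fb f l.

Definition Os_int (Fa Fb : (R -> Prop) -> Prop) (f : R -> C) : C :=
  iota (T := C_R_CompleteNormedModule) (is_Os_int Fa Fb f).

(** In all that follows the double sign is a real [s], equal to 1 or -1.
    [Rpower] is the usual real power on the open half-line (0, oo), which is
    the only place where [I_integrand] is integrated. *)

Definition I_integrand (s p q : R) (b : R -> C) (lam x : R) : C :=
  (Cexpi (s * lam * Rpower x p) * RtoC (Rpower x (q - 1)) * b x)%C.

Definition ex_I (s p q : R) (b : R -> C) (lam : R) : Prop :=
  ex_Os_int (at_right 0) (Rbar_locally p_infty) (I_integrand s p q b lam).

Definition I_osc (s p q : R) (b : R -> C) (lam : R) : C :=
  Os_int (at_right 0) (Rbar_locally p_infty) (I_integrand s p q b lam).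

Definition J_integrand (s : R) (m q : nat) (b : R -> C) (lam x : R) : C :=
  (Cexpi (s * lam * x ^ m) * RtoC (x ^ (q - 1)) * b x)%C.

Definition ex_J (s : R) (m q : nat) (b : R -> C) (lam : R) : Prop :=
  ex_Os_int (Rbar_locally m_infty) (Rbar_locally p_infty) (J_integrand s m q b lam).

Definition J_osc (s : R) (m q : nat) (b : R -> C) (lam : R) : C :=
  Os_int (Rbar_locally m_infty) (Rbar_locally p_infty) (J_integrand s m q b lam).

(** The constants: Os-integral of e^{s i x^p} x^k over (0, oo). *)

Definition ex_I_const (s p : R) (k : nat) : Prop :=
  ex_I s p (INR k + 1) (fun _ => RtoC 1) 1.

Definition I_const (s p : R) (k : nat) : C :=
  I_osc s p (INR k + 1) (fun _ => RtoC 1) 1.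

(** p^{-1} e^{s i (pi/2) (k+1)/p} Gamma((k+1)/p) *)
Definition I_const_value (s p : R) (k : nat) : C :=
  (RtoC (/ p) * Cexpi (s * (PI / 2) * ((INR k + 1) / p))
     * RtoC (Gamma ((INR k + 1) / p)))%C.

(** For [s] the sign +-, the sign +-(-1)^m is [s * (-1) ^ m]. *)
Definition c_const (s : R) (m k : nat) : C :=
  (I_const s (INR m) k + RtoC ((-1) ^ k) * I_const (s * (-1) ^ m) (INR m) k)%C.

(** c * a^(k)(0)/k! * lam^{-(k+1)/p} *)
Definition expansion_term (c : C) (p : R) (a : R -> C) (lam : R) (k : nat) : C :=
  (c * (CDerive_n a k 0 / RtoC (INR (fact k)))
     * RtoC (Rpower lam (- ((INR k + 1) / p))))%C.

(** Integral form of the Taylor remainder of order [n] of [a * phi] at 0,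
    divided by x^n. *)
Definition a_tilde (a phi : R -> C) (n : nat) (x : R) : C :=
  (/ RtoC (INR (fact (n - 1))) *
   RInt (V := C_R_CompleteNormedModule)
     (fun theta : R =>
        RtoC ((1 - theta) ^ (n - 1)) *
        CDerive_n (fun y => a y * phi y) n (theta * x))
     0 1)%C.

Definition a_psi (a phi : R -> C) (x : R) : C := (a x * (RtoC 1 - phi x))%C.

Definition R_rem (s p : R) (N : nat) (a phi : R -> C) (lam : R) : C :=
  (sum_n_m (fun k => expansion_term (I_const s p k) p a lam k)
     N (N + nat_part p - 1)
   + I_osc s p (INR (N + nat_part p + 1)) (a_tilde a phi (N + nat_part p)) lam
   + I_osc s p 1 (a_psi a phi) lam)%C.

Definition R_tilde_rem (s : R) (m N : nat) (a phi : R -> C) (lam : R) : C :=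
  (sum_n_m (fun k => expansion_term (c_const s m k) (INR m) a lam k)
     N (N + m - 1)
   + J_osc s m (N + m + 1) (a_tilde a phi (N + m)) lam
   + J_osc s m 1 (a_psi a phi) lam)%C.

(* Main.v *)
(** Write [D = x^{1-p} d/dx].  Each integration by parts against
    [e^{+-i lam x^p} x^{p-1} dx] replaces an amplitude [f] by [D f], at the cost
    of a factor [1/(p lam)].  If [|D^k f| <= M x^{B + k rho}] at infinity with
    [rho = delta + 1 - p < 0], a few steps make the integral absolutely
    convergent with a bound proportional to [M].  Applied to
    [f * (chi1 (e1 x) - chi2 (e2 x))], whose constant is [O(e1 + e2)], this bound
    gives existence of the Os-integral and its independence of [chi] by Cauchy's
    criterion.  If also [|D^k f| <= M x^{A - k p}] near 0, cutting at
    [x = lam^{-1/p}] gives the decay [lam^{-(A+p)/p}].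

    The constants come from replacing [chi (eps x)] by [e^{-eps x^p}] and
    rotating the ray: [e^{-i s th q/p} int_0^oo e^{-lam e^{-i s th} x^p} x^{q-1} dx]
    does not depend on [th] in [0, pi/2), which is proved by real analysis (its
    increments are quadratic in the step) instead of a contour integral.

    Taylor's formula for [a phi] splits [a] into monomials, [x^n] times
    the remainder amplitude, and [a psi].  The whole line is the sum of the
    half-line results for [a] and [a(-x)]. *)

Require Import Defs.
From Stdlib Require Import Reals ZArith Lra Lia Psatz Factorial ClassicalEpsilon.
From Coquelicot Require Import Coquelicot.

Local Open Scope R_scope.

(** * Calculus of complex-valued functions of a real variable *)

(** Each regularized amplitude carries two bounds. It decays faster than any power, but with a
    constant that may blow up as eps -> 0; that bound serves only to make boundary terms vanish at
    infinity, so that the integrals converge. The size comes from a second bound, with a fixed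
    growth exponent and a controlled constant. Hence the two [sym] hypotheses on one function in
    [osc_tail] and [osc_integral].

    For non-integer p the phase x^p is not smooth at 0 and integration by parts cannot reach 0. The
    weights therefore have separate exponents at 0 and at infinity, and the cut b balances the
    integral over (0, b), of size b^{A+p}, against a boundary term b^A / lam; this forces b =
    lam^{-1/p}.

    The factor x^{p-1} is reserved for the phase, so x^{q-1} b(x) enters as f = x^{q-p} b. With b
    bounded near 0 this means A = q - p, and the rate lam^{-(A+p)/p} is the expected lam^{-q/p}.

    The assumption delta >= -1 acts as rho >= -p: D lowers a power of x by p, so powers, cut-offs
    and amplitudes all fit classes with the same rho. *)

Notation cderiv f x l :=
  (is_derive (K := R_AbsRing) (V := C_R_NormedModule) f x l).
Notation ccont f x :=
  (continuous (T := R_UniformSpace) (U := C_UniformSpace) f x).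
Notation cintg f Fa Fb l := (is_RInt_gen (V := C_R_NormedModule) f Fa Fb l).

Lemma Cnorm_Cmod (z : C) : norm (V := C_R_NormedModule) z = Cmod z.
Proof.
  destruct z as [a b]. unfold norm; simpl. unfold prod_norm, Cmod; simpl.
  unfold norm; simpl. unfold abs; simpl.
  f_equal. rewrite !Rmult_1_r, <- !Rabs_mult, !Rabs_pos_eq; nra.
Qed.

Lemma cderiv_Re (f : R -> C) (x : R) (l : C) :
  cderiv f x l -> is_derive (fun t => Re (f t)) x (Re l).
Proof.
  intros H. unfold is_derive in *.
  apply (filterdiff_comp' (K := R_AbsRing) f (fun z : C => fst z) x
    (fun y => scal y l) (fun z : C_R_NormedModule => fst z)); [exact H|].
  apply filterdiff_linear. apply is_linear_fst.
Qed.

Lemma cderiv_Im (f : R -> C) (x : R) (l : C) :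
  cderiv f x l -> is_derive (fun t => Im (f t)) x (Im l).
Proof.
  intros H. unfold is_derive in *.
  apply (filterdiff_comp' (K := R_AbsRing) f (fun z : C => snd z) x
    (fun y => scal y l) (fun z : C_R_NormedModule => snd z)); [exact H|].
  apply filterdiff_linear. apply is_linear_snd.
Qed.

Lemma cderiv_pair (f : R -> C) (x : R) (l : C) :
  is_derive (fun t => Re (f t)) x (Re l) ->
  is_derive (fun t => Im (f t)) x (Im l) -> cderiv f x l.
Proof.
  intros H1 H2. unfold is_derive in *.
  apply filterdiff_ext with (fun t => (Re (f t), Im (f t))).
  { intros y. unfold Re, Im. now destruct (f y). }
  apply filterdiff_ext_lin with (fun y : R => (scal y (Re l), scal y (Im l))).
  2:{ intros y. now destruct l. }
  apply (filterdiff_comp'_2 (K := R_AbsRing) (fun t => Re (f t)) (fun t => Im (f t))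
    (fun u v => ((u, v) : C_R_NormedModule)) x
    (fun y : R => scal y (Re l)) (fun y : R => scal y (Im l))
    (fun u v => ((u, v) : C_R_NormedModule))); [exact H1|exact H2|].
  apply filterdiff_ext_lin with (fun t => t); [|intros [u v]; reflexivity].
  apply filterdiff_ext with (fun t => t); [intros [u v]; reflexivity|].
  apply filterdiff_id.
Qed.

Lemma ccont_pair (f : R -> C) (x : R) :
  continuous (fun t => Re (f t)) x -> continuous (fun t => Im (f t)) x ->
  ccont f x.
Proof.
  intros H1 H2.
  apply continuous_ext with (fun t => (Re (f t), Im (f t))).
  { intros y. unfold Re, Im. now destruct (f y). }
  apply (continuous_comp_2 (fun t => Re (f t)) (fun t => Im (f t))
    (fun u v => ((u, v) : C_UniformSpace))); [exact H1|exact H2|].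
  apply continuous_ext with (fun t => t); [intros [u v]; reflexivity|].
  apply continuous_id.
Qed.

Lemma ccont_Re (f : R -> C) (x : R) : ccont f x -> continuous (fun t => Re (f t)) x.
Proof.
  intros H. apply (continuous_comp f (fun z : C => fst z)); [exact H|].
  destruct (f x) as [u v]. apply continuous_fst.
Qed.

Lemma ccont_Im (f : R -> C) (x : R) : ccont f x -> continuous (fun t => Im (f t)) x.
Proof.
  intros H. apply (continuous_comp f (fun z : C => snd z)); [exact H|].
  destruct (f x) as [u v]. apply continuous_snd.
Qed.

Lemma ccont_plus (f g : R -> C) (x : R) :
  ccont f x -> ccont g x -> ccont (fun t => (f t + g t)%C) x.
Proof.
  intros Hf Hg. apply ccont_pair; simpl.
  - apply (continuous_plus (fun t => Re (f t)) (fun t => Re (g t))); now apply ccont_Re.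
  - apply (continuous_plus (fun t => Im (f t)) (fun t => Im (g t))); now apply ccont_Im.
Qed.

Lemma ccont_mult (f g : R -> C) (x : R) :
  ccont f x -> ccont g x -> ccont (fun t => (f t * g t)%C) x.
Proof.
  intros Hf Hg.
  pose proof (ccont_Re _ _ Hf). pose proof (ccont_Im _ _ Hf).
  pose proof (ccont_Re _ _ Hg). pose proof (ccont_Im _ _ Hg).
  apply ccont_pair; simpl.
  - apply (continuous_minus (fun t => Re (f t) * Re (g t)) (fun t => Im (f t) * Im (g t)));
    now apply (continuous_mult (K := R_AbsRing)).
  - apply (continuous_plus (fun t => Re (f t) * Im (g t)) (fun t => Im (f t) * Re (g t)));
    now apply (continuous_mult (K := R_AbsRing)).
Qed.

Lemma ccont_RtoC (f : R -> R) (x : R) :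
  continuous f x -> ccont (fun t => RtoC (f t)) x.
Proof. intros H. apply ccont_pair; simpl; [exact H|apply continuous_const]. Qed.

Lemma cderiv_ccont (f : R -> C) (x : R) (l : C) : cderiv f x l -> ccont f x.
Proof.
  intros H. apply (ex_derive_continuous (K := R_AbsRing) (V := C_R_NormedModule) f).
  now exists l.
Qed.

Lemma cderiv_plus (f g : R -> C) (x : R) (l k : C) :
  cderiv f x l -> cderiv g x k -> cderiv (fun t => (f t + g t)%C) x (l + k)%C.
Proof. intros Hf Hg. exact (is_derive_plus f g x l k Hf Hg). Qed.

Lemma cderiv_mult (f g : R -> C) (x : R) (l k : C) :
  cderiv f x l -> cderiv g x k ->
  cderiv (fun t => (f t * g t)%C) x (l * g x + f x * k)%C.
Proof.
  intros Hf Hg.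
  pose proof (cderiv_Re _ _ _ Hf). pose proof (cderiv_Im _ _ _ Hf).
  pose proof (cderiv_Re _ _ _ Hg). pose proof (cderiv_Im _ _ _ Hg).
  apply cderiv_pair; simpl.
  - evar_last.
    { apply (is_derive_minus (K := R_AbsRing) (fun t => Re (f t) * Re (g t)) (fun t => Im (f t) * Im (g t)));
      apply (is_derive_mult (K := R_AbsRing)); eauto using Rmult_comm. }
    unfold minus, plus, opp, mult; simpl. unfold Re, Im. ring.
  - evar_last.
    { apply (is_derive_plus (K := R_AbsRing) (fun t => Re (f t) * Im (g t)) (fun t => Im (f t) * Re (g t)));
      apply (is_derive_mult (K := R_AbsRing)); eauto using Rmult_comm. }
    unfold minus, plus, opp, mult; simpl. unfold Re, Im. ring.
Qed.

Lemma cderiv_const (c : C) (x : R) : cderiv (fun _ => c) x (RtoC 0).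
Proof. exact (is_derive_const (K := R_AbsRing) (V := C_R_NormedModule) c x). Qed.

Lemma cderiv_scal (c : C) (f : R -> C) (x : R) (l : C) :
  cderiv f x l -> cderiv (fun t => (c * f t)%C) x (c * l)%C.
Proof.
  intros H. replace (c * l)%C with (RtoC 0 * f x + c * l)%C by ring.
  apply (cderiv_mult (fun _ => c)); [apply cderiv_const|exact H].
Qed.

Lemma cderiv_RtoC (f : R -> R) (x l : R) :
  is_derive f x l -> cderiv (fun t => RtoC (f t)) x (RtoC l).
Proof.
  intros H. apply cderiv_pair; simpl; [exact H|].
  exact (is_derive_const (K := R_AbsRing) (V := R_NormedModule) 0 x).
Qed.

Lemma cderiv_comp (f : R -> C) (g : R -> R) (x l : R) (k : C) :
  is_derive g x l -> cderiv f (g x) k -> cderiv (fun t => f (g t)) x (RtoC l * k)%C.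
Proof.
  intros Hg Hf. 
  replace (RtoC l * k)%C with (scal (K := R_AbsRing) (V := C_R_NormedModule) l k).
  - exact (is_derive_comp (V := C_R_NormedModule) f g x k l Hf Hg).
  - destruct k as [u v]. unfold scal; simpl. unfold prod_scal, scal; simpl.
    unfold mult; simpl. unfold RtoC, Cmult; simpl. f_equal; ring.
Qed.

Lemma cderiv_unique (f : R -> C) (x : R) (l k : C) :
  cderiv f x l -> cderiv f x k -> l = k.
Proof.
  intros H1 H2.
  pose proof (is_derive_unique _ _ _ (cderiv_Re _ _ _ H1)) as A1.
  pose proof (is_derive_unique _ _ _ (cderiv_Re _ _ _ H2)) as A2.
  pose proof (is_derive_unique _ _ _ (cderiv_Im _ _ _ H1)) as B1.
  pose proof (is_derive_unique _ _ _ (cderiv_Im _ _ _ H2)) as B2.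
  destruct l, k; simpl in *; congruence.
Qed.

Lemma cderiv_ext_loc (f g : R -> C) (x : R) (l : C) :
  locally x (fun t => f t = g t) -> cderiv f x l -> cderiv g x l.
Proof. intros H. now apply (is_derive_ext_loc (V := C_R_NormedModule)). Qed.

Definition Cexp (z : C) : C := (RtoC (exp (Re z)) * Cexpi (Im z))%C.

Lemma Cmod_Cexpi (t : R) : Cmod (Cexpi t) = 1.
Proof.
  unfold Cmod, Cexpi; simpl. rewrite !Rmult_1_r.
  pose proof (sin2_cos2 t) as H. unfold Rsqr in H.
  replace (cos t * cos t + sin t * sin t) with 1 by lra. apply sqrt_1.
Qed.

Lemma Cmod_Cexp (z : C) : Cmod (Cexp z) = exp (Re z).
Proof.
  unfold Cexp. rewrite Cmod_mult, Cmod_Cexpi, Cmod_R, Rabs_pos_eq; [ring|].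
  left; apply exp_pos.
Qed.

Lemma cderiv_Cexp (h : R -> C) (x : R) (l : C) :
  cderiv h x l -> cderiv (fun t => Cexp (h t)) x (l * Cexp (h x))%C.
Proof.
  intros H. pose proof (cderiv_Re _ _ _ H) as H1. pose proof (cderiv_Im _ _ _ H) as H2.
  assert (E1 : is_derive (fun t => exp (Re (h t))) x (Re l * exp (Re (h x)))).
  { exact (is_derive_comp exp _ x _ _ (is_derive_exp _) H1). }
  assert (E2 : is_derive (fun t => cos (Im (h t))) x (Im l * - sin (Im (h x)))).
  { exact (is_derive_comp cos _ x _ _ (is_derive_cos _) H2). }
  assert (E3 : is_derive (fun t => sin (Im (h t))) x (Im l * cos (Im (h x)))).
  { exact (is_derive_comp sin _ x _ _ (is_derive_sin _) H2). }
  unfold Cexp.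
  evar_last.
  { apply (cderiv_mult (fun t => RtoC (exp (Re (h t)))) (fun t => Cexpi (Im (h t)))
      x (RtoC (Re l * exp (Re (h x)))) (Im l * - sin (Im (h x)), Im l * cos (Im (h x)))).
    - now apply cderiv_RtoC.
    - apply cderiv_pair; simpl; assumption. }
  destruct l as [u v]. unfold Cexpi, Cplus, Cmult, RtoC; simpl. f_equal; ring.
Qed.

(** * Symbol classes *)

Lemma Rpower_pos (x a : R) : 0 < Rpower x a.
Proof. apply exp_pos. Qed.

Lemma is_derive_Rpower (a x : R) :
  0 < x -> is_derive (fun t => Rpower t a) x (a * Rpower x (a - 1)).
Proof.
  intros Hx. replace (Rpower x (a - 1)) with (/ x * Rpower x a).
  2:{ unfold Rminus. rewrite Rpower_plus, Rpower_Ropp, Rpower_1 by lra. ring. }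
  unfold Rpower. auto_derive; [lra|]. field. lra.
Qed.

Lemma continuous_Rpower (a x : R) :
  0 < x -> continuous (fun t => Rpower t a) x.
Proof.
  intros Hx. apply (ex_derive_continuous (fun t => Rpower t a)).
  eexists. now apply is_derive_Rpower.
Qed.

Lemma cderiv_Rpower (a x : R) :
  0 < x -> cderiv (fun t => RtoC (Rpower t a)) x (RtoC (a * Rpower x (a - 1))).
Proof. intros Hx. apply cderiv_RtoC. now apply is_derive_Rpower. Qed.

Lemma Rpower_le_small (x a b : R) : 0 < x -> x <= 1 -> b <= a -> Rpower x a <= Rpower x b.
Proof.
  intros Hx H1 H. unfold Rpower. destruct (Req_dec (ln x) 0) as [E|E].
  { rewrite E, !Rmult_0_r. lra. }
  assert (ln x <= 0) by (rewrite <- ln_1; apply ln_le; lra).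
  destruct (Rle_lt_or_eq_dec (a * ln x) (b * ln x)) as [L|L]; [nra| |].
  - left. now apply exp_increasing.
  - rewrite L; lra.
Qed.

Definition wt (A B x : R) : R := if Rlt_dec x 1 then Rpower x A else Rpower x B.

Lemma wt_pos (A B x : R) : 0 < wt A B x.
Proof. unfold wt; destruct (Rlt_dec x 1); apply Rpower_pos. Qed.

Lemma wt_mult (A B A' B' x : R) : wt A B x * wt A' B' x = wt (A + A') (B + B') x.
Proof. unfold wt; destruct (Rlt_dec x 1); now rewrite Rpower_plus. Qed.

Lemma wt_le (A B A' B' x : R) :
  0 < x -> A' <= A -> B <= B' -> wt A B x <= wt A' B' x.
Proof.
  intros Hx HA HB. unfold wt; destruct (Rlt_dec x 1).
  - apply Rpower_le_small; lra.
  - apply Rle_Rpower; lra.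
Qed.

Lemma wt_1 (A B : R) : wt A B 1 = 1.
Proof. unfold wt. destruct (Rlt_dec 1 1); unfold Rpower; rewrite ln_1, Rmult_0_r; apply exp_0. Qed.

Lemma Rpower_1_l (a : R) : Rpower 1 a = 1.
Proof. unfold Rpower. rewrite ln_1, Rmult_0_r. apply exp_0. Qed.

Lemma wt_small (A B x : R) : x <= 1 -> wt A B x = Rpower x A.
Proof.
  intros Hx. unfold wt. destruct (Rlt_dec x 1); [reflexivity|].
  replace x with 1 by lra. now rewrite !Rpower_1_l.
Qed.

Lemma wt_large (A B x : R) : 1 <= x -> wt A B x = Rpower x B.
Proof. intros Hx. unfold wt. destruct (Rlt_dec x 1); [lra|reflexivity]. Qed.

Lemma wt_diag (A x : R) : wt A A x = Rpower x A.
Proof. unfold wt. now destruct (Rlt_dec x 1). Qed.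

(** [sym p rho n A B M f]: with [D = x^{1-p} d/dx], for every [k <= n],
    [|D^k f| <= M x^{A - k p}] on (0,1) and [|D^k f| <= M x^{B + k rho}] on
    [1,oo).  An existential chain of derivatives makes the Leibniz rule a
    plain induction. *)
Fixpoint sym (p rho : R) (n : nat) (A B M : R) (f : R -> C) {struct n} : Prop :=
  (forall x, 0 < x -> Cmod (f x) <= M * wt A B x) /\
  match n with
  | O => forall x, 0 < x -> ccont f x
  | S m => exists g,
      (forall x, 0 < x -> cderiv f x (RtoC (Rpower x (p - 1)) * g x)%C) /\
      sym p rho m (A - p) (B + rho) M g
  end.

Lemma sym_bound p rho n A B M f :
  sym p rho n A B M f -> forall x, 0 < x -> Cmod (f x) <= M * wt A B x.
Proof. destruct n; now intros [H _]. Qed.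

Lemma sym_const_nonneg p rho n A B M f : sym p rho n A B M f -> 0 <= M.
Proof.
  intros H. pose proof (sym_bound _ _ _ _ _ _ _ H 1 Rlt_0_1) as H1.
  rewrite wt_1 in H1. pose proof (Cmod_ge_0 (f 1)). lra.
Qed.

Lemma sym_ccont p rho n A B M f :
  sym p rho n A B M f -> forall x, 0 < x -> ccont f x.
Proof.
  destruct n; intros [H0 H] x Hx; [now apply H|].
  destruct H as (g & Hg & _). eapply cderiv_ccont; now apply Hg.
Qed.

Lemma locally_pos (x : R) : 0 < x -> locally x (fun t => 0 < t).
Proof. intros Hx. exact (open_gt 0 x Hx). Qed.

Lemma sym_ext p rho n A B M f g :
  (forall x, 0 < x -> f x = g x) -> sym p rho n A B M f -> sym p rho n A B M g.
Proof.
  intros E H. assert (L : forall x, 0 < x -> locally x (fun t => f t = g t)).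
  { intros x Hx. apply filter_imp with (2 := locally_pos x Hx). exact E. }
  destruct n; destruct H as [H0 H]; split; try (intros x Hx; rewrite <- E; auto).
  - intros x Hx. eapply continuous_ext_loc; [|apply (H x Hx)]. exact (L x Hx).
  - destruct H as (h & Hh & Hs). exists h. split; [|exact Hs].
    intros x Hx. eapply cderiv_ext_loc; [apply L|]; auto.
Qed.

Lemma sym_le p rho n : forall A B M A' B' M' f,
  A' <= A -> B <= B' -> M <= M' -> sym p rho n A B M f -> sym p rho n A' B' M' f.
Proof.
  assert (K : forall A B M A' B' M' x y, 0 < x -> A' <= A -> B <= B' -> 0 <= M -> M <= M' ->
     y <= M * wt A B x -> y <= M' * wt A' B' x).
  { intros A B M A' B' M' x y Hx HA HB H0 HM Hy.
    pose proof (wt_le A B A' B' x Hx HA HB). pose proof (wt_pos A B x). nra. }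
  induction n; intros A B M A' B' M' f HA HB HM Hf;
    pose proof (sym_const_nonneg _ _ _ _ _ _ _ Hf) as HM0; destruct Hf as [H0 H]; split; eauto.
  destruct H as (g & Hg & Hs). exists g; split; [exact Hg|].
  eapply IHn; [| | |exact Hs]; lra.
Qed.

Lemma sym_pred p rho n : forall A B M f, sym p rho (S n) A B M f -> sym p rho n A B M f.
Proof.
  induction n; intros A B M f Hf.
  - split; [exact (sym_bound _ _ _ _ _ _ _ Hf)|exact (sym_ccont _ _ _ _ _ _ _ Hf)].
  - destruct Hf as [H0 (g & Hg & Hs)]. split; [exact H0|]. exists g. auto.
Qed.

Lemma sym_plus p rho n : forall A B M M' f g,
  sym p rho n A B M f -> sym p rho n A B M' g ->
  sym p rho n A B (M + M') (fun x => f x + g x)%C.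
Proof.
  assert (K : forall n A B M M' f g, sym p rho n A B M f -> sym p rho n A B M' g ->
     forall x, 0 < x -> Cmod (f x + g x)%C <= (M + M') * wt A B x).
  { intros n' A B M M' f g Hf Hg x Hx.
    pose proof (sym_bound _ _ _ _ _ _ _ Hf x Hx). pose proof (sym_bound _ _ _ _ _ _ _ Hg x Hx).
    pose proof (Cmod_triangle (f x) (g x)). lra. }
  induction n; intros A B M M' f g Hf Hg; (split; [eapply K; eassumption|]).
  - intros x Hx. apply ccont_plus; eapply sym_ccont; eassumption.
  - destruct Hf as [_ (f' & Hf & Sf)], Hg as [_ (g' & Hg & Sg)].
    exists (fun x => f' x + g' x)%C. split; [|now apply IHn].
    intros x Hx. rewrite Cmult_plus_distr_l. apply cderiv_plus; auto.
Qed.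

Lemma sym_scal p rho n (c : C) : forall A B M f,
  sym p rho n A B M f -> sym p rho n A B (Cmod c * M) (fun x => c * f x)%C.
Proof.
  assert (K : forall n A B M f, sym p rho n A B M f ->
     forall x, 0 < x -> Cmod (c * f x)%C <= (Cmod c * M) * wt A B x).
  { intros n' A B M f Hf x Hx.
    pose proof (sym_bound _ _ _ _ _ _ _ Hf x Hx). rewrite Cmod_mult.
    pose proof (Cmod_ge_0 c). nra. }
  induction n; intros A B M f Hf; (split; [eapply K; eassumption|]).
  - intros x Hx. apply ccont_mult; [apply continuous_const|eapply sym_ccont; eassumption].
  - destruct Hf as [_ (f' & Hf & Sf)].
    exists (fun x => c * f' x)%C. split; [|now apply IHn].
    intros x Hx. replace (RtoC (Rpower x (p - 1)) * (c * f' x))%C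
      with (c * (RtoC (Rpower x (p - 1)) * f' x))%C by ring. apply cderiv_scal; auto.
Qed.

(** The factor 2^n counts the terms of the uncollected Leibniz rule: every derivative doubles their
    number. *)
Lemma sym_mult p rho n : forall A B M A' B' M' f g,
  sym p rho n A B M f -> sym p rho n A' B' M' g ->
  sym p rho n (A + A') (B + B') (2 ^ n * (M * M')) (fun x => f x * g x)%C.
Proof.
  assert (K : forall n A B M A' B' M' f g, sym p rho n A B M f -> sym p rho n A' B' M' g ->
     forall x, 0 < x -> Cmod (f x * g x)%C <= (2 ^ n * (M * M')) * wt (A + A') (B + B') x).
  { intros n' A B M A' B' M' f g Hf Hg x Hx.
    pose proof (sym_bound _ _ _ _ _ _ _ Hf x Hx). pose proof (sym_bound _ _ _ _ _ _ _ Hg x Hx).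
    pose proof (sym_const_nonneg _ _ _ _ _ _ _ Hf) as HM.
    pose proof (sym_const_nonneg _ _ _ _ _ _ _ Hg) as HM'.
    rewrite Cmod_mult, <- wt_mult.
    assert (1 <= 2 ^ n') by (apply pow_R1_Rle; lra).
    pose proof (wt_pos A B x). pose proof (wt_pos A' B' x).
    apply Rle_trans with ((M * wt A B x) * (M' * wt A' B' x)).
    { apply Rmult_le_compat; auto using Cmod_ge_0. }
    assert (0 <= (M * wt A B x) * (M' * wt A' B' x)) by (apply Rmult_le_pos; nra).
    replace (2 ^ n' * (M * M') * (wt A B x * wt A' B' x))
      with (2 ^ n' * ((M * wt A B x) * (M' * wt A' B' x))) by ring. nra. }
  induction n; intros A B M A' B' M' f g Hf Hg; (split; [eapply K; eassumption|]).
  - intros x Hx. apply ccont_mult; eapply sym_ccont; eassumption.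
  - pose proof (sym_pred _ _ _ _ _ _ _ Hf) as Pf. pose proof (sym_pred _ _ _ _ _ _ _ Hg) as Pg.
    destruct Hf as [_ (f' & Hf & Sf)], Hg as [_ (g' & Hg & Sg)].
    exists (fun x => f' x * g x + f x * g' x)%C. split.
    + intros x Hx.
      replace (RtoC (Rpower x (p - 1)) * (f' x * g x + f x * g' x))%C
        with (RtoC (Rpower x (p - 1)) * f' x * g x + f x * (RtoC (Rpower x (p - 1)) * g' x))%C
        by ring.
      apply cderiv_mult; auto.
    + replace (2 ^ S n * (M * M')) with (2 ^ n * (M * M') + 2 ^ n * (M * M')) by (simpl; ring).
      apply sym_plus.
      * replace (A + A' - p) with (A - p + A') by ring.
        replace (B + B' + rho) with (B + rho + B') by ring. now apply IHn.
      * replace (A + A' - p) with (A + (A' - p)) by ring.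
        replace (B + B' + rho) with (B + (B' + rho)) by ring. now apply IHn.
Qed.

(** D x^a = a x^{a-p}: the exponent drops by exactly p at each step, which is what the class asks
    near 0 and, by -p <= rho, at least what it asks at infinity. *)
Lemma sym_Rpower p rho n : - p <= rho -> forall a,
  exists M, 0 <= M /\ sym p rho n a a M (fun x => RtoC (Rpower x a)).
Proof.
  intros Hrho.
  assert (K : forall a x M, 0 < x -> 1 <= M -> Cmod (RtoC (Rpower x a)) <= M * wt a a x).
  { intros a x M Hx HM. rewrite wt_diag, Cmod_R, Rabs_pos_eq by (left; apply Rpower_pos).
    pose proof (Rpower_pos x a). nra. }
  induction n; intros a.
  - exists 1. split; [lra|]. split; [intros; apply K; lra|].
    intros x Hx. apply ccont_RtoC. now apply continuous_Rpower.
  - destruct (IHn (a - p)) as (M & HM & H). pose proof (Cmod_ge_0 (RtoC a)).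
    exists (Rmax 1 (Cmod (RtoC a) * M)). pose proof (Rmax_l 1 (Cmod (RtoC a) * M)).
    split; [lra|]. split; [intros; now apply K|].
    exists (fun x => RtoC a * RtoC (Rpower x (a - p)))%C. split.
    + intros x Hx. replace (RtoC (Rpower x (p - 1)) * (RtoC a * RtoC (Rpower x (a - p))))%C
        with (RtoC (a * Rpower x (a - 1))); [now apply cderiv_Rpower|].
      rewrite <- !RtoC_mult. f_equal.
      replace (a - 1) with (p - 1 + (a - p)) by ring. rewrite Rpower_plus. ring.
    + eapply sym_le; [| | |apply sym_scal, H]; [lra|lra|apply Rmax_r].
Qed.

(** [C0] depends on the bounds only, so it is uniform in [eps] for the cut-offs
    [chi (eps x)]. *)
Lemma sym_of_derivs p delta n : -1 <= delta -> forall A B (Mj : nat -> R),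
  (forall j, 0 <= Mj j) ->
  exists C0, 0 <= C0 /\ forall (t : R) (H : nat -> R -> C), 0 <= t ->
    (forall j x, 0 < x -> cderiv (H j) x (H (S j) x)) ->
    (forall j x, 0 < x -> Cmod (H j x) <= t * Mj j * wt (A - INR j) (B + delta * INR j) x) ->
    sym p (delta + 1 - p) n A B (C0 * t) (H O).
Proof.
  intros Hd. induction n; intros A B Mj HMj.
  - exists (Mj O). split; [auto|]. intros t H Ht Hd' Hb. split.
    + intros x Hx. specialize (Hb O x Hx). simpl in Hb.
      rewrite Rminus_0_r, Rmult_0_r, Rplus_0_r in Hb. lra.
    + intros x Hx. eapply cderiv_ccont; auto.
  - destruct (IHn (A - 1) (B + delta) (fun j => Mj (S j))) as (C1 & HC1 & H1).
    { intros; auto. }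
    destruct (sym_Rpower p (delta + 1 - p) n ltac:(lra) (1 - p)) as (C2 & HC2 & H2).
    set (C3 := 2 ^ n * (C2 * C1)).
    assert (HC3 : 0 <= C3).
    { apply Rmult_le_pos; [apply pow_le; lra|nra]. }
    exists (Mj O + C3). split; [pose proof (HMj O); lra|].
    intros t H Ht Hd' Hb. split.
    + intros x Hx. specialize (Hb O x Hx). simpl in Hb.
      rewrite Rminus_0_r, Rmult_0_r, Rplus_0_r in Hb. pose proof (wt_pos A B x).
      assert (0 <= C3 * t * wt A B x) by (apply Rmult_le_pos; nra). lra.
    (* D (H 0) = x^{1-p} H 1. The shifted family puts H 1 at exponents (A - 1, B + delta), and the
       factor x^{1-p} moves them to (A - p, B + rho). *)
    + exists (fun x => RtoC (Rpower x (1 - p)) * H 1%nat x)%C. split.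
      * intros x Hx. rewrite Cmult_assoc, <- RtoC_mult, <- Rpower_plus.
        replace (p - 1 + (1 - p)) with 0 by ring. rewrite Rpower_O by lra.
        rewrite Cmult_1_l. auto.
      * eapply sym_le.
        4:{ apply sym_mult; [exact H2|]. apply (H1 t (fun j => H (S j))); [auto|auto|].
            intros j x Hx. specialize (Hb (S j) x Hx). rewrite S_INR in Hb.
            replace (A - 1 - INR j) with (A - (INR j + 1)) by ring.
            replace (B + delta + delta * INR j) with (B + delta * (INR j + 1)) by ring. exact Hb. }
        -- lra.
        -- lra.
        -- replace (2 ^ n * (C2 * (C1 * t))) with (C3 * t) by (unfold C3; ring).
           pose proof (HMj O). nra.
Qed.

(** * Dominated improper integrals *)

(** [D] is order-convex, so once both endpoints lie in it the whole segment between them does,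
    whichever endpoint is larger. It allows integrands that are regular only on (0, oo). *)
Lemma RInt_gen_of_primitive {V : CompleteNormedModule R_AbsRing} (D : R -> Prop)
  (Fa Fb : (R -> Prop) -> Prop) {FFa : Filter Fa} {FFb : Filter Fb}
  (h h' : R -> V) (la lb : V) :
  (forall x y z, D x -> D z -> x <= y <= z -> D y) -> Fa D -> Fb D ->
  (forall x, D x -> is_derive h x (h' x)) -> (forall x, D x -> continuous h' x) ->
  filterlim h Fa (locally la) -> filterlim h Fb (locally lb) ->
  is_RInt_gen h' Fa Fb (minus lb la).
Proof.
  intros HD Da Db Hh Hc La Lb.
  assert (Hin : forall a b x, D a -> D b -> Rmin a b <= x <= Rmax a b -> D x).
  { intros a b x Ha Hb. unfold Rmin, Rmax. destruct (Rle_dec a b); intros; eauto. }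
  unfold is_RInt_gen.
  apply (filterlimi_lim_ext_loc (fun ab => minus (h (snd ab)) (h (fst ab)))).
  - exists D D; [exact Da|exact Db|]. intros a b Ha Hb. simpl.
    apply is_RInt_derive; intros x Hx; [apply Hh|apply Hc]; exact (Hin _ _ _ Ha Hb Hx).
  - apply (filterlim_comp_2 (G := locally lb) (H := locally (opp la))
      (fun ab => h (snd ab)) (fun ab => opp (h (fst ab))) plus).
    + eapply filterlim_comp; [apply filterlim_snd|exact Lb].
    + eapply filterlim_comp; [eapply filterlim_comp; [apply filterlim_fst|exact La]|].
      apply (filterlim_opp (V := V)).
    + apply (filterlim_plus (V := V)).
Qed.

Lemma filterlim_at_point {V : UniformSpace} (h : R -> V) (a : R) :
  filterlim h (at_point a) (locally (h a)).
Proof. intros P HP. exact (locally_singleton _ _ HP). Qed.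

Lemma minus_plus_mid {G : AbelianGroup} (w v w' : G) :
  minus (plus w (plus v w')) v = plus w w'.
Proof.
  unfold minus. rewrite (plus_comm v w'), (plus_assoc w w' v), <- (plus_assoc _ v).
  now rewrite plus_opp_r, plus_zero_r.
Qed.

(** Cauchy's criterion: the integrals over two intervals differ by two end pieces, and each of these
    is dominated by the same end piece for [g], which is small because the integrals of [g]
    converge. *)
Lemma cintg_dominated (D : R -> Prop) (Fa Fb : (R -> Prop) -> Prop)
  {FFa : ProperFilter Fa} {FFb : ProperFilter Fb} (f : R -> C) (g : R -> R) (lg : R) :
  (forall x y z, D x -> D z -> x <= y <= z -> D y) -> Fa D -> Fb D ->
  filter_prod Fa Fb (fun ab => fst ab <= snd ab) ->
  (forall x, D x -> ccont f x) -> (forall x, D x -> continuous g x) ->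
  (forall x, D x -> Cmod (f x) <= g x) ->
  is_RInt_gen g Fa Fb lg ->
  exists v : C, cintg f Fa Fb v /\ Cmod v <= lg.
Proof.
  intros HD Da Db Hab Hf Hg Hfg Hlg.
  assert (Hin : forall a b x, D a -> D b -> Rmin a b <= x <= Rmax a b -> D x).
  { intros a b x Ha Hb. unfold Rmin, Rmax. destruct (Rle_dec a b); intros; eauto. }
  assert (If : forall a b, D a -> D b -> ex_RInt (V := C_R_CompleteNormedModule) f a b).
  { intros a b Ha Hb. apply (ex_RInt_continuous (V := C_R_CompleteNormedModule)).
    intros z Hz. apply Hf. eapply Hin; [| |exact Hz]; auto. }
  assert (Ig : forall a b, D a -> D b -> ex_RInt g a b).
  { intros a b Ha Hb. apply (ex_RInt_continuous (V := R_CompleteNormedModule)).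
    intros z Hz. apply Hg. eapply Hin; [| |exact Hz]; auto. }
  assert (Nle : forall a b l, D a -> D b -> a <= b -> is_RInt (V := C_R_NormedModule) f a b l ->
    norm (V := C_R_NormedModule) l <= RInt g a b).
  { intros a b l Ha Hb Hle Hl.
    apply (norm_RInt_le (V := C_R_NormedModule) f g a b l); auto.
    - intros x Hx. rewrite Cnorm_Cmod. apply Hfg. eauto.
    - apply (RInt_correct (V := R_CompleteNormedModule)). auto. }
  (* Orientation-free form: nothing tells which of two lower or two upper endpoints comes first. *)
  assert (N : forall a b l, D a -> D b -> is_RInt (V := C_R_NormedModule) f a b l ->
    norm (V := C_R_NormedModule) l <= Rabs (RInt g a b)).
  { intros a b l Ha Hb Hl. destruct (Rle_dec a b) as [L|L].
    - eapply Rle_trans; [apply Nle with (4 := Hl); auto|apply Rle_abs].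
    - assert (H : norm (opp l) <= RInt g b a).
      { apply (Nle b a (opp l)); auto; [lra|].
        apply (is_RInt_swap (V := C_R_NormedModule)) in Hl. exact Hl. }
      rewrite norm_opp in H. rewrite <- (opp_RInt_swap (V := R_CompleteNormedModule) g b a) by auto.
      unfold opp; simpl. rewrite Rabs_Ropp. eapply Rle_trans; [exact H|apply Rle_abs]. }
  assert (Ex : exists v : C, cintg f Fa Fb v).
  { unfold is_RInt_gen.
    apply (filterlimi_locally_cauchy (U := C_R_CompleteNormedModule)).
    - exists D D; [exact Da|exact Db|]. intros a b Ha Hb; simpl. split.
      + destruct (If a b Ha Hb) as [l Hl]. now exists l.
      + intros y1 y2 H1 H2.
        rewrite <- (is_RInt_unique (V := C_R_CompleteNormedModule) _ _ _ _ H1).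
        exact (is_RInt_unique (V := C_R_CompleteNormedModule) _ _ _ _ H2).
    - intros eps.
      (* An end piece of [g] is a difference of two integrals within eps/4 of [lg], hence below
         eps/2, and there are two end pieces. *)
      assert (He : 0 < eps / 4) by (destruct eps; simpl; lra).
      pose proof (proj1 (filterlimi_locally _ _) Hlg (mkposreal _ He)) as Hb.
      destruct Hb as [Q1 R1 HQ HR HQR]. simpl in HQR.
      exists (fun ab => (D (fst ab) /\ Q1 (fst ab)) /\ (D (snd ab) /\ R1 (snd ab))).
      split.
      { exists (fun a => D a /\ Q1 a) (fun b => D b /\ R1 b);
          [now apply filter_and|now apply filter_and|]. intros; simpl; tauto. }
      assert (HG : forall a b, D a -> D b -> Q1 a -> R1 b -> Rabs (RInt g a b - lg) < eps / 4).
      { intros a b Ha Hb Qa Rb. destruct (HQR a b Qa Rb) as (z & Hz & Bz).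
        rewrite (is_RInt_unique (V := R_CompleteNormedModule) _ _ _ _ Hz). exact Bz. }
      intros [a b] [a' b'] [[Da1 Qa] [Db1 Rb]] [[Da2 Qa'] [Db2 Rb']] u v Hu Hv. simpl in *.
      destruct (If a a' Da1 Da2) as [w Hw]. destruct (If b' b Db2 Db1) as [w' Hw'].
      assert (E : u = plus w (plus v w')).
      { pose proof (is_RInt_Chasles (V := C_R_NormedModule) _ _ _ _ _ _ Hw
          (is_RInt_Chasles (V := C_R_NormedModule) _ _ _ _ _ _ Hv Hw')) as H.
        rewrite <- (is_RInt_unique (V := C_R_CompleteNormedModule) _ _ _ _ Hu).
        exact (is_RInt_unique (V := C_R_CompleteNormedModule) _ _ _ _ H). }
      pose proof (N _ _ _ Da1 Da2 Hw) as N1. pose proof (N _ _ _ Db2 Db1 Hw') as N2.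
      assert (E1 : RInt g a a' = RInt g a b - RInt g a' b).
      { pose proof (RInt_Chasles (V := R_CompleteNormedModule) g a a' b ltac:(auto) ltac:(auto)) as H.
        change (RInt g a a' + RInt g a' b = RInt g a b) in H. lra. }
      assert (E2 : RInt g b' b = RInt g a b - RInt g a b').
      { pose proof (RInt_Chasles (V := R_CompleteNormedModule) g a b' b ltac:(auto) ltac:(auto)) as H.
        change (RInt g a b' + RInt g b' b = RInt g a b) in H. lra. }
      pose proof (HG a b Da1 Db1 Qa Rb) as G1. pose proof (HG a' b Da2 Db1 Qa' Rb) as G2.
      pose proof (HG a b' Da1 Db2 Qa Rb') as G3.
      rewrite E1 in N1. rewrite E2 in N2.
      apply (ball_sym (M := C_R_NormedModule)).
      apply (norm_compat1 (V := C_R_NormedModule)).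
      assert (Em : minus (G := C_R_NormedModule) u v = plus (G := C_R_NormedModule) w w').
      { rewrite E. apply (minus_plus_mid (G := C_R_NormedModule)). }
      change (norm (V := C_R_NormedModule) (minus (G := C_R_NormedModule) u v) < eps).
      rewrite Em. eapply Rle_lt_trans; [apply (norm_triangle (V := C_R_NormedModule))|].
      assert (T1 : Rabs (RInt g a b - RInt g a' b) < eps / 2) by (apply Rabs_def1; apply Rabs_def2 in G1, G2; lra).
      assert (T2 : Rabs (RInt g a b - RInt g a b') < eps / 2) by (apply Rabs_def1; apply Rabs_def2 in G1, G3; lra).
      eapply Rle_lt_trans; [apply Rplus_le_compat; [exact N1|exact N2]|]. lra. }
  destruct Ex as [v Hv]. exists v. split; [exact Hv|].
  rewrite <- Cnorm_Cmod.
  apply (RInt_gen_norm (V := C_R_CompleteNormedModule) (Fa := Fa) (Fb := Fb) f g); auto.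
  exists D D; [exact Da|exact Db|]. intros a b Ha Hb x Hx. simpl in Hx.
  etransitivity; [apply Req_le, Cnorm_Cmod|]. apply Hfg. eauto.
Qed.

(** * Integrals of powers at both ends of the half-line *)

Lemma filterlim_Rpower_0 (a : R) : 0 < a ->
  filterlim (fun x => Rpower x a) (at_right 0) (locally 0).
Proof.
  intros Ha. apply filterlim_locally. intros eps.
  exists (mkposreal _ (Rpower_pos eps (/ a))). intros y Hy Hy0. simpl in Hy.
  unfold ball in *; simpl in *; unfold AbsRing_ball, abs, minus, plus, opp in *; simpl in *.
  rewrite Ropp_0, Rplus_0_r in *. rewrite Rabs_pos_eq in * by (try lra; left; apply Rpower_pos).
  replace (pos eps) with (Rpower (Rpower eps (/ a)) a).
  - apply Rlt_Rpower_l; lra.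
  - rewrite Rpower_mult. rewrite Rinv_l by lra. apply Rpower_1. apply cond_pos.
Qed.

Lemma filterlim_Rpower_infty (a : R) : a < 0 ->
  filterlim (fun x => Rpower x a) (Rbar_locally p_infty) (locally 0).
Proof.
  intros Ha. apply filterlim_locally. intros eps.
  exists (Rpower eps (/ a)). intros y Hy.
  unfold ball in *; simpl in *; unfold AbsRing_ball, abs, minus, plus, opp in *; simpl in *.
  rewrite Ropp_0, Rplus_0_r in *. rewrite Rabs_pos_eq in * by (try lra; left; apply Rpower_pos).
  pose proof (Rpower_pos eps (/ a)).
  replace (pos eps) with (Rpower (Rpower eps (/ a)) a).
  - rewrite <- (Ropp_involutive a) at 1 3. rewrite !(Rpower_Ropp _ (- a)).
    apply Rinv_lt_contravar.
    + apply Rmult_lt_0_compat; apply Rpower_pos.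
    + apply Rlt_Rpower_l; lra.
  - rewrite Rpower_mult. rewrite Rinv_l by lra. apply Rpower_1. apply cond_pos.
Qed.

Lemma at_right_pos (D : R -> Prop) (a : R) :
  0 < a -> (forall x, 0 < x < a -> D x) -> at_right 0 D.
Proof.
  intros Ha H. exists (mkposreal _ Ha). intros y Hy Hy0. apply H.
  unfold ball in Hy; simpl in Hy; unfold AbsRing_ball, abs, minus, plus, opp in Hy; simpl in Hy.
  apply Rabs_def2 in Hy. lra.
Qed.

Lemma is_RInt_gen_Rpower_0 (a b : R) : 0 < a -> 0 < b ->
  is_RInt_gen (fun x => Rpower x (a - 1)) (at_right 0) (at_point b) (Rpower b a / a).
Proof.
  intros Ha Hb. replace (Rpower b a / a) with (minus (Rpower b a / a) (/ a * 0)).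
  2:{ unfold minus, plus, opp; simpl. field. lra. }
  apply (RInt_gen_of_primitive (V := R_CompleteNormedModule) (fun x => 0 < x)
    _ _ (fun x => / a * Rpower x a)).
  - intros; lra.
  - apply at_right_pos with 1; intros; lra.
  - exact Hb.
  - intros x Hx. replace (Rpower x (a - 1)) with (/ a * (a * Rpower x (a - 1))) by (field; lra).
    apply is_derive_scal. now apply is_derive_Rpower.
  - intros. now apply continuous_Rpower.
  - eapply filterlim_comp; [now apply filterlim_Rpower_0|].
    apply (filterlim_scal_r (V := R_NormedModule)).
  - replace (Rpower b a / a) with (/ a * Rpower b a) by (field; lra).
    apply (filterlim_at_point (V := R_UniformSpace) (fun x => / a * Rpower x a)).
Qed.

Lemma is_RInt_gen_Rpower_infty (a b : R) : a < 0 -> 0 < b ->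
  is_RInt_gen (fun x => Rpower x (a - 1)) (at_point b) (Rbar_locally p_infty)
    (Rpower b a / - a).
Proof.
  intros Ha Hb. replace (Rpower b a / - a) with (minus (/ a * 0) (/ a * Rpower b a)).
  2:{ unfold minus, plus, opp; simpl. field. lra. }
  apply (RInt_gen_of_primitive (V := R_CompleteNormedModule) (fun x => 0 < x)
    _ _ (fun x => / a * Rpower x a)).
  - intros; lra.
  - exact Hb.
  - exists 0. auto.
  - intros x Hx. replace (Rpower x (a - 1)) with (/ a * (a * Rpower x (a - 1))) by (field; lra).
    apply is_derive_scal. now apply is_derive_Rpower.
  - intros. now apply continuous_Rpower.
  - apply (filterlim_at_point (V := R_UniformSpace) (fun x => / a * Rpower x a)).
  - eapply filterlim_comp; [now apply filterlim_Rpower_infty|].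
    apply (filterlim_scal_r (V := R_NormedModule)).
Qed.

Lemma is_RInt_Rpower (a b c : R) : a <> 0 -> 0 < b -> 0 < c ->
  is_RInt_gen (fun x => Rpower x (a - 1)) (at_point b) (at_point c)
    ((Rpower c a - Rpower b a) / a).
Proof.
  intros Ha Hb Hc.
  replace ((Rpower c a - Rpower b a) / a) with (minus (/ a * Rpower c a) (/ a * Rpower b a)).
  2:{ unfold minus, plus, opp; simpl. field. lra. }
  apply (RInt_gen_of_primitive (V := R_CompleteNormedModule) (fun x => 0 < x)
    _ _ (fun x => / a * Rpower x a)).
  - intros; lra.
  - exact Hb.
  - exact Hc.
  - intros x Hx. replace (Rpower x (a - 1)) with (/ a * (a * Rpower x (a - 1))) by (field; lra).
    apply is_derive_scal. now apply is_derive_Rpower.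
  - intros. now apply continuous_Rpower.
  - apply (filterlim_at_point (V := R_UniformSpace) (fun x => / a * Rpower x a)).
  - apply (filterlim_at_point (V := R_UniformSpace) (fun x => / a * Rpower x a)).
Qed.

(** * Integration by parts *)

(** Up to the factor i s lam p, the phase times x^{p-1} is the derivative of the phase; keeping this
    weight apart from [f] makes integration by parts act on [f] by D alone. *)
Definition osc (s lam p : R) (f : R -> C) (x : R) : C :=
  (Cexpi (s * lam * Rpower x p) * f x * RtoC (Rpower x (p - 1)))%C.

Lemma Cmod_osc s lam p f x : Cmod (osc s lam p f x) = Cmod (f x) * Rpower x (p - 1).
Proof.
  unfold osc. rewrite !Cmod_mult, Cmod_Cexpi, Cmod_R, Rabs_pos_eq by (left; apply Rpower_pos).
  ring.
Qed.

Lemma ccont_Cexpi (h : R -> R) x : continuous h x -> ccont (fun t => Cexpi (h t)) x.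
Proof.
  intros H. apply ccont_pair; simpl.
  - exact (continuous_comp h cos x H (continuous_cos (h x))).
  - exact (continuous_comp h sin x H (continuous_sin (h x))).
Qed.

Lemma continuous_phase (c p x : R) : 0 < x -> continuous (fun t => c * Rpower t p) x.
Proof.
  intros Hx. apply (continuous_scal_r (V := R_NormedModule)). now apply continuous_Rpower.
Qed.

Lemma ccont_osc s lam p f x : 0 < x -> ccont f x -> ccont (osc s lam p f) x.
Proof.
  intros Hx Hf. unfold osc. apply ccont_mult; [apply ccont_mult; [|exact Hf]|].
  - apply ccont_Cexpi. now apply continuous_phase.
  - apply ccont_RtoC. now apply continuous_Rpower.
Qed.

Lemma Cmult_continuous (c z : C) :
  filterlim (fun w : C => (c * w)%C) (locally (T := C_UniformSpace) z)
    (locally (T := C_UniformSpace) (c * z)%C).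
Proof. exact (filterlim_scal_r (K := C_AbsRing) (V := C_NormedModule) c z). Qed.

(** The scalar is complex, whereas [C_R_NormedModule] scales by reals; hence the detour through the
    components. *)
Lemma is_RInt_Cscal (c : C) (f : R -> C) (a b : R) (l : C) :
  is_RInt (V := C_R_NormedModule) f a b l ->
  is_RInt (V := C_R_NormedModule) (fun x => (c * f x)%C) a b (c * l)%C.
Proof.
  intros H.
  pose proof (is_RInt_fct_extend_fst (U := R_NormedModule) (V := R_NormedModule) f a b l H) as H1.
  pose proof (is_RInt_fct_extend_snd (U := R_NormedModule) (V := R_NormedModule) f a b l H) as H2.
  apply (is_RInt_fct_extend_pair (U := R_NormedModule) (V := R_NormedModule)).
  - apply (is_RInt_minus (V := R_NormedModule)); now apply (is_RInt_scal (V := R_NormedModule)).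
  - apply (is_RInt_plus (V := R_NormedModule)); now apply (is_RInt_scal (V := R_NormedModule)).
Qed.

Lemma cintg_scal (c : C) Fa Fb {FFa : Filter Fa} {FFb : Filter Fb} (f : R -> C) (l : C) :
  cintg f Fa Fb l -> cintg (fun x => (c * f x)%C) Fa Fb (c * l)%C.
Proof.
  intros H P HP. unfold filtermapi.
  eapply filter_imp; [|exact (H _ (Cmult_continuous c l P HP))].
  intros ab (y & Hy & HPy). exists (c * y)%C. split; [now apply is_RInt_Cscal|exact HPy].
Qed.

Lemma filter_prod_at_right_point (b : R) : 0 < b ->
  filter_prod (at_right 0) (at_point b) (fun ab => fst ab <= snd ab).
Proof.
  intros Hb. exists (fun a => 0 < a < b) (fun x => x = b).
  - now apply at_right_pos with b.
  - reflexivity.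
  - intros; simpl; lra.
Qed.

Lemma filter_prod_point_infty (b : R) :
  filter_prod (at_point b) (Rbar_locally p_infty) (fun ab => fst ab <= snd ab).
Proof.
  exists (fun x => x = b) (fun x => b < x); [reflexivity|now exists b|].
  intros; simpl; lra.
Qed.

Lemma osc_near_zero s lam p f A B M b :
  0 < A + p -> 0 < b -> b <= 1 ->
  (forall x, 0 < x -> ccont f x) ->
  (forall x, 0 < x -> Cmod (f x) <= M * wt A B x) ->
  exists v : C, cintg (osc s lam p f) (at_right 0) (at_point b) v /\
    Cmod v <= M * (Rpower b (A + p) / (A + p)).
Proof.
  intros HAp Hb Hb1 Hc HM.
  apply (cintg_dominated (fun x => 0 < x <= b) _ _ _ (fun x => M * Rpower x (A + p - 1))).
  - intros; lra.
  - apply at_right_pos with b; intros; lra.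
  - unfold at_point; lra.
  - now apply filter_prod_at_right_point.
  - intros x Hx. apply ccont_osc; [|apply Hc]; lra.
  - intros x Hx. apply continuous_phase; lra.
  - intros x Hx. rewrite Cmod_osc. pose proof (HM x ltac:(lra)) as H.
    replace (A + p - 1) with (A + (p - 1)) by ring. rewrite Rpower_plus.
    pose proof (Rpower_pos x (p - 1)).
    rewrite wt_small in H by lra. nra.
  - apply (is_RInt_gen_scal (V := R_NormedModule)). now apply is_RInt_gen_Rpower_0.
Qed.

Lemma osc_absolute_tail s lam p f A B M b :
  A + p < 0 -> B + p < 0 -> 0 < b -> b <= 1 ->
  (forall x, 0 < x -> ccont f x) ->
  (forall x, 0 < x -> Cmod (f x) <= M * wt A B x) ->
  exists v : C, cintg (osc s lam p f) (at_point b) (Rbar_locally p_infty) v /\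
    Cmod v <= M * (Rpower b (A + p) * (/ - (A + p) + / - (B + p))).
Proof.
  intros HAp HBp Hb Hb1 Hc HM.
  assert (HM0 : 0 <= M).
  { pose proof (HM 1 ltac:(lra)) as H. rewrite wt_1 in H. pose proof (Cmod_ge_0 (f 1)). lra. }
  destruct (cintg_dominated (fun x => b <= x <= 1) (at_point b) (at_point 1)
    (osc s lam p f) (fun x => M * Rpower x (A + p - 1))
    (M * ((Rpower 1 (A + p) - Rpower b (A + p)) / (A + p)))) as (v1 & Hv1 & Bv1).
  - intros; lra.
  - unfold at_point; lra.
  - unfold at_point; lra.
  - exists (fun x => x = b) (fun x => x = 1); try reflexivity. intros; simpl; lra.
  - intros x Hx. apply ccont_osc; [|apply Hc]; lra.
  - intros x Hx. apply continuous_phase; lra.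
  - intros x Hx. rewrite Cmod_osc. pose proof (HM x ltac:(lra)) as H.
    replace (A + p - 1) with (A + (p - 1)) by ring. rewrite Rpower_plus.
    pose proof (Rpower_pos x (p - 1)).
    rewrite wt_small in H by lra. nra.
  - apply (is_RInt_gen_scal (V := R_NormedModule)). apply is_RInt_Rpower; lra.
  - destruct (cintg_dominated (fun x => 1 <= x) (at_point 1) (Rbar_locally p_infty)
      (osc s lam p f) (fun x => M * Rpower x (B + p - 1))
      (M * (Rpower 1 (B + p) / - (B + p)))) as (v2 & Hv2 & Bv2).
    + intros; lra.
    + unfold at_point; lra.
    + exists 1; intros; lra.
    + apply filter_prod_point_infty.
    + intros x Hx. apply ccont_osc; [|apply Hc]; lra.
    + intros x Hx. apply continuous_phase; lra.
    + intros x Hx. rewrite Cmod_osc. pose proof (HM x ltac:(lra)) as H.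
      replace (B + p - 1) with (B + (p - 1)) by ring. rewrite Rpower_plus.
      pose proof (Rpower_pos x (p - 1)).
      rewrite wt_large in H by lra. nra.
    + apply (is_RInt_gen_scal (V := R_NormedModule)). apply is_RInt_gen_Rpower_infty; lra.
    + exists (v1 + v2)%C. split.
      { exact (is_RInt_gen_Chasles (V := C_R_NormedModule) (osc s lam p f) 1 v1 v2 Hv1 Hv2). }
      eapply Rle_trans; [apply Cmod_triangle|].
      rewrite !Rpower_1_l in *.
      (* Since A + p < 0 and b <= 1, the power b^{A+p} is at least 1 and can absorb the contribution
         of [1, oo). The bound thus becomes homogeneous in [b], which makes the later choice of [b]
         exact. *)
      assert (Hb2 : 1 <= Rpower b (A + p)).
      { rewrite <- (Rpower_O b Hb). apply Rpower_le_small; lra. }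
      assert (I1 : 0 < / - (A + p)) by (apply Rinv_0_lt_compat; lra).
      assert (I2 : 0 < / - (B + p)) by (apply Rinv_0_lt_compat; lra).
      replace (M * ((1 - Rpower b (A + p)) / (A + p))) with
        (M * ((Rpower b (A + p) - 1) * / - (A + p))) in Bv1 by (field; lra).
      unfold Rdiv in Bv2. rewrite Rmult_1_l in Bv2.
      apply Rle_trans with (M * ((Rpower b (A + p) - 1) * / - (A + p)) + M * / - (B + p)); [lra|].
      rewrite <- Rmult_plus_distr_l. apply Rmult_le_compat_l; [exact HM0|]. nra.
Qed.

(** [n] integrations by parts starting at [b]: one boundary term each, then
    an absolutely convergent integral. *)
Fixpoint ibp_const (p rho lam b : R) (n : nat) (A B : R) {struct n} : R :=
  match n with
  | O => Rpower b (A + p) * (/ - (A + p) + / - (B + p))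
  | S m => (Rpower b A + ibp_const p rho lam b m (A - p) (B + rho)) / (p * lam)
  end.

(** The estimate involves [M] only. The bound with [K] enters solely through the limit of the
    boundary terms at infinity, so [K] may depend badly on the regularization. *)
Lemma osc_tail s lam p rho b n : s = 1 \/ s = -1 -> 0 < p -> rho < 0 -> 0 < lam -> 0 < b -> b <= 1 ->
  forall A B M B' K f,
  A - INR n * p + p < 0 -> B + INR n * rho + p < 0 -> B' + p < 0 ->
  sym p rho n A B M f -> sym p rho n A B' K f ->
  exists v : C, cintg (osc s lam p f) (at_point b) (Rbar_locally p_infty) v /\
    Cmod v <= M * ibp_const p rho lam b n A B.
Proof.
  intros Hs Hp Hrho Hlam Hb Hb1. induction n; intros A B M B' K f HA HB HB' Hf HK.
  - simpl in *. rewrite Rmult_0_l in *. apply osc_absolute_tail; try lra.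
    + exact (proj2 Hf).
    + exact (proj1 Hf).
  - rewrite S_INR in HA, HB.
    pose proof (sym_const_nonneg _ _ _ _ _ _ _ Hf) as HM0.
    destruct Hf as [Bf (g & Hg & Sg)]. destruct HK as [BK (g' & Hg' & Sg')].
    (* The two symbol hypotheses come with separate derivative chains; they agree because x^{p-1}
       does not vanish on (0, oo). *)
    assert (E : forall x, 0 < x -> g' x = g x).
    { intros x Hx. pose proof (cderiv_unique _ _ _ _ (Hg x Hx) (Hg' x Hx)) as E.
      assert (N : RtoC (Rpower x (p - 1)) <> RtoC 0).
      { intros N. apply RtoC_inj in N. pose proof (Rpower_pos x (p - 1)). lra. }
      rewrite <- (Cmult_1_l (g' x)), <- (Cmult_1_l (g x)), <- (Cinv_l _ N), <- !Cmult_assoc, E.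
      reflexivity. }
    apply (sym_ext _ _ _ _ _ _ _ _ E) in Sg'.
    destruct (IHn (A - p) (B + rho) M (B' + rho) K g) as (w & Hw & Bw);
      [lra|lra|lra|exact Sg|exact Sg'|].
    (* The derivative of the phase factor is i s lam p x^{p-1} times itself; [kap] inverts that
       constant, so [h] below is a primitive of osc f + kap osc g, where g = D f. *)
    set (kap := (/ (Ci * RtoC (s * lam * p)))%C).
    assert (Hslp : s * lam * p <> 0).
    { assert (s <> 0) by (destruct Hs; lra). repeat apply Rmult_integral_contrapositive_currified; lra. }
    assert (HN : (Ci * RtoC (s * lam * p))%C <> RtoC 0).
    { apply Cmod_gt_0. rewrite Cmod_mult, Cmod_Ci, Cmod_R, Rmult_1_l. now apply Rabs_pos_lt. }
    assert (Ckap : Cmod kap = / (p * lam)).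
    { unfold kap. rewrite Cmod_inv by exact HN. rewrite Cmod_mult, Cmod_Ci, Cmod_R, Rmult_1_l.
      f_equal. rewrite !Rabs_mult, (Rabs_pos_eq lam), (Rabs_pos_eq p) by lra.
      replace (Rabs s) with 1; [ring|]. destruct Hs as [-> | ->]; [now rewrite Rabs_R1|].
      rewrite Rabs_left; lra. }
    set (h := fun x => (kap * (Cexpi (s * lam * Rpower x p) * f x))%C).
    assert (Dh : forall x, 0 < x -> cderiv h x (osc s lam p f x + kap * osc s lam p g x)%C).
    { intros x Hx. unfold h.
      assert (De : cderiv (fun t => Cexpi (s * lam * Rpower t p)) x
        (RtoC (s * lam * (p * Rpower x (p - 1))) * (Ci * Cexpi (s * lam * Rpower x p)))%C).
      { apply (cderiv_comp Cexpi (fun t => s * lam * Rpower t p)).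
        - apply is_derive_scal. now apply is_derive_Rpower.
        - apply cderiv_pair; simpl.
          + evar_last; [apply is_derive_cos|simpl; ring].
          + evar_last; [apply is_derive_sin|simpl; ring]. }
      evar_last; [apply cderiv_scal, cderiv_mult; [exact De|apply Hg, Hx]|].
      unfold osc.
      replace (s * lam * (p * Rpower x (p - 1))) with (s * lam * p * Rpower x (p - 1)) by ring.
      rewrite (RtoC_mult (s * lam * p)).
      transitivity (kap * (Ci * RtoC (s * lam * p)) *
          (Cexpi (s * lam * Rpower x p) * f x * RtoC (Rpower x (p - 1))) +
          kap * (Cexpi (s * lam * Rpower x p) * g x * RtoC (Rpower x (p - 1))))%C; [ring|].
      unfold kap at 1. rewrite Cinv_l by exact HN. ring. }
    assert (Ih : cintg (fun x => (osc s lam p f x + kap * osc s lam p g x)%C)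
      (at_point b) (Rbar_locally p_infty) (minus (G := C_R_NormedModule) (RtoC 0) (h b))).
    { apply (RInt_gen_of_primitive (V := C_R_CompleteNormedModule) (fun x => 0 < x) _ _ h).
      - intros; lra.
      - exact Hb.
      - exists 0; auto.
      - exact Dh.
      - intros x Hx. apply ccont_plus; [|apply ccont_mult; [apply continuous_const|]].
        + apply ccont_osc; [exact Hx|]. eapply cderiv_ccont; apply Hg, Hx.
        + apply ccont_osc; [exact Hx|]. eapply sym_ccont; eassumption.
      - apply (filterlim_at_point (V := C_R_CompleteNormedModule)).
      (* The boundary term at infinity vanishes by the rapidly decaying bound, as B' < -p < 0. *)
      - apply (filterlim_norm_zero (V := C_R_NormedModule)).
        apply (filterlim_le_le (F := Rbar_locally p_infty) (fun _ => 0) _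
          (fun x => (/ (p * lam) * K) * Rpower x B') 0).
        + exists 1. intros x Hx. rewrite Cnorm_Cmod. split; [apply Cmod_ge_0|].
          unfold h. rewrite !Cmod_mult, Cmod_Cexpi, Ckap, Rmult_1_l.
          pose proof (BK x ltac:(lra)) as H. unfold wt in H. destruct (Rlt_dec x 1); [lra|].
          assert (0 < / (p * lam)) by (apply Rinv_0_lt_compat; nra). nra.
        + apply filterlim_const.
        + assert (Z : (/ (p * lam) * K) * 0 = 0) by ring.
          change (filterlim (fun x => (/ (p * lam) * K) * Rpower x B') (Rbar_locally p_infty) (locally 0)).
          rewrite <- Z.
          eapply filterlim_comp; [apply (filterlim_Rpower_infty B'); lra|].
          apply (filterlim_scal_r (V := R_NormedModule)). }
    assert (Iw : cintg (fun x => (kap * osc s lam p g x)%C) (at_point b) (Rbar_locally p_infty)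
      (kap * w)%C).
    { exact (cintg_scal kap _ _ _ _ Hw). }
    exists (minus (G := C_R_NormedModule) (minus (G := C_R_NormedModule) (RtoC 0) (h b)) (kap * w)%C).
    split.
    + eapply (is_RInt_gen_ext (V := C_R_NormedModule));
        [|apply (is_RInt_gen_minus (V := C_R_NormedModule)); [exact Ih|exact Iw]].
      apply filter_forall. intros ab x _. 
      change (osc s lam p f x + kap * osc s lam p g x - kap * osc s lam p g x = osc s lam p f x)%C. ring.
    + change (Cmod (0 - h b - kap * w)%C <= M * ibp_const p rho lam b (S n) A B).
      replace (0 - h b - kap * w)%C with (- (h b + kap * w))%C by ring.
      rewrite Cmod_opp. eapply Rle_trans; [apply Cmod_triangle|].
      unfold h. rewrite !Cmod_mult, Cmod_Cexpi, Ckap, Rmult_1_l. simpl.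
      pose proof (Bf b Hb) as H1.
      rewrite wt_small in H1 by exact Hb1. assert (0 < / (p * lam)) by (apply Rinv_0_lt_compat; nra).
      unfold Rdiv. nra.
Qed.

Lemma ibp_const_nonneg p rho lam b n : 0 < p -> 0 < lam -> forall A B,
  A - INR n * p + p < 0 -> B + INR n * rho + p < 0 -> 0 <= ibp_const p rho lam b n A B.
Proof.
  intros Hp Hl. induction n; intros A B HA HB.
  - simpl in *. rewrite Rmult_0_l in *. apply Rmult_le_pos; [left; apply Rpower_pos|].
    assert (0 < / - (A + p)) by (apply Rinv_0_lt_compat; lra).
    assert (0 < / - (B + p)) by (apply Rinv_0_lt_compat; lra). lra.
  - rewrite S_INR in *. simpl. apply Rmult_le_pos.
    + pose proof (Rpower_pos b A).
      assert (0 <= ibp_const p rho lam b n (A - p) (B + rho)) by (apply IHn; lra). lra.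
    + left. apply Rinv_0_lt_compat. nra.
Qed.

(** At b = lam^{-1/p} a step lowers A by p, which costs b^{-p} = lam, and gains 1 / (p lam). The
    powers of lam cancel, so all boundary terms and the final integral have the same order. *)
Lemma ibp_const_decay p rho n : 0 < p -> forall A B, exists C0, 0 <= C0 /\
  forall lam, 1 <= lam ->
    ibp_const p rho lam (Rpower lam (- / p)) n A B <= C0 * Rpower lam (- ((A + p) / p)).
Proof.
  intros Hp. induction n; intros A B.
  - exists (Rabs (/ - (A + p) + / - (B + p))). split; [apply Rabs_pos|].
    intros lam Hl. simpl. rewrite Rpower_mult.
    replace (- / p * (A + p)) with (- ((A + p) / p)) by (field; lra).
    pose proof (Rpower_pos lam (- ((A + p) / p))). pose proof (Rle_abs (/ - (A + p) + / - (B + p))). nra.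
  - destruct (IHn (A - p) (B + rho)) as (C1 & HC1 & H1).
    exists ((1 + C1) / p). split.
    { apply Rmult_le_pos; [lra|]. left. now apply Rinv_0_lt_compat. }
    intros lam Hl. simpl. specialize (H1 lam Hl). rewrite Rpower_mult.
    replace (- / p * A) with (- ((A - p + p) / p)) by (field; lra).
    replace (- ((A + p) / p)) with (- ((A - p + p) / p) + Ropp 1) by (field; lra).
    rewrite Rpower_plus, (Rpower_Ropp lam 1), Rpower_1 by lra.
    set (r := Rpower lam (- ((A - p + p) / p))) in *.
    replace ((1 + C1) / p * (r * / lam)) with ((r + C1 * r) / (p * lam)) by (field; lra).
    apply Rmult_le_compat_r; [left; apply Rinv_0_lt_compat; nra|lra].
Qed.

(** The function [c] is chosen before [s], [f], [M] and [K]: one bound serves all regularized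
    amplitudes at once. *)
Lemma osc_integral p rho n A B :
  0 < p -> rho < 0 -> 0 < A + p -> A - INR n * p + p < 0 -> B + INR n * rho + p < 0 ->
  exists c : R -> R,
    (forall lam, 0 < lam -> 0 <= c lam /\
      forall s f M B' K, s = 1 \/ s = -1 -> B' + p < 0 ->
        sym p rho n A B M f -> sym p rho n A B' K f ->
        exists v : C, cintg (osc s lam p f) (at_right 0) (Rbar_locally p_infty) v /\
          Cmod v <= M * c lam) /\
    exists C0, 0 <= C0 /\ forall lam, 1 <= lam -> c lam <= C0 * Rpower lam (- ((A + p) / p)).
Proof.
  intros Hp Hrho HAp HA HB.
  (* For lam < 1 the balanced cut would exceed 1, where the weight changes branch. No decay is
     claimed there, so the cut is put at 1. *)
  set (b := fun lam => if Rlt_dec lam 1 then 1 else Rpower lam (- / p)).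
  assert (Hb : forall lam, 0 < lam -> 0 < b lam /\ b lam <= 1).
  { intros lam Hl. unfold b. destruct (Rlt_dec lam 1); [lra|]. split; [apply Rpower_pos|].
    rewrite <- (Rpower_O lam) by lra. apply Rle_Rpower; [lra|].
    assert (0 < / p) by now apply Rinv_0_lt_compat. lra. }
  exists (fun lam => Rpower (b lam) (A + p) / (A + p) + ibp_const p rho lam (b lam) n A B).
  split.
  - intros lam Hl. destruct (Hb lam Hl) as [Hb0 Hb1]. split.
    + apply Rplus_le_le_0_compat; [|now apply ibp_const_nonneg].
      left. apply Rdiv_lt_0_compat; [apply Rpower_pos|lra].
    + intros s f M B' K Hs HB' Hf HK.
      destruct (osc_near_zero s lam p f A B M (b lam)) as (v1 & Hv1 & Bv1);
        [lra|lra|lra|exact (sym_ccont _ _ _ _ _ _ _ Hf)|exact (sym_bound _ _ _ _ _ _ _ Hf)|].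
      destruct (osc_tail s lam p rho (b lam) n Hs Hp Hrho Hl Hb0 Hb1 A B M B' K f HA HB HB' Hf HK)
        as (v2 & Hv2 & Bv2).
      exists (v1 + v2)%C. split.
      * exact (is_RInt_gen_Chasles (V := C_R_NormedModule) (osc s lam p f) (b lam) v1 v2 Hv1 Hv2).
      * eapply Rle_trans; [apply Cmod_triangle|]. lra.
  - destruct (ibp_const_decay p rho n Hp A B) as (C1 & HC1 & H1).
    assert (0 < / (A + p)) by (apply Rinv_0_lt_compat; lra).
    exists (/ (A + p) + C1). split; [lra|]. intros lam Hl.
    unfold b. destruct (Rlt_dec lam 1); [lra|]. specialize (H1 lam Hl).
    rewrite Rpower_mult. replace (- / p * (A + p)) with (- ((A + p) / p)) by (field; lra).
    unfold Rdiv at 1. nra.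
Qed.

(** * Regularizations *)

(** Besides [chi (eps x)], this covers the damping factors [e^{-eps x^p}],
    which are not of that form but compute the same limit. *)
Definition regularizer (p rho : R) (th : R -> R -> C) : Prop :=
  exists mu, 0 <= mu /\ forall n, exists C0, forall eps, 0 < eps ->
    sym p rho n 0 mu (C0 * eps) (fun x => th eps x - 1)%C /\
    forall J : nat, exists K, sym p rho n 0 (- INR J) K (th eps).

Lemma exists_nat_gt (a b : R) : 0 < b -> exists n : nat, a < INR n * b.
Proof.
  intros Hb. destruct (INR_unbounded (a / b)) as [n Hn]. exists n.
  apply (Rmult_lt_reg_r (/ b)); [now apply Rinv_0_lt_compat|].
  rewrite Rmult_assoc, Rinv_r by lra. unfold Rdiv in Hn. lra.
Qed.

(** The difference is treated as f (th1 - 1) - f (th2 - 1). Each bracket is O(eps), at the price of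
    the growth [mu], which further integrations by parts remove. *)
Lemma regularizer_pair p rho th1 th2 s lam A B f :
  0 < p -> - p <= rho -> rho < 0 -> 0 < A + p -> 0 < lam -> s = 1 \/ s = -1 ->
  (forall n, exists M, sym p rho n A B M f) ->
  regularizer p rho th1 -> regularizer p rho th2 ->
  exists C0, 0 <= C0 /\ forall e1 e2, 0 < e1 -> 0 < e2 ->
    exists v1 v2 : C,
      cintg (osc s lam p (fun x => f x * th1 e1 x)%C) (at_right 0) (Rbar_locally p_infty) v1 /\
      cintg (osc s lam p (fun x => f x * th2 e2 x)%C) (at_right 0) (Rbar_locally p_infty) v2 /\
      Cmod (v1 - v2)%C <= C0 * (e1 + e2).
Proof.
  intros Hp Hrho1 Hrho HAp Hl Hs Hf (mu1 & Hmu1 & R1) (mu2 & Hmu2 & R2).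
  set (mu := Rmax mu1 mu2).
  destruct (exists_nat_gt (A + p) p Hp) as [n1 Hn1].
  destruct (exists_nat_gt (B + mu + p) (- rho) ltac:(lra)) as [n2 Hn2].
  (* [n1] steps make the exponent at 0 low enough for [ibp_const], [n2] steps make the integral
     converge at infinity; further steps keep both inequalities, so the sum serves both. *)
  set (n := (n1 + n2)%nat).
  assert (Hn : A - INR n * p + p < 0 /\ B + mu + INR n * rho + p < 0).
  { unfold n. rewrite plus_INR. pose proof (pos_INR n1). pose proof (pos_INR n2). nra. }
  destruct (exists_nat_gt (B + p) 1 ltac:(lra)) as [J HJ].
  destruct (osc_integral p rho n A (B + mu) Hp Hrho HAp (proj1 Hn) (proj2 Hn)) as (c & Hc & _).
  destruct (Hc lam Hl) as [Hc0 Hcl].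
  destruct (Hf n) as [M HM]. pose proof (sym_const_nonneg _ _ _ _ _ _ _ HM) as HM0.
  destruct (R1 n) as [C1 H1], (R2 n) as [C2 H2].
  assert (Hex : forall g M' K, sym p rho n A (B + mu) M' g -> sym p rho n A (B + - INR J) K g ->
    exists v : C, cintg (osc s lam p g) (at_right 0) (Rbar_locally p_infty) v /\
          Cmod v <= M' * c lam).
  { intros g M' K Hg HK. apply (Hcl s g M' (B + - INR J) K); auto. lra. }
  assert (Hd1 : forall th mu' C0, 0 <= mu' -> mu' <= mu -> sym p rho n 0 mu' C0 (fun x => th x - 1)%C ->
    sym p rho n A (B + mu) (2 ^ n * (M * C0)) (fun x => f x * (th x - 1))%C).
  { intros th mu' C0 Hm Hm' Hth. eapply sym_le; [| | |apply sym_mult; [exact HM|exact Hth]]; lra. }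
  assert (Hd2 : forall th, (forall J : nat, exists K, sym p rho n 0 (- INR J) K th) ->
    exists K, sym p rho n A (B + - INR J) K (fun x => f x * th x)%C).
  { intros th Hth. destruct (Hth J) as [K HK]. eexists.
    eapply sym_le; [| | |apply sym_mult; [exact HM|exact HK]]; [lra|lra|apply Rle_refl]. }
  pose proof (Rmax_l mu1 mu2) as L1. pose proof (Rmax_r mu1 mu2) as L2. fold mu in L1, L2.
  assert (HC1 : 0 <= C1).
  { destruct (H1 1 ltac:(lra)) as [A1 _]. apply sym_const_nonneg in A1. lra. }
  assert (HC2 : 0 <= C2).
  { destruct (H2 1 ltac:(lra)) as [A2 _]. apply sym_const_nonneg in A2. lra. }
  assert (Hpow : 0 <= 2 ^ n) by (apply pow_le; lra).
  exists (2 ^ n * (M * (C1 + C2)) * c lam). split.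
  { apply Rmult_le_pos; [|exact Hc0]. apply Rmult_le_pos; [exact Hpow|].
    apply Rmult_le_pos; lra. }
  intros e1 e2 He1 He2.
  destruct (H1 e1 He1) as [A1 D1], (H2 e2 He2) as [A2 D2].
  destruct (Hd2 _ D1) as [K1 S1], (Hd2 _ D2) as [K2 S2].
  assert (HBmu : B + - INR J <= B + mu) by (pose proof (pos_INR J); lra).
  destruct (Hex _ K1 K1 ltac:(eapply sym_le; [| | |exact S1]; lra) S1) as (v1 & Hv1 & _).
  destruct (Hex _ K2 K2 ltac:(eapply sym_le; [| | |exact S2]; lra) S2) as (v2 & Hv2 & _).
  (* The same difference is bounded twice: here with rapid decay and arbitrary constants, next with
     growth [mu] and a constant O(e1 + e2). *)
  assert (S12 : sym p rho n A (B + - INR J) (K1 + Cmod (RtoC (-1)) * K2)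
    (fun x => f x * th1 e1 x + RtoC (-1) * (f x * th2 e2 x))%C).
  { apply sym_plus; [exact S1|]. now apply sym_scal. }
  assert (T12 : sym p rho n A (B + mu) (2 ^ n * (M * (C1 * e1)) + Cmod (RtoC (-1)) * (2 ^ n * (M * (C2 * e2))))
    (fun x => f x * th1 e1 x + RtoC (-1) * (f x * th2 e2 x))%C).
  { eapply sym_ext; [|apply sym_plus; [apply (Hd1 _ mu1 _ Hmu1 L1 A1)|apply sym_scal, (Hd1 _ mu2 _ Hmu2 L2 A2)]].
    intros x Hx. simpl. ring. }
  destruct (Hex _ _ _ T12 S12) as (w & Hw & Bw).
  exists v1, v2. split; [exact Hv1|]. split; [exact Hv2|].
  assert (Ew : w = (v1 - v2)%C).
  { rewrite <- (is_RInt_gen_unique (V := C_R_CompleteNormedModule) _ _ Hw).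
    apply (is_RInt_gen_unique (V := C_R_CompleteNormedModule)).
    eapply (is_RInt_gen_ext (V := C_R_NormedModule));
      [|apply (is_RInt_gen_minus (V := C_R_NormedModule)); [exact Hv1|exact Hv2]].
    apply filter_forall. intros ab x _. unfold osc.
    match goal with |- minus ?a ?b = _ => change (a - b = osc s lam p
      (fun x => f x * th1 e1 x + RtoC (-1) * (f x * th2 e2 x)) x)%C end.
    unfold osc. ring. }
  rewrite <- Ew. eapply Rle_trans; [exact Bw|].
  rewrite Cmod_R, Rabs_left by lra.
  assert (0 <= 2 ^ n * (M * C1) * e2 + 2 ^ n * (M * C2) * e1).
  { apply Rplus_le_le_0_compat; apply Rmult_le_pos; try lra; apply Rmult_le_pos; nra. }
  replace (2 ^ n * (M * (C1 + C2)) * c lam * (e1 + e2))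
    with (2 ^ n * (M * (C1 + C2)) * (e1 + e2) * c lam) by ring.
  apply Rmult_le_compat_r; [exact Hc0|]. nra.
Qed.

Lemma at_right_pos_id : at_right 0 (fun x => 0 < x).
Proof. apply at_right_pos with 1; intros; lra. Qed.

Lemma at_right_lt (e : posreal) : at_right 0 (fun x => 0 < x < e).
Proof. apply at_right_pos with e; [apply cond_pos|auto]. Qed.

Lemma cintg_unique Fa Fb {FFa : ProperFilter' Fa} {FFb : ProperFilter' Fb} (f : R -> C) (v w : C) :
  cintg f Fa Fb v -> cintg f Fa Fb w -> v = w.
Proof.
  intros Hv Hw. rewrite <- (is_RInt_gen_unique (V := C_R_CompleteNormedModule) _ _ Hv).
  exact (is_RInt_gen_unique (V := C_R_CompleteNormedModule) _ _ Hw).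
Qed.

Lemma Cmod_lt_ball (v w : C) (e : posreal) : Cmod (w - v)%C < e -> ball (M := C_UniformSpace) v e w.
Proof. intros H. apply C_NormedModule_mixin_compat1. exact H. Qed.

(** [th0] fixes the limit by Cauchy's criterion; the pair estimate then transfers this limit to
    every other regularizer. *)
Lemma osc_limit_exists p rho s lam A B f th0 :
  0 < p -> - p <= rho -> rho < 0 -> 0 < A + p -> 0 < lam -> s = 1 \/ s = -1 ->
  (forall n, exists M, sym p rho n A B M f) -> regularizer p rho th0 ->
  exists l : C, forall th, regularizer p rho th ->
    filterlimi (fun eps => is_RInt_gen (V := C_R_NormedModule)
      (osc s lam p (fun x => f x * th eps x)%C) (at_right 0) (Rbar_locally p_infty))
      (at_right 0) (locally (T := C_UniformSpace) l).
Proof.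
  intros Hp Hrho1 Hrho HAp Hl Hs Hf H0.
  assert (Hlim : exists l : C, filterlimi (fun eps => is_RInt_gen (V := C_R_NormedModule)
      (osc s lam p (fun x => f x * th0 eps x)%C) (at_right 0) (Rbar_locally p_infty))
      (at_right 0) (locally (T := C_R_CompleteNormedModule) l)).
  { destruct (regularizer_pair p rho th0 th0 s lam A B f) as (C0 & HC0 & H); auto.
    apply (filterlimi_locally_cauchy (U := C_R_CompleteNormedModule)).
    - eapply filter_imp; [|exact at_right_pos_id]. intros e He. simpl. split.
      + destruct (H e e He He) as (v1 & _ & Hv1 & _). now exists v1.
      + intros y1 y2 Hy1 Hy2. exact (cintg_unique _ _ _ _ _ Hy1 Hy2).
    (* The 2 accounts for the two parameters in e1 + e2; C0 + 1 instead of C0 keeps the quotient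
       meaningful when C0 = 0 and the final inequality strict. *)
    - intros eps. assert (Hd : 0 < eps / (2 * (C0 + 1))).
      { apply Rdiv_lt_0_compat; [apply cond_pos|lra]. }
      exists (fun x => 0 < x < mkposreal _ Hd). split; [apply at_right_lt|].
      intros u v [Hu Hu1] [Hv Hv1] u' v' Hu' Hv'. simpl in Hu1, Hv1.
      destruct (H v u Hv Hu) as (v1 & v2 & Hv1' & Hv2' & Hvv).
      rewrite (cintg_unique _ _ _ _ _ Hu' Hv2'), (cintg_unique _ _ _ _ _ Hv' Hv1').
      apply Cmod_lt_ball. eapply Rle_lt_trans; [exact Hvv|].
      apply Rle_lt_trans with (C0 * (2 * (eps / (2 * (C0 + 1))))).
      { apply Rmult_le_compat_l; lra. }
      replace (C0 * (2 * (eps / (2 * (C0 + 1))))) with (eps * (C0 / (C0 + 1))) by (field; lra).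
      rewrite <- (Rmult_1_r eps) at 2. apply Rmult_lt_compat_l; [apply cond_pos|].
      apply (Rmult_lt_reg_r (C0 + 1)); [lra|]. unfold Rdiv. rewrite Rmult_assoc, Rinv_l by lra. lra. }
  destruct Hlim as [l Hlim]. exists l. intros th Hth.
  destruct (regularizer_pair p rho th th0 s lam A B f) as (C0 & HC0 & H); auto.
  apply (filterlimi_locally (U := C_UniformSpace)). intros eps.
  pose proof (proj1 (filterlimi_locally (U := C_UniformSpace) _ _) Hlim (pos_div_2 eps)) as H1.
  assert (Hd : 0 < eps / (4 * (C0 + 1))).
  { apply Rdiv_lt_0_compat; [apply cond_pos|lra]. }
  eapply filter_imp; [|exact (filter_and _ _ H1 (at_right_lt (mkposreal _ Hd)))].
  intros e [(z & Hz & Bz) [He1 He2]]. simpl in He2.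
  destruct (H e e He1 He1) as (v1 & v2 & Hv1' & Hv2' & Hvv).
  rewrite (cintg_unique _ _ _ _ _ Hz Hv2') in Bz.
  exists v1. split; [exact Hv1'|].
  replace (pos eps) with (eps / 2 + eps / 2) by field.
  apply (ball_triangle (M := C_UniformSpace) l v2); [exact Bz|].
  apply (Cmod_lt_ball v2 v1 (pos_div_2 eps)). eapply Rle_lt_trans; [exact Hvv|]. simpl.
  apply Rle_lt_trans with (C0 * (2 * (eps / (4 * (C0 + 1))))).
  { apply Rmult_le_compat_l; lra. }
  replace (C0 * (2 * (eps / (4 * (C0 + 1))))) with (eps / 2 * (C0 / (C0 + 1))) by (field; lra).
  pose proof (cond_pos eps).
  rewrite <- (Rmult_1_r (eps / 2)) at 2. apply Rmult_lt_compat_l; [lra|].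
  apply (Rmult_lt_reg_r (C0 + 1)); [lra|]. unfold Rdiv. rewrite Rmult_assoc, Rinv_l by lra. lra.
Qed.

(** * The two kinds of regularizers: exponential damping and dilated Schwartz functions *)

Lemma nat_choice (P : nat -> R -> Prop) :
  (forall n, exists M, P n M) -> exists f, forall n, P n (f n).
Proof.
  intros H. exists (fun n => proj1_sig (constructive_indefinite_description _ (H n))).
  intros n. exact (proj2_sig (constructive_indefinite_description _ (H n))).
Qed.

(** Counterpart of [sym_of_derivs] for functions of x^p, whose iterates under D are explicit whereas
    their ordinary derivatives are not. *)
Lemma sym_of_chain p rho n : forall A B (Mj : nat -> R), (forall j, 0 <= Mj j) ->
  exists C0, 0 <= C0 /\ forall (t : R) (F : nat -> R -> C), 0 <= t ->
    (forall j x, 0 < x -> cderiv (F j) x (RtoC (Rpower x (p - 1)) * F (S j) x)%C) ->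
    (forall j x, 0 < x -> Cmod (F j x) <= t * Mj j * wt (A - INR j * p) (B + INR j * rho) x) ->
    sym p rho n A B (C0 * t) (F O).
Proof.
  induction n; intros A B Mj HMj.
  - exists (Mj O). split; [auto|]. intros t F Ht HF Hb. split.
    + intros x Hx. specialize (Hb O x Hx). simpl in Hb.
      rewrite !Rmult_0_l, Rminus_0_r, Rplus_0_r in Hb. lra.
    + intros x Hx. eapply cderiv_ccont; auto.
  - destruct (IHn (A - p) (B + rho) (fun j => Mj (S j))) as (C1 & HC1 & H1); [intros; auto|].
    exists (Mj O + C1). split; [pose proof (HMj O); lra|].
    intros t F Ht HF Hb. split.
    + intros x Hx. specialize (Hb O x Hx). simpl in Hb.
      rewrite !Rmult_0_l, Rminus_0_r, Rplus_0_r in Hb. pose proof (wt_pos A B x).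
      assert (0 <= C1 * t * wt A B x) by (apply Rmult_le_pos; nra). lra.
    + exists (F 1%nat). split; [auto|]. eapply sym_le; [apply Rle_refl|apply Rle_refl| |].
      2:{ apply (H1 t (fun j => F (S j))); auto. intros j x Hx. specialize (Hb (S j) x Hx).
          rewrite S_INR in Hb. replace (A - p - INR j * p) with (A - (INR j + 1) * p) by ring.
          replace (B + rho + INR j * rho) with (B + (INR j + 1) * rho) by ring. exact Hb. }
      pose proof (HMj O). nra.
Qed.

(** Halving the argument drives the induction: e^u = e^{u/2} e^{u/2}, where one factor bounds
    (u/2)^j by the induction hypothesis and the other bounds u/2. *)
Lemma pow_exp_bound (j : nat) : exists c, 0 <= c /\ forall u, 0 <= u -> u ^ j * exp (- u) <= c.
Proof.
  assert (H : exists c, 0 <= c /\ forall u, 0 <= u -> u ^ j <= c * exp u).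
  { induction j as [|j (c & Hc & IH)].
    - exists 1. split; [lra|]. intros u Hu. simpl. pose proof (exp_ineq1_le u). lra.
    - exists (2 ^ S j * c). split; [apply Rmult_le_pos; [apply pow_le; lra|exact Hc]|].
      intros u Hu. specialize (IH (u / 2) ltac:(lra)).
      pose proof (exp_ineq1_le (u / 2)) as E.
      replace (u ^ S j) with (2 ^ S j * ((u / 2) ^ j * (u / 2))).
      2:{ replace u with (2 * (u / 2)) at 3 by field. rewrite Rpow_mult_distr. simpl. ring. }
      replace (exp u) with (exp (u / 2) * exp (u / 2)) by (rewrite <- exp_plus; f_equal; field).
      rewrite Rmult_assoc. apply Rmult_le_compat_l; [apply pow_le; lra|].
      rewrite <- Rmult_assoc. apply Rmult_le_compat; try lra. apply pow_le; lra. }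
  destruct H as (c & Hc & H). exists c. split; [exact Hc|]. intros u Hu.
  specialize (H u Hu). rewrite exp_Ropp. apply (Rmult_le_reg_r (exp u)); [apply exp_pos|].
  rewrite Rmult_assoc, Rinv_l; [lra|]. pose proof (exp_pos u). lra.
Qed.

Lemma Rpower_le_wt a A B x : 0 < x -> A <= a -> a <= B -> Rpower x a <= wt A B x.
Proof. intros Hx HA HB. rewrite <- wt_diag. now apply wt_le. Qed.

Lemma Rpower_mult_INR x p (j : nat) : Rpower x (- (INR j * p)) = / Rpower x p ^ j.
Proof.
  rewrite <- Rpower_pow by apply Rpower_pos. rewrite Rpower_mult, Rpower_Ropp.
  now rewrite (Rmult_comm p).
Qed.

(** D multiplies e^{-u}, with u = eps x^p, by -p eps. At order 0, |e^{-u} - 1| <= u dictates the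
    growth mu = p. At order j >= 1 one factor eps is kept and the others form u^{j-1} e^{-u}
    x^{-(j-1)p}, a power that rho >= -p makes admissible. *)
Lemma exp_regularizer p rho : 0 < p -> - p <= rho -> rho < 0 ->
  regularizer p rho (fun eps x => RtoC (exp (- (eps * Rpower x p)))).
Proof.
  intros Hp Hrho Hrho0. exists p. split; [lra|]. intros n.
  destruct (nat_choice (fun j c => 0 <= c /\ forall u, 0 <= u -> u ^ j * exp (- u) <= c) pow_exp_bound)
    as [c Hc].
  assert (Hder : forall eps j x, 0 < x ->
    cderiv (fun x => RtoC ((- (p * eps)) ^ j * exp (- (eps * Rpower x p)))) x
      (RtoC (Rpower x (p - 1)) * RtoC ((- (p * eps)) ^ S j * exp (- (eps * Rpower x p))))%C).
  { intros eps j x Hx. rewrite <- RtoC_mult. apply cderiv_RtoC.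
    evar_last.
    { apply is_derive_scal. apply (is_derive_comp exp (fun x => - (eps * Rpower x p))).
      - apply is_derive_exp.
      - apply (is_derive_opp (fun x => eps * Rpower x p)). apply is_derive_scal.
        now apply is_derive_Rpower. }
    unfold scal, opp; simpl. unfold mult; simpl. ring. }
  set (Mj := fun j => match j with O => 1 | S i => p ^ S i * c i end).
  assert (Hpj : forall j, 0 <= p ^ j) by (intros; apply pow_le; lra).
  assert (HMj : forall j, 0 <= Mj j).
  { intros [|j]; [simpl; lra|]. change (0 <= p ^ S j * c j).
    apply Rmult_le_pos; [apply Hpj|apply Hc]. }
  destruct (sym_of_chain p rho n 0 p Mj HMj) as (C0 & HC0 & H0).
  exists C0. intros eps Heps. split.
  - apply (sym_ext p rho n 0 p (C0 * eps)
      (fun x => RtoC ((- (p * eps)) ^ 0 * exp (- (eps * Rpower x p))) - 1)%C).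
    { intros x Hx. simpl. now rewrite Rmult_1_l. }
    apply (H0 eps (fun j x => (RtoC ((- (p * eps)) ^ j * exp (- (eps * Rpower x p)))
      - RtoC (match j with O => 1 | _ => 0 end))%C)); [lra| |].
    + intros j x Hx. simpl (RtoC (match S j with O => 1 | _ => 0 end)).
      replace (RtoC (Rpower x (p - 1)) *
        (RtoC ((- (p * eps)) ^ S j * exp (- (eps * Rpower x p))) - RtoC 0))%C
      with (RtoC (Rpower x (p - 1)) * RtoC ((- (p * eps)) ^ S j * exp (- (eps * Rpower x p)))
         + - RtoC 1 * RtoC 0)%C by ring.
      apply (cderiv_ext_loc (fun x => (RtoC ((- (p * eps)) ^ j * exp (- (eps * Rpower x p)))
         + - RtoC 1 * RtoC (match j with O => 1 | _ => 0 end))%C)).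
      { apply filter_forall. intros t. ring. }
      apply cderiv_plus; [auto|]. apply cderiv_scal, cderiv_const.
    + intros [|j] x Hx.
      * simpl. rewrite Rmult_1_l, <- RtoC_minus, Cmod_R, !Rmult_0_l.
        pose proof (Rpower_pos x p). set (u := eps * Rpower x p).
        assert (Hu : 0 < u) by (unfold u; nra).
        pose proof (exp_ineq1_le (- u)).
        assert (exp (- u) <= 1) by (rewrite <- exp_0; left; apply exp_increasing; lra).
        rewrite Rabs_left1 by lra.
        assert (Rpower x p <= wt (0 - 0) (p + 0) x) by (apply Rpower_le_wt; lra).
        assert (u <= eps * wt (0 - 0) (p + 0) x) by (apply Rmult_le_compat_l; lra). lra.
      * simpl (match S j with O => 1 | _ => 0 end).
        replace (RtoC ((- (p * eps)) ^ S j * exp (- (eps * Rpower x p))) - RtoC 0)%C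
          with (RtoC ((- (p * eps)) ^ S j * exp (- (eps * Rpower x p)))) by ring.
        rewrite Cmod_R, Rabs_mult, <- RPow_abs, Rabs_Ropp, Rabs_pos_eq by nra.
        rewrite (Rabs_pos_eq (exp _)) by (left; apply exp_pos).
        pose proof (Rpower_pos x p) as HX. set (X := Rpower x p) in *.
        destruct (Hc j) as [Hcj Hcu]. specialize (Hcu (eps * X) ltac:(nra)).
        assert (W : / X ^ j <= wt (0 - INR (S j) * p) (p + INR (S j) * rho) x).
        { unfold X. rewrite <- Rpower_mult_INR. rewrite S_INR. pose proof (pos_INR j).
          apply Rpower_le_wt; nra. }
        assert (HXj : 0 < X ^ j) by now apply pow_lt.
        change (Mj (S j)) with (p ^ S j * c j).
        apply Rle_trans with (eps * (p ^ S j * c j) * / X ^ j).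
        -- replace ((p * eps) ^ S j * exp (- (eps * X)))
             with (eps * (p ^ S j * ((eps * X) ^ j * exp (- (eps * X)))) * / X ^ j).
           2:{ rewrite !Rpow_mult_distr. simpl. field. lra. }
           apply Rmult_le_compat_r; [left; now apply Rinv_0_lt_compat|].
           apply Rmult_le_compat_l; [lra|]. apply Rmult_le_compat_l; [apply Hpj|exact Hcu].
        -- apply Rmult_le_compat_l; [|exact W]. apply Rmult_le_pos; [lra|].
           apply Rmult_le_pos; [apply Hpj|exact Hcj].
  (* Decay x^{-J} is bought with [m] more factors of u, at the price of eps^{-m}; this constant may
     depend on eps. In [Nj], the first term serves (0, 1) and the second [1, oo). *)
  - intros J. destruct (exists_nat_gt (INR J) p Hp) as [m Hm].
    set (Nj := fun j => p ^ j * (c j + c (j + m)%nat * / eps ^ m)).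
    assert (Hem : 0 < / eps ^ m) by (apply Rinv_0_lt_compat, pow_lt; lra).
    assert (HNj : forall j, 0 <= Nj j).
    { intros j. unfold Nj. apply Rmult_le_pos; [apply Hpj|].
      pose proof (proj1 (Hc j)). pose proof (proj1 (Hc (j + m)%nat)). nra. }
    destruct (sym_of_chain p rho n 0 (- INR J) Nj HNj) as (C1 & HC1 & H1).
    exists (C1 * 1).
    apply (sym_ext p rho n 0 (- INR J) (C1 * 1)
      (fun x => RtoC ((- (p * eps)) ^ 0 * exp (- (eps * Rpower x p))))).
    { intros x Hx. simpl. now rewrite Rmult_1_l. }
    apply (H1 1 (fun j x => RtoC ((- (p * eps)) ^ j * exp (- (eps * Rpower x p))))); [lra|auto|].
    intros j x Hx.
    rewrite Cmod_R, Rabs_mult, <- RPow_abs, Rabs_Ropp, Rabs_pos_eq by nra.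
    rewrite (Rabs_pos_eq (exp _)) by (left; apply exp_pos).
    pose proof (Rpower_pos x p) as HX. 
    destruct (Hc j) as [Hcj Hcu]. specialize (Hcu (eps * Rpower x p) ltac:(nra)).
    destruct (Hc (j + m)%nat) as [Hcm Hcmu]. specialize (Hcmu (eps * Rpower x p) ltac:(nra)).
    rewrite Rmult_1_l, Rpow_mult_distr. unfold Nj. rewrite !Rmult_assoc.
    apply Rmult_le_compat_l; [apply Hpj|].
    unfold wt. destruct (Rlt_dec x 1) as [L|L].
    + replace (0 - INR j * p) with (- (INR j * p)) by ring. rewrite Rpower_mult_INR.
      set (X := Rpower x p) in *. assert (HXj : 0 < X ^ j) by now apply pow_lt.
      apply Rle_trans with (c j * / X ^ j).
      * replace (eps ^ j * exp (- (eps * X))) with ((eps * X) ^ j * exp (- (eps * X)) * / X ^ j).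
        2:{ rewrite Rpow_mult_distr. field. lra. }
        apply Rmult_le_compat_r; [left; now apply Rinv_0_lt_compat|exact Hcu].
      * apply Rmult_le_compat_r; [left; now apply Rinv_0_lt_compat|]. nra.
    + apply Rle_trans with (c (j + m)%nat * / eps ^ m * Rpower x (- (INR (j + m) * p))).
      * rewrite Rpower_mult_INR.
        set (X := Rpower x p) in *. assert (HXj : 0 < X ^ j) by now apply pow_lt.
        assert (HXm : 0 < X ^ m) by now apply pow_lt.
        assert (Hep : 0 < eps ^ m) by (apply pow_lt; lra).
        replace (eps ^ j * exp (- (eps * X)))
          with ((eps * X) ^ (j + m) * exp (- (eps * X)) * / eps ^ m * / X ^ (j + m)).
        2:{ rewrite Rpow_mult_distr, !pow_add. field. repeat split; lra. }
        apply Rmult_le_compat_r; [left; apply Rinv_0_lt_compat; now apply pow_lt|].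
        apply Rmult_le_compat_r; [lra|exact Hcmu].
      * apply Rmult_le_compat; [nra|left; apply Rpower_pos|nra|].
        apply Rle_Rpower; [lra|]. rewrite plus_INR. pose proof (pos_INR j). nra.
Qed.

Lemma smooth_cderiv (f : R -> C) : smooth f ->
  forall j x, cderiv (CDerive_n f j) x (CDerive_n f (S j) x).
Proof.
  intros Hf j x. destruct (Hf (S j) x) as [H1 H2]. simpl in H1, H2.
  unfold CDerive_n. simpl Derive_n.
  apply cderiv_pair; unfold Re, Im; simpl; apply Derive_correct; assumption.
Qed.

Lemma Cmod_le_Re_Im (z : C) : Cmod z <= Rabs (Re z) + Rabs (Im z).
Proof.
  destruct z as [a b]. replace (a, b) with (RtoC a + Ci * RtoC b)%C.
  - eapply Rle_trans; [apply Cmod_triangle|]. rewrite Cmod_mult, Cmod_Ci, !Cmod_R.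
    unfold Re, Im, RtoC, Ci, Cmult, Cplus; simpl. apply Req_le. f_equal; [f_equal|rewrite Rmult_1_l; f_equal]; ring.
  - unfold RtoC, Ci, Cmult, Cplus; simpl. f_equal; ring.
Qed.

Lemma im_le_Cmod (z : C) : Rabs (Im z) <= Cmod z.
Proof. eapply Rle_trans; [|apply Rmax_Cmod]. apply Rmax_r. Qed.

(** The mean value inequality is applied to the real and imaginary parts separately, hence the
    factor 2. Its hypothesis covers a ball around [x], so also points on the side away from [y]. *)
Lemma cderiv_increment (f g : R -> C) (M x y : R) :
  (forall t, cderiv f t (g t)) -> (forall t, Rabs (t - x) <= Rabs (y - x) -> Cmod (g t) <= M) ->
  Cmod (f y - f x)%C <= 2 * M * Rabs (y - x).
Proof.
  intros Hd HM. eapply Rle_trans; [apply Cmod_le_Re_Im|].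
  replace (2 * M * Rabs (y - x)) with (M * Rabs (y - x) + M * Rabs (y - x)) by ring.
  apply Rplus_le_compat.
  - apply (bounded_variation (fun t => Re (f t)) (fun t => Re (g t))).
    intros t Ht. split; [apply cderiv_Re, Hd|]. eapply Rle_trans; [apply re_le_Cmod|auto].
  - apply (bounded_variation (fun t => Im (f t)) (fun t => Im (g t))).
    intros t Ht. split; [apply cderiv_Im, Hd|]. eapply Rle_trans; [apply im_le_Cmod|auto].
Qed.

Lemma CDerive_n_0 (f : R -> C) x : CDerive_n f 0 x = f x.
Proof. unfold CDerive_n; simpl. unfold Re, Im. now destruct (f x). Qed.

(** Here mu = 1, as chi(eps x) - chi(0) = O(eps x). For j >= 1 the derivative eps^j chi^(j)(eps x)
    is written as eps (eps x)^{j-1} chi^(j)(eps x) x^{-(j-1)}: a single eps is kept, the Schwartz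
    bound of weight j - 1 takes the rest, and delta >= -1 admits the power of x. *)
Lemma schwartz_regularizer p delta chi : 0 < p -> -1 <= delta -> delta < p - 1 ->
  schwartz chi -> chi 0 = RtoC 1 ->
  regularizer p (delta + 1 - p) (fun eps x => chi (eps * x)).
Proof.
  intros Hp Hd1 Hd2 [Hs HS] H0. exists 1. split; [lra|]. intros n.
  assert (HP : forall m, exists f, forall k, 0 <= f k /\
     forall x, Rabs x ^ (k + m) * Cmod (CDerive_n chi k x) <= f k).
  { intros m. apply (nat_choice (fun k M => 0 <= M /\
      forall x, Rabs x ^ (k + m) * Cmod (CDerive_n chi k x) <= M)).
    intros k. destruct (HS (k + m)%nat k) as [M HM]. exists M. split; [|exact HM].
    eapply Rle_trans; [|apply (HM 0)]. apply Rmult_le_pos; [apply pow_le, Rabs_pos|apply Cmod_ge_0]. }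
  assert (HQ : exists f, forall k, 0 <= f k /\
     forall x, Rabs x ^ (k - 1) * Cmod (CDerive_n chi k x) <= f k).
  { apply (nat_choice (fun k M => 0 <= M /\
      forall x, Rabs x ^ (k - 1) * Cmod (CDerive_n chi k x) <= M)).
    intros k. destruct (HS (k - 1)%nat k) as [M HM]. exists M. split; [|exact HM].
    eapply Rle_trans; [|apply (HM 0)]. apply Rmult_le_pos; [apply pow_le, Rabs_pos|apply Cmod_ge_0]. }
  assert (Hder : forall eps j x, cderiv (fun x => (RtoC (eps ^ j) * CDerive_n chi j (eps * x))%C) x
     (RtoC (eps ^ S j) * CDerive_n chi (S j) (eps * x))%C).
  { intros eps j x. replace (RtoC (eps ^ S j) * CDerive_n chi (S j) (eps * x))%C
      with (RtoC (eps ^ j) * (RtoC eps * CDerive_n chi (S j) (eps * x)))%C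
      by (simpl; rewrite RtoC_mult; ring).
    apply cderiv_scal. apply (cderiv_comp (CDerive_n chi j) (fun x => eps * x)).
    - evar_last; [apply is_derive_scal, is_derive_id|]. unfold one; simpl. ring.
    - now apply smooth_cderiv. }
  destruct HQ as [q Hq].
  set (Mj := fun j => match j with O => 2 * q 1%nat | _ => q j end).
  assert (HMj : forall j, 0 <= Mj j).
  { intros [|j]; simpl Mj; [pose proof (proj1 (Hq 1%nat)); lra|apply Hq]. }
  destruct (sym_of_derivs p delta n Hd1 0 1 Mj HMj) as (C0 & HC0 & HC).
  exists C0. intros eps Heps. split.
  - apply (sym_ext p _ n 0 1 (C0 * eps)
      (fun x => RtoC (eps ^ 0) * CDerive_n chi 0 (eps * x) - 1)%C).
    { intros x Hx. simpl. rewrite CDerive_n_0. ring. }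
    apply (HC eps (fun j x => (RtoC (eps ^ j) * CDerive_n chi j (eps * x)
      - RtoC (match j with O => 1 | _ => 0 end))%C)); [lra| |].
    + intros j x Hx. simpl (RtoC (match S j with O => 1 | _ => 0 end)).
      replace (RtoC (eps ^ S j) * CDerive_n chi (S j) (eps * x) - RtoC 0)%C
      with (RtoC (eps ^ S j) * CDerive_n chi (S j) (eps * x) + - RtoC 1 * RtoC 0)%C by ring.
      apply (cderiv_ext_loc (fun x => (RtoC (eps ^ j) * CDerive_n chi j (eps * x)
         + - RtoC 1 * RtoC (match j with O => 1 | _ => 0 end))%C)).
      { apply filter_forall. intros t. ring. }
      apply cderiv_plus; [auto|]. apply cderiv_scal, cderiv_const.
    + intros [|j] x Hx.
      * simpl. rewrite CDerive_n_0, Cmult_1_l, <- H0, !Rmult_0_r.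
        eapply Rle_trans; [apply (cderiv_increment chi (CDerive_n chi 1) (q 1%nat) 0 (eps * x))|].
        -- intros t. generalize (smooth_cderiv chi Hs 0 t). apply cderiv_ext_loc.
           apply filter_forall. intros y. apply CDerive_n_0.
        -- intros t _. pose proof (proj2 (Hq 1%nat) t) as H. simpl in H. lra.
        -- rewrite Rminus_0_r, Rabs_pos_eq by nra.
           assert (x <= wt (0 - 0) (1 + 0) x).
           { rewrite <- (Rpower_1 x) at 1 by lra. apply Rpower_le_wt; lra. }
           pose proof (proj1 (Hq 1%nat)).
           replace (2 * q 1%nat * (eps * x)) with (eps * (2 * q 1%nat) * x) by ring.
           apply Rmult_le_compat_l; [nra|auto].
      * simpl (match S j with O => 1 | _ => 0 end).
        replace (RtoC (eps ^ S j) * CDerive_n chi (S j) (eps * x) - RtoC 0)%C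
          with (RtoC (eps ^ S j) * CDerive_n chi (S j) (eps * x))%C by ring.
        rewrite Cmod_mult, Cmod_R, Rabs_pos_eq by (apply pow_le; lra).
        pose proof (proj2 (Hq (S j)) (eps * x)) as H. replace (S j - 1)%nat with j in H by lia.
        rewrite Rabs_pos_eq in H by nra.
        assert (W : / x ^ j <= wt (0 - INR (S j)) (1 + delta * INR (S j)) x).
        { rewrite <- Rpower_pow, <- Rpower_Ropp by lra. rewrite S_INR. pose proof (pos_INR j).
          apply Rpower_le_wt; nra. }
        assert (Hxj : 0 < x ^ j) by now apply pow_lt.
        apply Rle_trans with (eps * q (S j) * / x ^ j).
        -- replace (eps ^ S j * Cmod (CDerive_n chi (S j) (eps * x)))
             with (eps * ((eps * x) ^ j * Cmod (CDerive_n chi (S j) (eps * x))) * / x ^ j).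
           2:{ rewrite Rpow_mult_distr. simpl. field. lra. }
           apply Rmult_le_compat_r; [left; now apply Rinv_0_lt_compat|].
           apply Rmult_le_compat_l; lra.
        -- apply Rmult_le_compat_l; [|exact W]. apply Rmult_le_pos; [lra|exact (HMj (S j))].
  (* Weight j suffices on (0, 1); on [1, oo) weight j + J gives the extra x^{-J}, at the price of
     eps^{-J}. *)
  - intros J. destruct (HP O) as [f0 Hf0], (HP J) as [fJ HfJ].
    set (Nj := fun j => f0 j + fJ j * / eps ^ J).
    assert (Hem : 0 < / eps ^ J) by (apply Rinv_0_lt_compat, pow_lt; lra).
    assert (HNj : forall j, 0 <= Nj j).
    { intros j. unfold Nj. pose proof (proj1 (Hf0 j)). pose proof (proj1 (HfJ j)). nra. }
    destruct (sym_of_derivs p delta n Hd1 0 (- INR J) Nj HNj) as (C1 & HC1 & H1).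
    exists (C1 * 1).
    apply (sym_ext p _ n 0 (- INR J) (C1 * 1)
      (fun x => RtoC (eps ^ 0) * CDerive_n chi 0 (eps * x))%C).
    { intros x Hx. simpl. rewrite CDerive_n_0. ring. }
    apply (H1 1 (fun j x => (RtoC (eps ^ j) * CDerive_n chi j (eps * x))%C)); [lra|auto|].
    intros j x Hx.
    rewrite Cmod_mult, Cmod_R, Rabs_pos_eq by (apply pow_le; lra).
    destruct (Hf0 j) as [P0 Q0]. specialize (Q0 (eps * x)). rewrite Rabs_pos_eq in Q0 by nra.
    destruct (HfJ j) as [PJ QJ]. specialize (QJ (eps * x)). rewrite Rabs_pos_eq in QJ by nra.
    rewrite Nat.add_0_r in Q0.
    rewrite Rmult_1_l. unfold Nj. set (D := Cmod (CDerive_n chi j (eps * x))) in *.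
    assert (Hxj : 0 < x ^ j) by now apply pow_lt.
    assert (HxJ : 0 < x ^ J) by now apply pow_lt.
    assert (HeJ : 0 < eps ^ J) by now apply pow_lt.
    unfold wt. destruct (Rlt_dec x 1) as [L|L].
    + replace (0 - INR j) with (- INR j) by ring. rewrite Rpower_Ropp, Rpower_pow by lra.
      apply Rle_trans with (f0 j * / x ^ j).
      * replace (eps ^ j * D) with ((eps * x) ^ j * D * / x ^ j).
        2:{ rewrite Rpow_mult_distr. field. lra. }
        apply Rmult_le_compat_r; [left; now apply Rinv_0_lt_compat|exact Q0].
      * apply Rmult_le_compat_r; [left; now apply Rinv_0_lt_compat|]. nra.
    + apply Rle_trans with (fJ j * / eps ^ J * Rpower x (- INR (j + J))).
      * rewrite Rpower_Ropp, Rpower_pow by lra.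
        replace (eps ^ j * D) with ((eps * x) ^ (j + J) * D * / eps ^ J * / x ^ (j + J)).
        2:{ rewrite Rpow_mult_distr, !pow_add. field. repeat split; lra. }
        apply Rmult_le_compat_r; [left; apply Rinv_0_lt_compat; now apply pow_lt|].
        apply Rmult_le_compat_r; lra.
      * apply Rmult_le_compat; [nra|left; apply Rpower_pos|nra|].
        apply Rle_Rpower; [lra|]. rewrite plus_INR. pose proof (pos_INR j). nra.
Qed.

(** The error [b] made by the regularization disappears in the limit, so the unregularized bound [K]
    survives. *)
Lemma filterlimi_Cmod_bound (F : R -> C -> Prop) (l : C) (K : R) (b : R -> R) :
  filterlimi F (at_right 0) (locally (T := C_UniformSpace) l) ->
  (forall eps, 0 < eps -> forall v, F eps v -> Cmod v <= K + b eps) ->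
  (forall d : posreal, at_right 0 (fun e => b e <= d)) ->
  Cmod l <= K.
Proof.
  intros Hl Hb Hd. apply le_epsilon. intros e He.
  assert (He2 : 0 < e / 4) by lra.
  pose proof (proj1 (filterlimi_locally (U := C_UniformSpace) _ _) Hl (mkposreal _ He2)) as H1.
  destruct (filter_ex _ (filter_and _ _ H1 (filter_and _ _ (Hd (mkposreal _ He2)) at_right_pos_id)))
    as (t & (v & Hv & Bv) & Hbt & Ht).
  specialize (Hb t Ht v Hv). simpl in Hbt.
  apply C_NormedModule_mixin_compat2 in Bv. simpl in Bv.
  (* Balls of C are squares, so radius e/4 only gives modulus below sqrt 2 times e/4, hence at most
     e/2; this leaves room for the e/4 spent on [b]. *)
  assert (Hs : sqrt 2 <= 2).
  { rewrite <- (sqrt_square 2) at 2 by lra. apply sqrt_le_1; lra. }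
  assert (Cmod l <= Cmod v + Cmod (minus (G := C_R_NormedModule) v l)).
  { change (minus (G := C_R_NormedModule) v l) with (v - l)%C. rewrite <- (Cmod_opp (v - l)%C).
    replace (Cmod l) with (Cmod (v + - (v - l))%C) by (f_equal; ring). apply Cmod_triangle. }
  change (Cmod (minus (G := C_R_NormedModule) v l) < sqrt 2 * (e / 4)) in Bv. nra.
Qed.

(** Raising B to B + mu is harmless, because the rate in lam depends on A alone. The constant is
    uniform in [s] and [lam], as the remainder estimate requires. *)
Lemma osc_limit_bound p rho A B f :
  0 < p -> - p <= rho -> rho < 0 -> 0 < A + p ->
  (forall n, exists M, sym p rho n A B M f) ->
  exists C0, 0 <= C0 /\ forall s lam l, s = 1 \/ s = -1 -> 1 <= lam ->
    (forall th, regularizer p rho th ->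
      filterlimi (fun eps => is_RInt_gen (V := C_R_NormedModule)
      (osc s lam p (fun x => f x * th eps x)%C) (at_right 0) (Rbar_locally p_infty))
      (at_right 0) (locally (T := C_UniformSpace) l)) ->
    Cmod l <= C0 * Rpower lam (- ((A + p) / p)).
Proof.
  intros Hp Hrho1 Hrho HAp Hf.
  pose proof (exp_regularizer p rho Hp Hrho1 Hrho) as Hreg.
  set (th := fun eps x => RtoC (exp (- (eps * Rpower x p)))) in *.
  destruct Hreg as (mu & Hmu & R1).
  destruct (exists_nat_gt (A + p) p Hp) as [n1 Hn1].
  destruct (exists_nat_gt (B + mu + p) (- rho) ltac:(lra)) as [n2 Hn2].
  set (n := (n1 + n2)%nat).
  assert (Hn : A - INR n * p + p < 0 /\ B + mu + INR n * rho + p < 0).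
  { unfold n. rewrite plus_INR. pose proof (pos_INR n1). pose proof (pos_INR n2). nra. }
  destruct (exists_nat_gt (B + p) 1 ltac:(lra)) as [J HJ].
  destruct (osc_integral p rho n A (B + mu) Hp Hrho HAp (proj1 Hn) (proj2 Hn)) as (c & Hc & C0 & HC0 & Hdec).
  destruct (Hf n) as [M HM]. pose proof (sym_const_nonneg _ _ _ _ _ _ _ HM) as HM0.
  destruct (R1 n) as [C1 H1].
  exists (M * C0). split; [nra|].
  intros s lam l Hs Hl Hlim.
  specialize (Hlim th (exp_regularizer p rho Hp Hrho1 Hrho)).
  destruct (Hc lam ltac:(lra)) as [Hc0 Hcl]. specialize (Hdec lam Hl).
  apply Rle_trans with (M * c lam); [|rewrite Rmult_assoc; now apply Rmult_le_compat_l].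
  apply (filterlimi_Cmod_bound _ l (M * c lam) (fun e => 2 ^ n * (M * (C1 * e)) * c lam) Hlim).
  - intros eps Heps v Hv. destruct (H1 eps Heps) as [S1 D1].
    destruct (D1 J) as [K HK].
    (* The splitting f th = f + f (th - 1) gives the constant M + O(eps), whose second part vanishes
       with eps. *)
    destruct (Hcl s (fun x => f x * th eps x)%C (M + 2 ^ n * (M * (C1 * eps))) (B + - INR J)
      (2 ^ n * (M * K)) Hs) as (w & Hw & Bw).
    + lra.
    + apply (sym_ext p rho n A (B + mu) (M + 2 ^ n * (M * (C1 * eps)))
        (fun x => f x + f x * (th eps x - 1))%C); [intros; ring|].
      apply sym_plus.
      * eapply sym_le; [| | |exact HM]; lra.
      * eapply sym_le; [| | |apply sym_mult; [exact HM|exact S1]]; lra.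
    + eapply sym_le; [| | |apply sym_mult; [exact HM|exact HK]]; lra.
    + rewrite (cintg_unique _ _ _ _ _ Hv Hw). lra.
  - intros d. set (Q := 2 ^ n * (M * Rabs C1) * c lam).
    assert (HQ : 0 <= Q).
    { unfold Q. apply Rmult_le_pos; [|exact Hc0]. apply Rmult_le_pos; [apply pow_le; lra|].
      apply Rmult_le_pos; [exact HM0|apply Rabs_pos]. }
    assert (Hd : 0 < d / (Q + 1)) by (apply Rdiv_lt_0_compat; [apply cond_pos|lra]).
    apply at_right_pos with (d / (Q + 1)); [exact Hd|]. intros x [Hx1 Hx2].
    apply Rle_trans with (Q * x).
    + unfold Q. pose proof (Rle_abs C1).
      replace (2 ^ n * (M * (C1 * x)) * c lam) with (C1 * (2 ^ n * M * c lam * x)) by ring.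
      replace (2 ^ n * (M * Rabs C1) * c lam * x) with (Rabs C1 * (2 ^ n * M * c lam * x)) by ring.
      apply Rmult_le_compat_r; [|assumption].
      apply Rmult_le_pos; [|lra]. apply Rmult_le_pos; [|exact Hc0].
      apply Rmult_le_pos; [apply pow_le; lra|exact HM0].
    + apply Rle_trans with (Q * (d / (Q + 1))); [apply Rmult_le_compat_l; lra|].
      replace (Q * (d / (Q + 1))) with (d * (Q / (Q + 1))) by (field; lra).
      rewrite <- (Rmult_1_r d) at 2. apply Rmult_le_compat_l; [left; apply cond_pos|].
      apply (Rmult_le_reg_r (Q + 1)); [lra|]. unfold Rdiv. rewrite Rmult_assoc, Rinv_l by lra. lra.
Qed.

(** * The Gamma constants *)

Lemma cintg_wt f a b M :
  0 < a -> b < 0 -> (forall x, 0 < x -> ccont f x) ->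
  (forall x, 0 < x -> Cmod (f x) <= M * wt (a - 1) (b - 1) x) ->
  exists v : C, cintg f (at_right 0) (Rbar_locally p_infty) v /\ Cmod v <= M * (/ a + / - b).
Proof.
  intros Ha Hb Hc HM.
  destruct (cintg_dominated (fun x => 0 < x <= 1) (at_right 0) (at_point 1)
    f (fun x => M * Rpower x (a - 1)) (M * (Rpower 1 a / a))) as (v1 & Hv1 & Bv1).
  - intros; lra.
  - apply at_right_pos with 1; intros; lra.
  - unfold at_point; lra.
  - apply filter_prod_at_right_point; lra.
  - intros x Hx. apply Hc; lra.
  - intros x Hx. apply continuous_phase; lra.
  - intros x Hx. pose proof (HM x ltac:(lra)) as H.
    rewrite wt_small in H by lra. exact H.
  - apply (is_RInt_gen_scal (V := R_NormedModule)). apply is_RInt_gen_Rpower_0; lra.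
  - destruct (cintg_dominated (fun x => 1 <= x) (at_point 1) (Rbar_locally p_infty)
      f (fun x => M * Rpower x (b - 1)) (M * (Rpower 1 b / - b))) as (v2 & Hv2 & Bv2).
    + intros; lra.
    + unfold at_point; lra.
    + exists 1; intros; lra.
    + apply filter_prod_point_infty.
    + intros x Hx. apply Hc; lra.
    + intros x Hx. apply continuous_phase; lra.
    + intros x Hx. pose proof (HM x ltac:(lra)) as H.
      unfold wt in H. destruct (Rlt_dec x 1); [lra|exact H].
    + apply (is_RInt_gen_scal (V := R_NormedModule)). apply is_RInt_gen_Rpower_infty; lra.
    + exists (v1 + v2)%C. split.
      { exact (is_RInt_gen_Chasles (V := C_R_NormedModule) f 1 v1 v2 Hv1 Hv2). }
      eapply Rle_trans; [apply Cmod_triangle|]. rewrite !Rpower_1_l in *. unfold Rdiv in *. lra.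
Qed.

Lemma cintg_Re f Fa Fb {FFa : Filter Fa} {FFb : Filter Fb} (l : C) :
  cintg f Fa Fb l -> is_RInt_gen (fun x => Re (f x)) Fa Fb (Re l).
Proof.
  intros H P HP.
  assert (HC : filterlim (fun z : C_UniformSpace => Re z) (locally l) (locally (Re l))).
  { destruct l as [u v]. exact (continuous_fst (U := R_UniformSpace) (V := R_UniformSpace) u v). }
  unfold filtermapi. eapply filter_imp; [|exact (H _ (HC P HP))].
  intros ab (y & Hy & HPy). exists (Re y). split; [|exact HPy].
  exact (is_RInt_fct_extend_fst (U := R_NormedModule) (V := R_NormedModule) f _ _ y Hy).
Qed.

Lemma cintg_RtoC f Fa Fb {FFa : Filter Fa} {FFb : Filter Fb} (l : R) :
  is_RInt_gen f Fa Fb l -> cintg (fun x => RtoC (f x)) Fa Fb (RtoC l).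
Proof.
  intros H P HP.
  assert (HC : filterlim RtoC (locally l) (locally (T := C_UniformSpace) (RtoC l))).
  { apply (ccont_RtoC (fun x => x)), continuous_id. }
  unfold filtermapi. eapply filter_imp; [|exact (H _ (HC P HP))].
  intros ab (y & Hy & HPy). exists (RtoC y). split; [|exact HPy].
  apply (is_RInt_fct_extend_pair (U := R_NormedModule) (V := R_NormedModule)); [exact Hy|].
  replace 0 with (scal (V := R_NormedModule) (snd ab - fst ab) 0).
  - apply (is_RInt_const (V := R_NormedModule)).
  - unfold scal; simpl; unfold mult; simpl; ring.
Qed.

(** The exponent [b] at infinity is free: [J] additional factors of x^p, with J p > -b, are absorbed
    by the exponential. *)
Lemma pow_exp_wt (k : nat) m p b : 0 < m -> 0 < p ->
  exists c, 0 <= c /\ forall x, 0 < x ->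
    Rpower x p ^ k * exp (- (m * Rpower x p)) <= c * wt 0 b x.
Proof.
  intros Hm Hp. destruct (exists_nat_gt (- b) p Hp) as [J HJ].
  destruct (pow_exp_bound (k + J)) as (c & Hc & H).
  assert (HmJ : 0 < m ^ (k + J)) by now apply pow_lt.
  exists (1 + c * / m ^ (k + J)). 
  assert (H0 : 0 <= c * / m ^ (k + J)).
  { apply Rmult_le_pos; [exact Hc|]. left; now apply Rinv_0_lt_compat. }
  split; [lra|]. intros x Hx. pose proof (Rpower_pos x p) as HX.
  unfold wt. destruct (Rlt_dec x 1) as [L|L].
  - rewrite Rpower_O by lra. 
    assert (HX1 : Rpower x p <= 1) by (rewrite <- (Rpower_O x Hx); apply Rpower_le_small; lra).
    assert (Rpower x p ^ k <= 1) by (rewrite <- (pow1 k); apply pow_incr; lra).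
    assert (0 <= Rpower x p ^ k) by (apply pow_le; lra).
    assert (exp (- (m * Rpower x p)) <= 1) by (rewrite <- exp_0; left; apply exp_increasing; nra).
    pose proof (exp_pos (- (m * Rpower x p))). nra.
  - specialize (H (m * Rpower x p) ltac:(nra)).
    apply Rle_trans with (c * / m ^ (k + J) * Rpower x (- (INR J * p))).
    + rewrite Rpower_mult_INR. set (X := Rpower x p) in *.
      assert (HXk : 0 < X ^ k) by now apply pow_lt. assert (HXJ : 0 < X ^ J) by now apply pow_lt.
      replace (X ^ k * exp (- (m * X)))
        with ((m * X) ^ (k + J) * exp (- (m * X)) * / m ^ (k + J) * / X ^ J).
      2:{ rewrite !Rpow_mult_distr, !pow_add. rewrite pow_add in HmJ. field.
          repeat split; try lra; apply Rgt_not_eq; now apply pow_lt. }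
      apply Rmult_le_compat_r; [left; now apply Rinv_0_lt_compat|].
      apply Rmult_le_compat_r; [left; now apply Rinv_0_lt_compat|exact H].
    + apply Rmult_le_compat; [lra|left; apply Rpower_pos|lra|]. apply Rle_Rpower; lra.
Qed.

Lemma is_RInt_gen_subst (f g dg : R -> R) (Fa Fb : (R -> Prop) -> Prop)
  {FFa : Filter Fa} {FFb : Filter Fb} (Ga Gb : (R -> Prop) -> Prop) (l : R) :
  Fa (fun x => 0 < x) -> Fb (fun x => 0 < x) ->
  (forall x, 0 < x -> 0 < g x) -> (forall t, 0 < t -> continuous f t) ->
  (forall x, 0 < x -> is_derive g x (dg x) /\ continuous dg x) ->
  filterlim g Fa Ga -> filterlim g Fb Gb ->
  is_RInt_gen f Ga Gb l -> is_RInt_gen (fun x => dg x * f (g x)) Fa Fb l.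
Proof.
  intros Ha Hb Hg Hf Hd La Lb H P HP. destruct (H P HP) as [Q R1 HQ HR HQR].
  exists (fun x => 0 < x /\ Q (g x)) (fun x => 0 < x /\ R1 (g x)).
  - apply filter_and; [exact Ha|exact (La Q HQ)].
  - apply filter_and; [exact Hb|exact (Lb R1 HR)].
  - intros a b [Ha0 Qa] [Hb0 Rb]. destruct (HQR _ _ Qa Rb) as (y & Hy & HPy).
    exists y. split; [|exact HPy]. simpl in *.
    rewrite <- (is_RInt_unique (V := R_CompleteNormedModule) _ _ _ _ Hy).
    assert (Hpos : forall x, Rmin a b <= x <= Rmax a b -> 0 < x).
    { intros x. unfold Rmin, Rmax. destruct (Rle_dec a b); lra. }
    apply (is_RInt_comp (V := R_CompleteNormedModule)); intros x Hx; auto.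
Qed.

(** [Gamma] is a value of [RInt_gen], which says something about the integral only once convergence
    is known; it follows from t^{z-1} near 0 and t^{-2} at infinity. *)
Lemma Gamma_correct z : 0 < z ->
  is_RInt_gen (fun t => Rpower t (z - 1) * exp (- t)) (at_right 0) (Rbar_locally p_infty) (Gamma z).
Proof.
  intros Hz. unfold Gamma. apply (RInt_gen_correct (V := R_CompleteNormedModule)).
  destruct (pow_exp_wt 0 1 1 (- (z + 1)) Rlt_0_1 Rlt_0_1) as (c & Hc & H).
  destruct (cintg_wt (fun t => RtoC (Rpower t (z - 1) * exp (- t))) z (-1) c) as (v & Hv & _);
    [lra|lra| | |].
  - intros x Hx. apply ccont_RtoC. apply (continuous_mult (K := R_AbsRing)).
    + now apply continuous_Rpower.
    + apply (ex_derive_continuous (fun t => exp (- t))). auto_derive. exact I.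
  - intros x Hx. specialize (H x Hx). rewrite pow_O, Rmult_1_l, Rmult_1_l, Rpower_1 in H by lra.
    rewrite Cmod_R, Rabs_pos_eq.
    2:{ left. apply Rmult_lt_0_compat; [apply Rpower_pos|apply exp_pos]. }
    replace (wt (z - 1) (-1 - 1) x) with (wt (z - 1) (z - 1) x * wt 0 (- (z + 1)) x).
    2:{ rewrite wt_mult. f_equal; ring. }
    rewrite wt_diag. pose proof (Rpower_pos x (z - 1)). nra.
  - exists (Re v). exact (cintg_Re (fun t => RtoC (Rpower t (z - 1) * exp (- t))) _ _ v Hv).
Qed.

Lemma filterlim_phase_0 lam p : 0 < lam -> 0 < p ->
  filterlim (fun x => lam * Rpower x p) (at_right 0) (at_right 0).
Proof.
  intros Hl Hp P [d Hd]. 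
  pose proof (filterlim_Rpower_0 p Hp) as H.
  pose proof (cond_pos d) as Hd0.
  assert (Hd1 : 0 < d / lam) by now apply Rdiv_lt_0_compat.
  pose proof (proj1 (filterlim_locally _ _) H (mkposreal _ Hd1)) as H1.
  unfold filtermap. eapply filter_imp; [|exact H1].
  intros x Hx. apply Hd; [|pose proof (Rpower_pos x p); nra].
  unfold ball in *; simpl in *; unfold AbsRing_ball, abs, minus, plus, opp in *; simpl in *.
  rewrite Ropp_0, Rplus_0_r in *. pose proof (Rpower_pos x p).
  rewrite Rabs_pos_eq in * by nra. apply (Rmult_lt_reg_r (/ lam)); [now apply Rinv_0_lt_compat|].
  replace (lam * Rpower x p * / lam) with (Rpower x p) by (field; lra). exact Hx.
Qed.

Lemma filterlim_phase_infty lam p : 0 < lam -> 0 < p ->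
  filterlim (fun x => lam * Rpower x p) (Rbar_locally p_infty) (Rbar_locally p_infty).
Proof.
  intros Hl Hp P [M HM]. 
  exists (Rmax 1 (Rpower (Rmax 1 (M / lam)) (/ p))). intros x Hx.
  apply HM. pose proof (Rmax_l 1 (Rpower (Rmax 1 (M / lam)) (/ p))).
  pose proof (Rmax_r 1 (Rpower (Rmax 1 (M / lam)) (/ p))).
  pose proof (Rmax_l 1 (M / lam)). pose proof (Rmax_r 1 (M / lam)).
  assert (Rmax 1 (M / lam) < Rpower x p).
  { apply Rle_lt_trans with (Rpower (Rpower (Rmax 1 (M / lam)) (/ p)) p).
    - rewrite Rpower_mult, Rinv_l, Rpower_1 by lra. lra.
    - apply Rlt_Rpower_l; [lra|]. split; [apply Rpower_pos|lra]. }
  assert (M / lam < Rpower x p) by lra.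
  apply (Rmult_lt_reg_r (/ lam)); [now apply Rinv_0_lt_compat|].
  replace (lam * Rpower x p * / lam) with (Rpower x p) by (field; lra). assumption.
Qed.

Lemma Rpower_Rmult (x y a : R) : 0 < x -> 0 < y -> Rpower (x * y) a = Rpower x a * Rpower y a.
Proof. intros. now rewrite Rpower_mult_distr. Qed.

(** Euler's integral under t = lam x^p; it provides the value at angle 0 of the rotated integrals
    below. *)
Lemma Gamma_subst p q lam : 0 < p -> 0 < q -> 0 < lam ->
  is_RInt_gen (fun x => Rpower x (q - 1) * exp (- (lam * Rpower x p))) (at_right 0) (Rbar_locally p_infty)
    (/ p * Rpower lam (- (q / p)) * Gamma (q / p)).
Proof.
  intros Hp Hq Hl. assert (Hz : 0 < q / p) by now apply Rdiv_lt_0_compat.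
  pose proof (is_RInt_gen_subst _ (fun x => lam * Rpower x p) (fun x => lam * (p * Rpower x (p - 1)))
    (at_right 0) (Rbar_locally p_infty) _ _ _ at_right_pos_id ltac:(exists 0; auto)
    ltac:(intros x Hx; apply Rmult_lt_0_compat; [exact Hl|apply Rpower_pos])
    ltac:(intros t Ht; apply (continuous_mult (K := R_AbsRing)); [now apply continuous_Rpower|
       apply (ex_derive_continuous (fun t => exp (- t))); auto_derive; exact I])
    ltac:(intros x Hx; split; [apply is_derive_scal; now apply is_derive_Rpower|
       apply (continuous_scal_r (V := R_NormedModule) lam (fun x => p * Rpower x (p - 1)));
       now apply continuous_phase])
    (filterlim_phase_0 lam p Hl Hp) (filterlim_phase_infty lam p Hl Hp) (Gamma_correct _ Hz)) as H.
  apply (is_RInt_gen_scal (V := R_NormedModule) _ (/ p * Rpower lam (- (q / p)))) in H.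
  eapply (is_RInt_gen_ext (V := R_NormedModule)); [|exact H].
  exists (fun x => 0 < x) (fun x => 0 < x); [apply at_right_pos_id|exists 0; auto|].
  intros a b Ha Hb x Hx. simpl in Hx.
  assert (Hx0 : 0 < x) by (apply Rlt_trans with (2 := proj1 Hx); now apply Rmin_case).
  unfold scal; simpl; unfold mult; simpl.
  rewrite Rpower_Rmult by (try apply Rpower_pos; lra). rewrite Rpower_mult.
  replace (q - 1) with (p - 1 + p * (q / p - 1)) by (field; lra).
  rewrite (Rpower_plus (p - 1)).
  replace (/ p * Rpower lam (- (q / p)) * (lam * (p * Rpower x (p - 1)) *
    (Rpower lam (q / p - 1) * Rpower x (p * (q / p - 1)) * exp (- (lam * Rpower x p)))))
  with ((Rpower lam (- (q / p)) * Rpower lam 1 * Rpower lam (q / p - 1)) *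
     (Rpower x (p - 1) * Rpower x (p * (q / p - 1)) * exp (- (lam * Rpower x p)))).
  2:{ rewrite (Rpower_1 lam Hl). field. lra. }
  rewrite <- !Rpower_plus. replace (- (q / p) + 1 + (q / p - 1)) with 0 by ring.
  rewrite Rpower_O by lra. ring.
Qed.

(** * Rotation of the ray without contour integrals *)

(** [rotW lam s z t th] is the exponent in
    [e^{-i s th z} e^{-lam t e^{-i s th}}], for [s = 1] or [s = -1]. *)
Definition rotW (lam s z t th : R) : C :=
  (- (lam * cos th * t), - (s * th * z) + s * lam * sin th * t).
Definition rotW' (lam s z t th : R) : C :=
  (lam * sin th * t, - (s * z) + s * lam * cos th * t).
Definition rotW'' (lam s t th : R) : C :=
  (lam * cos th * t, - (s * lam * sin th * t)).

Lemma cderiv_rotW lam s z t th : cderiv (rotW lam s z t) th (rotW' lam s z t th).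
Proof. apply cderiv_pair; unfold rotW, rotW', Re, Im; simpl; auto_derive; auto; ring. Qed.

Lemma cderiv_rotW' lam s z t th : cderiv (rotW' lam s z t) th (rotW'' lam s t th).
Proof. apply cderiv_pair; unfold rotW', rotW'', Re, Im; simpl; auto_derive; auto; ring. Qed.

Lemma Rabs_sign s : s = 1 \/ s = -1 -> Rabs s = 1.
Proof. intros [-> | ->]; [apply Rabs_R1|rewrite Rabs_left; lra]. Qed.

Lemma Rabs_cos_le x : Rabs (cos x) <= 1.
Proof. apply Rabs_le. apply COS_bound. Qed.

Lemma Rabs_sin_le x : Rabs (sin x) <= 1.
Proof. apply Rabs_le. apply SIN_bound. Qed.

Lemma Cmod_rotW' lam s z t th : s = 1 \/ s = -1 -> 0 < lam -> 0 < z -> 0 < t ->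
  Cmod (rotW' lam s z t th) <= 2 * lam * t + z.
Proof.
  intros Hs Hl Hz Ht. eapply Rle_trans; [apply Cmod_le_Re_Im|]. unfold rotW', Re, Im; simpl.
  pose proof (Rabs_cos_le th). pose proof (Rabs_sin_le th). pose proof (Rabs_sign s Hs) as As.
  assert (H1 : Rabs (lam * sin th * t) <= lam * t).
  { rewrite !Rabs_mult, (Rabs_pos_eq lam), (Rabs_pos_eq t) by lra. 
    assert (0 < lam * t) by nra. nra. }
  assert (H2 : Rabs (- (s * z) + s * lam * cos th * t) <= z + lam * t).
  { eapply Rle_trans; [apply Rabs_triang|].
    rewrite Rabs_Ropp, !Rabs_mult, As, (Rabs_pos_eq lam), (Rabs_pos_eq t), (Rabs_pos_eq z) by lra.
    assert (0 < lam * t) by nra. nra. }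
  lra.
Qed.

Lemma Cmod_rotW'' lam s t th : s = 1 \/ s = -1 -> 0 < lam -> 0 < t ->
  Cmod (rotW'' lam s t th) <= 2 * lam * t.
Proof.
  intros Hs Hl Ht. eapply Rle_trans; [apply Cmod_le_Re_Im|]. unfold rotW'', Re, Im; simpl.
  pose proof (Rabs_cos_le th). pose proof (Rabs_sin_le th). pose proof (Rabs_sign s Hs) as As.
  rewrite Rabs_Ropp, !Rabs_mult, As, (Rabs_pos_eq lam), (Rabs_pos_eq t) by lra.
  assert (0 < lam * t) by nra. nra.
Qed.

(** Second-order Taylor estimate in the angle. The damping at the extreme angle [th1] dominates the
    second derivative throughout, so the bound remains integrable in t; the 4 comes from two uses of
    [cderiv_increment]. *)
Lemma rot_taylor lam s z t th1 a b : s = 1 \/ s = -1 -> 0 < lam -> 0 < z -> 0 < t ->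
  0 <= a -> a <= b -> b <= th1 -> th1 < PI / 2 ->
  Cmod (Cexp (rotW lam s z t b) - Cexp (rotW lam s z t a)
    - RtoC (b - a) * (rotW' lam s z t a * Cexp (rotW lam s z t a)))%C
  <= 4 * ((2 * lam * t + (2 * lam * t + z) ^ 2) * exp (- (lam * cos th1 * t))) * (b - a) ^ 2.
Proof.
  intros Hs Hl Hz Ht Ha Hab Hb H1.
  set (K := (2 * lam * t + (2 * lam * t + z) ^ 2) * exp (- (lam * cos th1 * t))).
  set (F := fun th => Cexp (rotW lam s z t th)).
  set (F' := fun th => (rotW' lam s z t th * Cexp (rotW lam s z t th))%C).
  set (F'' := fun th => (rotW'' lam s t th * Cexp (rotW lam s z t th) +
     rotW' lam s z t th * (rotW' lam s z t th * Cexp (rotW lam s z t th)))%C).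
  assert (D1 : forall th, cderiv F th (F' th)).
  { intros th. apply cderiv_Cexp, cderiv_rotW. }
  assert (D2 : forall th, cderiv F' th (F'' th)).
  { intros th. apply cderiv_mult; [apply cderiv_rotW'|apply D1]. }
  (* Negative angles are included because the ball around [a] of radius b - a may cross 0; it stays
     within [-th1, th1]. *)
  assert (B2 : forall th, Rabs th <= th1 -> Cmod (F'' th) <= K).
  { intros th Hth. unfold F''. eapply Rle_trans; [apply Cmod_triangle|].
    rewrite !Cmod_mult, Cmod_Cexp. unfold rotW at 1 2. unfold Re; simpl.
    assert (Hc : cos th1 <= cos th).
    { replace (cos th) with (cos (Rabs th)).
      - apply cos_decr_1; try lra; try apply Rabs_pos.
      - unfold Rabs; destruct (Rcase_abs th); [apply cos_neg|reflexivity]. }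
    assert (He : exp (- (lam * cos th * t)) <= exp (- (lam * cos th1 * t))).
    { assert (lam * cos th1 * t <= lam * cos th * t).
      { apply Rmult_le_compat_r; [lra|]. apply Rmult_le_compat_l; lra. }
      destruct (Rle_lt_or_eq_dec _ _ H) as [L|L]; [left; apply exp_increasing; lra|rewrite L; lra]. }
    pose proof (Cmod_rotW' lam s z t th Hs Hl Hz Ht) as W1.
    pose proof (Cmod_rotW'' lam s t th Hs Hl Ht) as W2.
    pose proof (Cmod_ge_0 (rotW' lam s z t th)). pose proof (Cmod_ge_0 (rotW'' lam s t th)).
    set (e := exp (- (lam * cos th * t))) in *. pose proof (exp_pos (- (lam * cos th * t))) as He0. fold e in He0.
    assert (Cmod (rotW' lam s z t th) * Cmod (rotW' lam s z t th) <= (2 * lam * t + z) ^ 2).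
    { simpl. rewrite Rmult_1_r. apply Rmult_le_compat; lra. }
    replace (Cmod (rotW'' lam s t th) * e + Cmod (rotW' lam s z t th) * (Cmod (rotW' lam s z t th) * e))
      with ((Cmod (rotW'' lam s t th) + Cmod (rotW' lam s z t th) * Cmod (rotW' lam s z t th)) * e) by ring.
    unfold K. apply Rmult_le_compat; try lra. nra. }
  assert (B1 : forall th, Rabs (th - a) <= Rabs (b - a) -> Cmod (F' th - F' a)%C <= 2 * K * (b - a)).
  { intros th Hth. rewrite (Rabs_pos_eq (b - a)) in Hth by lra.
    assert (HK : 0 <= K).
    { eapply Rle_trans; [apply (Cmod_ge_0 (F'' a))|]. apply B2. rewrite Rabs_pos_eq; lra. }
    eapply Rle_trans; [apply (cderiv_increment F' F'' K a th D2)|].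
    - intros y Hy. apply B2. apply Rabs_le. 
      assert (Hy2 : Rabs (y - a) <= b - a) by lra. apply Rabs_le_between in Hy2. lra.
    - apply Rmult_le_compat_l; [lra|exact Hth]. }
  set (g := fun th => (F th + - F a + - (RtoC (th - a) * F' a))%C).
  pose proof (cderiv_increment g (fun th => (F' th + - F' a)%C) (2 * K * (b - a)) a b) as H.
  replace (4 * K * (b - a) ^ 2) with (2 * (2 * K * (b - a)) * Rabs (b - a))
    by (rewrite Rabs_pos_eq by lra; ring).
  replace (Cexp (rotW lam s z t b) - Cexp (rotW lam s z t a)
    - RtoC (b - a) * (rotW' lam s z t a * Cexp (rotW lam s z t a)))%C with (g b - g a)%C.
  2:{ unfold g, F, F'. rewrite Rminus_diag. ring. }
  apply H; [|exact B1].
  intros th. unfold g.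
  replace (F' th + - F' a)%C with (F' th + RtoC 0 + (- RtoC 1 * (RtoC 1 * F' a + RtoC (th - a) * RtoC 0)))%C by ring.
  apply cderiv_plus; [apply cderiv_plus; [apply D1|apply cderiv_const]|].
  apply (cderiv_ext_loc (fun th => (- RtoC 1 * (RtoC (th - a) * F' a))%C)).
  { apply filter_forall. intros y. ring. }
  apply cderiv_scal. apply (cderiv_mult (fun th => RtoC (th - a)) (fun _ => F' a)); [|apply cderiv_const].
  apply cderiv_RtoC. auto_derive; auto; ring.
Qed.

(** Over n equal steps the increments add up to at most n |K| (T/n)^2 = |K| T^2 / n, which tends to
    0. *)
Lemma constant_of_quadratic_increments (G : R -> C) (T K : R) :
  0 <= T -> (forall x y, 0 <= x -> x <= y -> y <= T -> Cmod (G y - G x)%C <= K * (y - x) ^ 2) ->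
  G T = G 0.
Proof.
  intros HT H.
  assert (HK : forall n : nat, (0 < n)%nat -> forall k : nat, (k <= n)%nat ->
    Cmod (G (INR k * (T / INR n))%R - G 0)%C <= INR k * (Rabs K * (T / INR n) ^ 2)).
  { intros n Hn. assert (Hn0 : 0 < INR n) by now apply lt_0_INR.
    assert (Hh : 0 <= T / INR n) by (apply Rmult_le_pos; [lra|left; now apply Rinv_0_lt_compat]).
    induction k as [|k IH]; intros Hk.
    - simpl. rewrite Rmult_0_l. replace (G 0 - G 0)%C with (RtoC 0) by ring. rewrite Cmod_0. lra.
    - specialize (IH ltac:(lia)).
      assert (Hk' : INR (S k) * (T / INR n) <= T).
      { apply Rle_trans with (INR n * (T / INR n)); [|right; field; lra].
        apply Rmult_le_compat_r; [exact Hh|now apply le_INR]. }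
      rewrite S_INR in *. pose proof (pos_INR k).
      pose proof (H (INR k * (T / INR n)) ((INR k + 1) * (T / INR n)) ltac:(nra) ltac:(nra) Hk') as H1.
      replace ((INR k + 1) * (T / INR n) - INR k * (T / INR n)) with (T / INR n) in H1 by ring.
      replace (G ((INR k + 1) * (T / INR n))%R - G 0)%C
        with ((G ((INR k + 1) * (T / INR n))%R - G (INR k * (T / INR n))%R) + (G (INR k * (T / INR n))%R - G 0))%C by ring.
      eapply Rle_trans; [apply Cmod_triangle|].
      assert (K * (T / INR n) ^ 2 <= Rabs K * (T / INR n) ^ 2).
      { apply Rmult_le_compat_r; [apply pow_le; exact Hh|apply Rle_abs]. }
      lra. }
  assert (Z : Cmod (G T - G 0)%C <= 0).
  { apply le_epsilon. intros e He. rewrite Rplus_0_l.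
    destruct (INR_unbounded (Rabs K * T ^ 2 / e)) as [n Hn].
    pose proof (Rabs_pos K). assert (0 <= T ^ 2) by (apply pow_le; lra).
    assert (Hn0 : 0 < INR n).
    { eapply Rle_lt_trans; [|exact Hn]. apply Rmult_le_pos; [nra|left; now apply Rinv_0_lt_compat]. }
    assert (Hn1 : (0 < n)%nat) by (apply INR_lt; simpl; lra).
    specialize (HK n Hn1 n (le_n n)).
    replace (INR n * (T / INR n)) with T in HK by (field; lra).
    eapply Rle_trans; [exact HK|].
    replace (INR n * (Rabs K * (T / INR n) ^ 2)) with (Rabs K * T ^ 2 * / INR n) by (field; lra).
    apply (Rmult_le_reg_r (INR n)); [lra|]. rewrite Rmult_assoc, Rinv_l by lra.
    apply (Rmult_lt_compat_r e) in Hn; [|exact He]. unfold Rdiv in Hn.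
    rewrite Rmult_assoc, Rinv_l in Hn by lra. lra. }
  pose proof (Cmod_ge_0 (G T - G 0)%C) as Z'.
  assert (E : (G T - G 0)%C = RtoC 0) by (apply Cmod_eq_0; lra).
  replace (G T) with ((G T - G 0) + G 0)%C by ring. rewrite E. ring.
Qed.

(** With z = q/p, the factor e^{-i s th q/p} inside [rotW] cancels the Jacobian e^{i s th q/p} that
    x = e^{i s th/p} y produces from x^{q-1} dx. *)
Definition rot_integrand (lam s p q th x : R) : C :=
  (Cexp (rotW lam s (q / p) (Rpower x p) th) * RtoC (Rpower x (q - 1)))%C.

Lemma cderiv_rotW_x lam s p z th x : 0 < x ->
  cderiv (fun x => rotW lam s z (Rpower x p) th) x
    (RtoC (p * Rpower x (p - 1)) * ((- (lam * cos th))%R, (s * lam * sin th)%R))%C.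
Proof.
  intros Hx. pose proof (is_derive_Rpower p x Hx) as D.
  apply cderiv_pair; unfold rotW, Re, Im; simpl.
  - evar_last.
    { apply (is_derive_opp (fun x => lam * cos th * Rpower x p)), is_derive_scal, D. }
    unfold opp; simpl; ring.
  - evar_last.
    { apply (is_derive_plus (fun _ => - (s * th * z)) (fun x => s * lam * sin th * Rpower x p)).
      - apply (is_derive_const (K := R_AbsRing) (V := R_NormedModule)).
      - apply is_derive_scal, D. }
    unfold plus, zero; simpl; ring.
Qed.

Lemma ccont_rot_integrand lam s p q th x : 0 < x -> ccont (rot_integrand lam s p q th) x.
Proof.
  intros Hx. apply ccont_mult.
  - eapply cderiv_ccont. apply cderiv_Cexp. now apply cderiv_rotW_x.
  - apply ccont_RtoC. now apply continuous_Rpower.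
Qed.

Lemma Cmod_rot_exp lam s z t th : Cmod (Cexp (rotW lam s z t th)) = exp (- (lam * cos th * t)).
Proof. rewrite Cmod_Cexp. reflexivity. Qed.

Lemma rot_weight p q m : 0 < m -> 0 < p -> forall k : nat, exists c, 0 <= c /\
  forall x, 0 < x -> Rpower x p ^ k * exp (- (m * Rpower x p)) * Rpower x (q - 1) <= c * wt (q - 1) (-1 - 1) x.
Proof.
  intros Hm Hp k. destruct (pow_exp_wt k m p (- q - 1) Hm Hp) as (c & Hc & H).
  exists c. split; [exact Hc|]. intros x Hx. specialize (H x Hx).
  replace (wt (q - 1) (-1 - 1) x) with (wt 0 (- q - 1) x * wt (q - 1) (q - 1) x)
    by (rewrite wt_mult; f_equal; ring).
  rewrite wt_diag. pose proof (Rpower_pos x (q - 1)).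
  rewrite <- Rmult_assoc. apply Rmult_le_compat_r; lra.
Qed.

Lemma rot_integral_ex lam s p q th : 0 < lam -> 0 < p -> 0 < q -> 0 < cos th ->
  exists v : C, cintg (rot_integrand lam s p q th) (at_right 0) (Rbar_locally p_infty) v.
Proof.
  intros Hl Hp Hq Hc.
  destruct (rot_weight p q (lam * cos th) ltac:(nra) Hp 0) as (c & Hc0 & H).
  destruct (cintg_wt (rot_integrand lam s p q th) q (-1) c) as (v & Hv & _);
    [lra|lra|intros; now apply ccont_rot_integrand| |now exists v].
  intros x Hx. specialize (H x Hx). unfold rot_integrand.
  rewrite Cmod_mult, Cmod_rot_exp, Cmod_R, Rabs_pos_eq by (left; apply Rpower_pos).
  rewrite pow_O, Rmult_1_l in H. exact H.
Qed.

(** The [th]-derivative of [rot_integrand] is the [x]-derivative of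
    [-(i s/p) x^q e^{rotW}], so rotating the ray leaves the integral constant. *)
Lemma rot_derivative_integral lam s p q th : s = 1 \/ s = -1 -> 0 < lam -> 0 < p -> 0 < q -> 0 < cos th ->
  cintg (fun x => rotW' lam s (q / p) (Rpower x p) th * rot_integrand lam s p q th x)%C
    (at_right 0) (Rbar_locally p_infty) (RtoC 0).
Proof.
  intros Hs Hl Hp Hq Hc.
  set (h := fun x => (- (Ci * RtoC (s / p)) * (Cexp (rotW lam s (q / p) (Rpower x p) th) * RtoC (Rpower x q)))%C).
  assert (E0 : minus (G := C_R_NormedModule) (RtoC 0) (RtoC 0) = RtoC 0).
  { change (0 - 0 = 0)%C. ring. }
  rewrite <- E0.
  assert (Hh : forall x, 0 < x -> Cmod (h x) = / p * (exp (- (lam * cos th * Rpower x p)) * Rpower x q)).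
  { intros x Hx. unfold h. rewrite !Cmod_mult, Cmod_opp, Cmod_mult, Cmod_Ci, Cmod_rot_exp, !Cmod_R.
    rewrite (Rabs_pos_eq (Rpower x q)) by (left; apply Rpower_pos).
    unfold Rdiv. rewrite Rabs_mult, (Rabs_sign s Hs), (Rabs_pos_eq (/ p)) by (left; now apply Rinv_0_lt_compat).
    ring. }
  assert (Hip : 0 < / p) by now apply Rinv_0_lt_compat.
  apply (RInt_gen_of_primitive (V := C_R_CompleteNormedModule) (fun x => 0 < x) _ _ h).
  - intros; lra.
  - apply at_right_pos_id.
  - exists 0; auto.
  - intros x Hx. unfold h. evar_last.
    { apply cderiv_scal, cderiv_mult; [apply cderiv_Cexp; now apply cderiv_rotW_x|].
      now apply cderiv_Rpower. }
    unfold rot_integrand. set (e := Cexp _).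
    replace (Rpower x q) with (Rpower x p * Rpower x (q - p)).
    2:{ rewrite <- Rpower_plus. f_equal; ring. }
    replace (Rpower x (q - 1)) with (Rpower x (p - 1) * Rpower x (q - p)).
    2:{ rewrite <- Rpower_plus. f_equal; ring. }
    set (X := Rpower x p). set (Y := Rpower x (p - 1)). set (Zq := Rpower x (q - p)).
    transitivity (e * (- (Ci * RtoC (s / p)) * (RtoC (p * Y) * ((- (lam * cos th))%R, (s * lam * sin th)%R) * RtoC (X * Zq) + RtoC (q * (Y * Zq)))))%C; [ring|].
    transitivity (e * (rotW' lam s (q / p) X th * RtoC (Y * Zq)))%C; [f_equal|ring].
    unfold rotW', Ci, RtoC, Cmult, Cplus, Copp; simpl.
    destruct Hs as [-> | ->]; f_equal; field; lra.
  - intros x Hx. apply ccont_mult; [|now apply ccont_rot_integrand].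
    apply ccont_pair; unfold rotW', Re, Im; simpl.
    + now apply continuous_phase.
    + apply (continuous_plus (fun _ => - (s * (q / p)))); [apply continuous_const|now apply continuous_phase].
  - apply (filterlim_norm_zero (V := C_R_NormedModule)).
    apply (filterlim_le_le (F := at_right 0) (fun _ => 0) _ (fun x => / p * Rpower x q) 0).
    + apply (at_right_pos _ 1 Rlt_0_1). intros x Hx. rewrite Cnorm_Cmod. split; [apply Cmod_ge_0|].
      rewrite Hh by lra. apply Rmult_le_compat_l; [lra|].
      pose proof (Rpower_pos x q). pose proof (Rpower_pos x p).
      assert (exp (- (lam * cos th * Rpower x p)) <= 1).
      { rewrite <- exp_0. left; apply exp_increasing. assert (0 < lam * cos th) by nra. nra. }
      nra.
    + apply filterlim_const.
    + assert (Z : / p * 0 = 0) by ring.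
      change (filterlim (fun x => / p * Rpower x q) (at_right 0) (locally 0)). rewrite <- Z at 2.
      eapply filterlim_comp; [apply (filterlim_Rpower_0 q); lra|].
      apply (filterlim_scal_r (V := R_NormedModule)).
  (* The exponent -q - 1 leaves x^{-1} after multiplication by the factor x^q of [h]. *)
  - destruct (pow_exp_wt 0 (lam * cos th) p (- q - 1) ltac:(nra) Hp) as (c & Hc0 & H).
    apply (filterlim_norm_zero (V := C_R_NormedModule)).
    apply (filterlim_le_le (F := Rbar_locally p_infty) (fun _ => 0) _ (fun x => / p * c * Rpower x (-1)) 0).
    + exists 1. intros x Hx. rewrite Cnorm_Cmod. split; [apply Cmod_ge_0|].
      rewrite Hh by lra. rewrite (Rmult_assoc (/ p) c). apply Rmult_le_compat_l; [lra|].
      specialize (H x ltac:(lra)). rewrite pow_O, Rmult_1_l in H.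
      unfold wt in H. destruct (Rlt_dec x 1); [lra|].
      replace (-1) with (- q - 1 + q) by ring. rewrite Rpower_plus.
      pose proof (Rpower_pos x q). nra.
    + apply filterlim_const.
    + assert (Z : / p * c * 0 = 0) by ring.
      change (filterlim (fun x => / p * c * Rpower x (-1)) (Rbar_locally p_infty) (locally 0)). rewrite <- Z.
      eapply filterlim_comp; [apply (filterlim_Rpower_infty (-1)); lra|].
      apply (filterlim_scal_r (V := R_NormedModule)).
Qed.

Lemma rot_value lam s p q th : s = 1 \/ s = -1 -> 0 < lam -> 0 < p -> 0 < q ->
  0 <= th -> th < PI / 2 ->
  cintg (rot_integrand lam s p q th) (at_right 0) (Rbar_locally p_infty)
    (RtoC (/ p * Rpower lam (- (q / p)) * Gamma (q / p))).
Proof.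
  intros Hs Hl Hp Hq Hth0 Hth1.
  assert (Hcos : forall t, 0 <= t -> t <= th -> 0 < cos t).
  { intros t H1 H2. apply cos_gt_0; lra. }
  set (G := fun t => RInt_gen (V := C_R_CompleteNormedModule) (rot_integrand lam s p q t)
    (at_right 0) (Rbar_locally p_infty)).
  assert (HG : forall t, 0 <= t -> t <= th ->
    cintg (rot_integrand lam s p q t) (at_right 0) (Rbar_locally p_infty) (G t)).
  { intros t H1 H2. apply (RInt_gen_correct (V := C_R_CompleteNormedModule)).
    destruct (rot_integral_ex lam s p q t Hl Hp Hq (Hcos t H1 H2)) as [v Hv]. now exists v. }
  assert (Hz : 0 < q / p) by now apply Rdiv_lt_0_compat.
  assert (HT : G th = G 0).
  (* [m] is the weakest damping among the angles in [0, th], so the three weights below serve all of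
     them. *)
  { set (m := lam * cos th). assert (Hm : 0 < m) by (unfold m; pose proof (Hcos th Hth0 (Rle_refl _)); nra).
    destruct (rot_weight p q m Hm Hp 0) as (c0 & Hc0 & H0).
    destruct (rot_weight p q m Hm Hp 1) as (c1 & Hc1 & H1).
    destruct (rot_weight p q m Hm Hp 2) as (c2 & Hc2 & H2).
    set (z := q / p) in *.
    (* The coefficients are those of 1, X and X^2 in 2 lam X + (2 lam X + z)^2, the polynomial in
       [rot_taylor]. *)
    set (M := z ^ 2 * c0 + (2 * lam + 4 * lam * z) * c1 + 4 * lam ^ 2 * c2).
    apply (constant_of_quadratic_increments G th (4 * M * (/ q + / - (-1))) Hth0).
    intros a b Ha Hab Hb.
    (* The first-order term integrates to 0, so the integral of this Taylor remainder is exactly G b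
       - G a, and it is quadratic in b - a. *)
    set (D := fun x => (rot_integrand lam s p q b x - rot_integrand lam s p q a x
       - RtoC (b - a) * (rotW' lam s z (Rpower x p) a * rot_integrand lam s p q a x))%C).
    destruct (cintg_wt D q (-1) (4 * M * (b - a) ^ 2)) as (w & Hw & Bw); [lra|lra| | |].
    - intros x Hx. unfold D. apply ccont_plus; [apply ccont_plus|].
      + now apply ccont_rot_integrand.
      + apply (continuous_opp (V := C_R_NormedModule)). now apply ccont_rot_integrand.
      + apply (continuous_opp (V := C_R_NormedModule)).
        apply ccont_mult; [apply continuous_const|]. apply ccont_mult; [|now apply ccont_rot_integrand].
        apply ccont_pair; unfold rotW', Re, Im; simpl.
        * now apply continuous_phase.
        * apply (continuous_plus (fun _ => - (s * z))); [apply continuous_const|now apply continuous_phase].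
    - intros x Hx. set (X := Rpower x p). assert (HX : 0 < X) by apply Rpower_pos.
      assert (E : D x = ((Cexp (rotW lam s z X b) - Cexp (rotW lam s z X a)
        - RtoC (b - a) * (rotW' lam s z X a * Cexp (rotW lam s z X a))) * RtoC (Rpower x (q - 1)))%C).
      { unfold D, rot_integrand. fold z. fold X. ring. }
      rewrite E, Cmod_mult, Cmod_R, Rabs_pos_eq by (left; apply Rpower_pos).
      pose proof (rot_taylor lam s z X th a b Hs Hl Hz HX Ha Hab Hb Hth1) as T. fold m in T.
      specialize (H0 x Hx). specialize (H1 x Hx). specialize (H2 x Hx). fold X in H0, H1, H2.
      pose proof (Rpower_pos x (q - 1)) as HY. set (Y := Rpower x (q - 1)) in *.
      set (e := exp (- (m * X))) in *. set (W := wt (q - 1) (-1 - 1) x) in *.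
      eapply Rle_trans; [apply Rmult_le_compat_r; [lra|exact T]|].
      replace (4 * ((2 * lam * X + (2 * lam * X + z) ^ 2) * e) * (b - a) ^ 2 * Y)
        with (4 * (b - a) ^ 2 * (z ^ 2 * (X ^ 0 * e * Y) + (2 * lam + 4 * lam * z) * (X ^ 1 * e * Y)
           + 4 * lam ^ 2 * (X ^ 2 * e * Y))) by ring.
      replace (4 * M * (b - a) ^ 2 * W) with (4 * (b - a) ^ 2 * (z ^ 2 * (c0 * W) +
         (2 * lam + 4 * lam * z) * (c1 * W) + 4 * lam ^ 2 * (c2 * W))) by (unfold M; ring).
      apply Rmult_le_compat_l; [pose proof (pow2_ge_0 (b - a)); lra|].
      apply Rplus_le_compat; [apply Rplus_le_compat|]; apply Rmult_le_compat_l; try assumption;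
        try (apply pow2_ge_0); try nra.
    - assert (Ew : w = (G b - G a - RtoC (b - a) * RtoC 0)%C).
      { apply (cintg_unique _ _ _ _ _ Hw).
        apply (is_RInt_gen_minus (V := C_R_NormedModule)
          (fun x => minus (G := C_R_NormedModule) (rot_integrand lam s p q b x) (rot_integrand lam s p q a x))).
        - apply (is_RInt_gen_minus (V := C_R_NormedModule)); apply HG; lra.
        - apply (cintg_scal _ _ _ _ _ (rot_derivative_integral lam s p q a Hs Hl Hp Hq (Hcos a Ha (Rle_trans _ _ _ Hab Hb)))). }
      replace (G b - G a)%C with w by (rewrite Ew; ring).
      eapply Rle_trans; [exact Bw|]. right; ring. }
  replace (RtoC (/ p * Rpower lam (- (q / p)) * Gamma (q / p))) with (G th).
  { apply HG; lra. }
  rewrite HT. apply (cintg_unique _ _ _ _ _ (HG 0 (Rle_refl 0) Hth0)).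
  pose proof (cintg_RtoC _ _ _ _ (Gamma_subst p q lam Hp Hq Hl)) as H.
  eapply (is_RInt_gen_ext (V := C_R_NormedModule)); [|exact H].
  apply filter_forall. intros ab x _. unfold rot_integrand, rotW, Cexp, Cexpi; simpl.
  rewrite cos_0, sin_0, Rmult_1_r, !Rmult_0_r, !Rmult_0_l, Ropp_0, Rplus_0_l, cos_0, sin_0.
  unfold RtoC, Cmult; simpl. f_equal; ring.
Qed.

Lemma Cexpi_add a b : Cexpi (a + b) = (Cexpi a * Cexpi b)%C.
Proof. unfold Cexpi, Cmult; simpl. rewrite cos_plus, sin_plus. f_equal; ring. Qed.

(** The angle pi/2 itself is outside the range of [rot_value]. For eps > 0 the damped integral lies
    on a ray of angle below pi/2 and has the closed form [V eps]; that formula is continuous at eps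
    = 0, which gives the limit. *)
Lemma osc_power_value s lam p q l : s = 1 \/ s = -1 -> 0 < lam -> 0 < p -> 0 < q ->
  filterlimi (fun eps => is_RInt_gen (V := C_R_NormedModule)
      (osc s lam p (fun x => RtoC (Rpower x (q - p)) * RtoC (exp (- (eps * Rpower x p))))%C)
      (at_right 0) (Rbar_locally p_infty))
      (at_right 0) (locally (T := C_UniformSpace) l) ->
  l = (RtoC (/ p * Rpower lam (- (q / p)) * Gamma (q / p)) * Cexpi (s * (PI / 2) * (q / p)))%C.
Proof.
  intros Hs Hl Hp Hq Hlim. set (z := q / p).
  (* [la e^{-i s th} = eps - i s lam]: on this ray the integrand is the damped oscillatory one. *)
  set (th := fun eps => PI / 2 - atan (eps / lam)).
  set (la := fun eps => lam / cos (atan (eps / lam))).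
  set (V := fun eps => (Cexpi (s * th eps * z) * RtoC (/ p * Rpower (la eps) (- z) * Gamma z))%C).
  assert (Hcos : forall y, 0 < cos (atan y)).
  { intros y. destruct (atan_bound y). apply cos_gt_0; lra. }
  assert (HV : forall eps, 0 < eps -> cintg (osc s lam p (fun x => RtoC (Rpower x (q - p)) * RtoC (exp (- (eps * Rpower x p))))%C)
      (at_right 0) (Rbar_locally p_infty) (V eps)).
  { intros eps He. assert (Hd : 0 < eps / lam) by now apply Rdiv_lt_0_compat.
    assert (Hla : 0 < la eps) by (apply Rdiv_lt_0_compat; auto).
    assert (Ha0 : 0 < atan (eps / lam)).
    { rewrite <- atan_0. now apply atan_increasing. }
    destruct (atan_bound (eps / lam)) as [_ Hat].
    assert (Hth : 0 <= th eps /\ th eps < PI / 2) by (unfold th; lra).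
    pose proof (rot_value (la eps) s p q (th eps) Hs Hla Hp Hq (proj1 Hth) (proj2 Hth)) as H.
    apply (cintg_scal (Cexpi (s * th eps * z))) in H; try typeclasses eauto.
    eapply (is_RInt_gen_ext (V := C_R_NormedModule)); [|exact H].
    apply filter_forall. intros ab x _. unfold rot_integrand, osc, Cexp, rotW. fold z. simpl Re. simpl Im.
    set (X := Rpower x p).
    assert (E1 : la eps * cos (th eps) = eps).
    { unfold la, th. rewrite cos_shift. pose proof (Hcos (eps / lam)).
      replace (lam / cos (atan (eps / lam)) * sin (atan (eps / lam))) with (lam * tan (atan (eps / lam))).
      - rewrite tan_atan. field. lra.
      - unfold tan. field. lra. }
    assert (E2 : la eps * sin (th eps) = lam).
    { unfold la, th. rewrite sin_shift. pose proof (Hcos (eps / lam)). field. lra. }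
    replace (- (la eps * cos (th eps) * X)) with (- (eps * X)) by (rewrite E1; reflexivity).
    replace (- (s * th eps * z) + s * la eps * sin (th eps) * X)
      with (- (s * th eps * z) + s * lam * X) by (rewrite <- E2; ring).
    replace (Rpower x (q - 1)) with (Rpower x (q - p) * Rpower x (p - 1))
      by (rewrite <- Rpower_plus; f_equal; ring).
    rewrite RtoC_mult.
    replace (Cexpi (s * lam * X)) with (Cexpi (s * th eps * z) * Cexpi (- (s * th eps * z) + s * lam * X))%C.
    { match goal with |- ?a = ?b => change (@eq C a b) end. ring. }
    rewrite <- Cexpi_add. f_equal. ring. }
  assert (H0 : V 0 = (RtoC (/ p * Rpower lam (- z) * Gamma z) * Cexpi (s * (PI / 2) * z))%C).
  { unfold V, th, la. replace (0 / lam) with 0 by (field; lra). rewrite atan_0, cos_0.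
    replace (lam / 1) with lam by field. rewrite Rminus_0_r. ring. }
  rewrite <- H0.
  eapply (filterlimi_locally_unique (V := C_R_NormedModule) (F := at_right 0)); [|exact Hlim|].
  - apply filter_forall. intros e v w Hv Hw. exact (cintg_unique _ _ _ _ _ Hv Hw).
  - apply (filterlimi_lim_ext_loc V).
    + eapply filter_imp; [|exact at_right_pos_id]. exact HV.
    + apply (filterlim_filter_le_1 (F := locally 0) V); [apply filter_le_within; typeclasses eauto|].
      assert (Hc : ccont V 0); [|exact Hc].
      assert (Hcos0 : cos (atan (0 / lam)) <> 0) by (pose proof (Hcos (0 / lam)); lra).
      apply ccont_mult; [apply ccont_Cexpi|apply ccont_RtoC].
      * apply (ex_derive_continuous (fun eps => s * th eps * z)). unfold th. auto_derive. auto.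
      * unfold Rpower. apply (ex_derive_continuous (fun eps => / p * exp (- z * ln (la eps)) * Gamma z)).
        unfold la. auto_derive. split; [exact Hcos0|]. split; [|exact I].
        apply Rdiv_lt_0_compat; auto.
Qed.

(** * Derivatives, cut-offs and Taylor's formula *)

Lemma Re_Derive_n (H : nat -> R -> C) :
  (forall j x, cderiv (H j) x (H (S j) x)) ->
  forall j x, Derive_n (fun y => Re (H O y)) j x = Re (H j x).
Proof.
  intros HH. induction j as [|j IH]; intros x; [reflexivity|]. simpl.
  rewrite (Derive_ext _ _ x IH). apply is_derive_unique. apply cderiv_Re, HH.
Qed.

Lemma Im_Derive_n (H : nat -> R -> C) :
  (forall j x, cderiv (H j) x (H (S j) x)) ->
  forall j x, Derive_n (fun y => Im (H O y)) j x = Im (H j x).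
Proof.
  intros HH. induction j as [|j IH]; intros x; [reflexivity|]. simpl.
  rewrite (Derive_ext _ _ x IH). apply is_derive_unique. apply cderiv_Im, HH.
Qed.

Lemma chain_CDerive_n (H : nat -> R -> C) :
  (forall j x, cderiv (H j) x (H (S j) x)) ->
  forall j x, CDerive_n (H O) j x = H j x.
Proof.
  intros HH j x. unfold CDerive_n. rewrite Re_Derive_n, Im_Derive_n by exact HH.
  unfold Re, Im. now destruct (H j x).
Qed.

(** Smoothness and higher derivatives of products and reflections are obtained by exhibiting all the
    derivatives at once as a chain [H]. *)
Lemma chain_smooth (H : nat -> R -> C) :
  (forall j x, cderiv (H j) x (H (S j) x)) -> smooth (H O).
Proof.
  intros HH [|j] x; [now split|]. simpl. split.
  - apply ex_derive_ext with (fun y => Re (H j y)).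
    + intros t. now rewrite Re_Derive_n.
    + eexists. apply cderiv_Re, HH.
  - apply ex_derive_ext with (fun y => Im (H j y)).
    + intros t. now rewrite Im_Derive_n.
    + eexists. apply cderiv_Im, HH.
Qed.

(** The j-th derivative of a product left as 2^j uncollected terms, so that no binomial coefficients
    appear and differentiation is a shift of one of the two families. *)
Fixpoint leibniz (j : nat) (F G : nat -> R -> C) {struct j} : R -> C :=
  match j with
  | O => fun x => (F O x * G O x)%C
  | S i => fun x => (leibniz i (fun k => F (S k)) G x + leibniz i F (fun k => G (S k)) x)%C
  end.

Lemma cderiv_leibniz j : forall F G,
  (forall j x, cderiv (F j) x (F (S j) x)) -> (forall j x, cderiv (G j) x (G (S j) x)) ->
  forall x, cderiv (leibniz j F G) x (leibniz (S j) F G x).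
Proof.
  induction j as [|j IH]; intros F G HF HG x.
  - simpl. now apply cderiv_mult.
  - apply (cderiv_plus (leibniz j (fun k => F (S k)) G) (leibniz j F (fun k => G (S k)))).
    + apply IH; auto.
    + apply IH; auto.
Qed.

Lemma smooth_ext f g : (forall x, f x = g x) -> smooth f -> smooth g.
Proof.
  intros E H n x. destruct (H n x) as [H1 H2]. split.
  - eapply ex_derive_n_ext; [|exact H1]. intros t; simpl; now rewrite E.
  - eapply ex_derive_n_ext; [|exact H2]. intros t; simpl; now rewrite E.
Qed.

Lemma smooth_mult f g : smooth f -> smooth g -> smooth (fun x => f x * g x)%C.
Proof.
  intros Hf Hg.
  apply smooth_ext with (leibniz 0 (CDerive_n f) (CDerive_n g)).
  { intros x. simpl. now rewrite !CDerive_n_0. }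
  apply (chain_smooth (fun j => leibniz j (CDerive_n f) (CDerive_n g))).
  intros j x. apply cderiv_leibniz; now apply smooth_cderiv.
Qed.

Lemma CDerive_n_ext_loc f g n x :
  locally x (fun t => f t = g t) -> CDerive_n f n x = CDerive_n g n x.
Proof.
  intros H. unfold CDerive_n. f_equal; apply Derive_n_ext_loc;
    (eapply filter_imp; [|exact H]); intros t Ht; simpl; now rewrite Ht.
Qed.

Lemma CDerive_n_const c n x : CDerive_n (fun _ => c) (S n) x = RtoC 0.
Proof. unfold CDerive_n. now rewrite !Derive_n_const. Qed.

(** * Schwartz functions, amplitudes and cut-offs as symbols *)

Lemma schwartz_of_compact_support h : smooth h -> compact_support h -> schwartz h.
Proof.
  intros Hs [r Hr]. split; [exact Hs|]. intros j k.
  (* [compact_support] allows a negative [r], hence the absolute value. *)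
  destruct (bounded_continuity (V := C_R_NormedModule) (CDerive_n h k) (- Rabs r) (Rabs r)) as [M HM].
  { intros x _. apply (cderiv_ccont (CDerive_n h k) x (CDerive_n h (S k) x)). now apply smooth_cderiv. }
  exists (Rabs r ^ j * M). intros x. destruct (Rle_dec (Rabs x) (Rabs r)) as [L|L].
  - assert (H : Cmod (CDerive_n h k x) < M).
    { rewrite <- Cnorm_Cmod. apply HM. now apply Rabs_le_between. }
    apply Rmult_le_compat; [apply pow_le, Rabs_pos|apply Cmod_ge_0| |lra].
    apply pow_incr. split; [apply Rabs_pos|exact L].
  - assert (HM0 : 0 <= M).
    { assert (H : Cmod (CDerive_n h k 0) < M).
      { rewrite <- Cnorm_Cmod. apply HM. pose proof (Rabs_pos r); lra. }
      pose proof (Cmod_ge_0 (CDerive_n h k 0)). lra. }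
    assert (E : CDerive_n h k x = RtoC 0).
    { rewrite (CDerive_n_ext_loc h (fun _ => RtoC 0)).
      - destruct k; [apply (CDerive_n_0 (fun _ => RtoC 0))|apply CDerive_n_const].
      - assert (Hd : 0 < Rabs x - Rabs r) by lra. exists (mkposreal _ Hd). intros y Hy.
        apply Hr. unfold ball in Hy; simpl in Hy. unfold AbsRing_ball, abs, minus, plus, opp in Hy; simpl in Hy.
        pose proof (Rle_abs r). pose proof (Rabs_triang_inv x (- (y + - x) + x)) as T. 
        replace (x - (- (y + - x) + x)) with (y + - x) in T by ring.
        replace (- (y + - x) + x) with (2 * x - y) in T by ring.
        assert (Rabs x <= Rabs y + Rabs (y + - x)).
        { replace x with (y + - (y + - x)) at 1 by ring. rewrite <- (Rabs_Ropp (y + - x)). apply Rabs_triang. }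
        lra. }
    rewrite E, Cmod_0, Rmult_0_r. apply Rmult_le_pos; [apply pow_le, Rabs_pos|exact HM0].
Qed.

Lemma japanese_bounds x : 0 < x -> 1 <= japanese x /\ x <= japanese x /\ (x < 1 -> japanese x <= 2) /\ (1 <= x -> japanese x <= 2 * x).
Proof.
  intros Hx. unfold japanese. rewrite Rabs_pos_eq by lra.
  assert (H0 : 0 <= 1 + x ^ 2) by nra. repeat split.
  - rewrite <- sqrt_1 at 1. apply sqrt_le_1; nra.
  - rewrite <- (sqrt_square x) at 1 by lra. apply sqrt_le_1; nra.
  - intros L. rewrite <- (sqrt_square 2) by lra. apply sqrt_le_1; nra.
  - intros L. rewrite <- (sqrt_square (2 * x)) by lra. apply sqrt_le_1; nra.
Qed.

Lemma japanese_wt al A x : 0 < x -> A <= 0 ->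
  Rpower (japanese x) al <= Rpower 2 (Rabs al) * wt A al x.
Proof.
  intros Hx HA. destruct (japanese_bounds x Hx) as (J1 & J2 & J3 & J4).
  assert (H2 : 1 <= Rpower 2 (Rabs al)).
  { rewrite <- (Rpower_O 2) at 1 by lra. apply Rle_Rpower; [lra|apply Rabs_pos]. }
  unfold wt. destruct (Rlt_dec x 1) as [L|L].
  - assert (1 <= Rpower x A).
    { rewrite <- (Rpower_O x Hx). apply Rpower_le_small; lra. }
    assert (Rpower (japanese x) al <= Rpower 2 (Rabs al)).
    { apply Rle_trans with (Rpower (japanese x) (Rabs al)).
      - apply Rle_Rpower; [exact J1|apply Rle_abs].
      - apply Rle_Rpower_l; [apply Rabs_pos|]. split; [lra|auto]. }
    nra.
  - destruct (Rle_dec 0 al) as [P|P].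
    + rewrite Rabs_pos_eq by exact P. rewrite Rpower_mult_distr by lra.
      apply Rle_Rpower_l; [exact P|]. split; [lra|apply J4; lra].
    + assert (Rpower (japanese x) al <= Rpower x al).
      { rewrite <- (Ropp_involutive al), !(Rpower_Ropp _ (- al)).
        apply Rinv_le_contravar; [apply Rpower_pos|]. apply Rle_Rpower_l; lra. }
      pose proof (Rpower_pos x al). nra.
Qed.

Lemma amplitude_sym p tau delta a n : -1 <= delta -> amplitude tau delta a ->
  exists M, sym p (delta + 1 - p) n 0 tau M a.
Proof.
  intros Hd [Hs Ha].
  destruct (nat_choice (fun k M => 0 < M /\ forall x, Cmod (CDerive_n a k x) <= M * Rpower (japanese x) (tau + delta * INR k)) Ha)
    as [c Hc].
  set (Mj := fun j => c j * Rpower 2 (Rabs (tau + delta * INR j))).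
  assert (HMj : forall j, 0 <= Mj j).
  { intros j. apply Rmult_le_pos; [left; apply Hc|left; apply Rpower_pos]. }
  destruct (sym_of_derivs p delta n Hd 0 tau Mj HMj) as (C0 & HC0 & H).
  exists (C0 * 1). apply (sym_ext p _ n 0 tau (C0 * 1) (CDerive_n a 0)).
  { intros x _. apply CDerive_n_0. }
  apply H; [lra|intros; now apply smooth_cderiv|].
  intros j x Hx. destruct (Hc j) as [Hcj Hb]. rewrite Rmult_1_l.
  eapply Rle_trans; [apply Hb|]. unfold Mj. rewrite Rmult_assoc.
  apply Rmult_le_compat_l; [lra|]. apply japanese_wt; [exact Hx|]. pose proof (pos_INR j). lra.
Qed.

Lemma locally_Rabs_lt (x r : R) : Rabs x < r -> locally x (fun t => Rabs t < r).
Proof.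
  intros H. exact (continuous_Rabs x _ (open_lt r (Rabs x) H)).
Qed.

(** As r0 >= 1, the function 1 - phi vanishes on (0, 1), so the exponent [A] at 0 is free. This
    freedom later gives the integral of a psi whatever decay in lam is wanted. *)
Lemma cutoff_complement_sym p delta phi r0 n A : -1 <= delta -> schwartz phi -> 1 <= r0 ->
  (forall x, Rabs x <= r0 -> phi x = RtoC 1) ->
  exists M, sym p (delta + 1 - p) n A 0 M (fun x => RtoC 1 - phi x)%C.
Proof.
  intros Hd [Hs HS] Hr0 H1.
  destruct (nat_choice (fun k M => forall x, Rabs x ^ k * Cmod (CDerive_n phi k x) <= M)
    (fun k => HS k k)) as [c Hc].
  assert (Hc0 : forall k, 0 <= c k).
  { intros k. eapply Rle_trans; [|apply (Hc k 0)]. apply Rmult_le_pos; [apply pow_le, Rabs_pos|apply Cmod_ge_0]. }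
  set (H := fun j x => (RtoC (match j with O => 1 | _ => 0 end) - CDerive_n phi j x)%C).
  assert (HMj : forall j, 0 <= 1 + c j) by (intros j; pose proof (Hc0 j); lra).
  destruct (sym_of_derivs p delta n Hd A 0 (fun j => 1 + c j) HMj) as (C0 & HC0 & HH).
  exists (C0 * 1). apply (sym_ext p _ n A 0 (C0 * 1) (H O)).
  { intros x _. unfold H. now rewrite CDerive_n_0. }
  apply HH; [lra| |].
  - intros j x _. unfold H.
    replace (RtoC (match S j with O => 1 | _ => 0 end) - CDerive_n phi (S j) x)%C
      with (RtoC 0 + - RtoC 1 * CDerive_n phi (S j) x)%C by (simpl; ring).
    apply (cderiv_ext_loc (fun x => (RtoC (match j with O => 1 | _ => 0 end) + - RtoC 1 * CDerive_n phi j x)%C)).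
    { apply filter_forall. intros; ring. }
    apply cderiv_plus; [apply cderiv_const|]. apply cderiv_scal. now apply smooth_cderiv.
  - intros j x Hx. rewrite Rmult_1_l. pose proof (Hc0 j).
    destruct (Rlt_dec x 1) as [L|L].
    + assert (E : H j x = RtoC 0).
      { unfold H. rewrite (CDerive_n_ext_loc phi (fun _ => RtoC 1)).
        - destruct j; [rewrite (CDerive_n_0 (fun _ => RtoC 1))|rewrite CDerive_n_const]; ring.
        - assert (Hxr : Rabs x < r0) by (rewrite Rabs_pos_eq; lra).
          eapply filter_imp; [|exact (locally_Rabs_lt x r0 Hxr)]. intros t Ht. apply H1. lra. }
      rewrite E, Cmod_0. apply Rmult_le_pos; [lra|left; apply wt_pos].
    + unfold wt. destruct (Rlt_dec x 1); [contradiction|].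
      specialize (Hc j x). rewrite Rabs_pos_eq in Hc by lra.
      assert (Hxj : 0 < x ^ j) by (apply pow_lt; lra).
      assert (HW : / x ^ j <= Rpower x (0 + delta * INR j)).
      { rewrite <- Rpower_pow, <- Rpower_Ropp by lra. apply Rle_Rpower; [lra|]. pose proof (pos_INR j). nra. }
      assert (HD : Cmod (CDerive_n phi j x) <= c j * / x ^ j).
      { apply (Rmult_le_reg_l (x ^ j)); [exact Hxj|]. replace (x ^ j * (c j * / x ^ j)) with (c j) by (field; lra). exact Hc. }
      unfold H. eapply Rle_trans; [apply Cmod_triangle|]. rewrite Cmod_opp, Cmod_R.
      assert (HE : Rabs (match j with O => 1 | _ => 0 end) <= 1 * / x ^ j).
      { destruct j; [simpl; rewrite Rabs_R1; lra|].
        rewrite Rabs_R0. apply Rmult_le_pos; [lra|left; now apply Rinv_0_lt_compat]. }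
      apply Rle_trans with ((1 + c j) * / x ^ j); [lra|]. apply Rmult_le_compat_l; lra.
Qed.

(** * Taylor polynomials and remainders *)

Fixpoint taylor_poly (m : nat) (c : nat -> C) (x : R) {struct m} : C :=
  match m with
  | O => RtoC 0
  | S i => (taylor_poly i c x + c i / RtoC (INR (fact i)) * RtoC (x ^ i))%C
  end.

Lemma RtoC_fact_neq_0 i : RtoC (INR (fact i)) <> RtoC 0.
Proof. intros H. apply RtoC_inj in H. now apply (INR_fact_neq_0 i). Qed.

(** [c] lists derivatives at 0 rather than coefficients, so differentiating shifts [c] and drops one
    term. *)
Lemma cderiv_taylor_poly m : forall c x,
  cderiv (taylor_poly (S m) c) x (taylor_poly m (fun i => c (S i)) x).
Proof.
  induction m as [|m IH]; intros c x.
  - simpl. apply (cderiv_ext_loc (fun _ => c O)); [|apply cderiv_const].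
    apply filter_forall. intros t. field.
  - change (taylor_poly (S m) (fun i => c (S i)) x) with
      (taylor_poly m (fun i => c (S i)) x + c (S m) / RtoC (INR (fact m)) * RtoC (x ^ m))%C.
    apply (cderiv_plus (taylor_poly (S m) c)); [apply IH|].
    replace (c (S m) / RtoC (INR (fact m)) * RtoC (x ^ m))%C
      with (c (S m) / RtoC (INR (fact (S m))) * RtoC (INR (S m) * x ^ m))%C.
    + apply cderiv_scal. apply cderiv_RtoC. auto_derive; [exact I|].
      apply Rmult_1_l.
    + rewrite fact_simpl, mult_INR, !RtoC_mult. field. split; [apply RtoC_fact_neq_0|].
      intros E. apply RtoC_inj in E. now apply (not_0_INR (S m)).
Qed.

Lemma taylor_poly_0 m c : taylor_poly (S m) c 0 = c O.
Proof.
  induction m as [|m IH].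
  - simpl. field.
  - change (taylor_poly (S m) c 0 + c (S m) / RtoC (INR (fact (S m))) * RtoC (0 ^ S m) = c O)%C.
    rewrite IH, pow_i by lia. ring.
Qed.

Lemma taylor_poly_bound m c : exists K, 0 <= K /\
  forall x, 1 <= x -> Cmod (taylor_poly m c x) <= K * x ^ m.
Proof.
  induction m as [|m (K & HK & H)].
  - exists 0. split; [lra|]. intros x Hx. simpl. rewrite Cmod_0. lra.
  - exists (K + Cmod (c m / RtoC (INR (fact m)))%C). pose proof (Cmod_ge_0 (c m / RtoC (INR (fact m)))%C).
    split; [lra|]. intros x Hx. specialize (H x Hx). simpl taylor_poly.
    eapply Rle_trans; [apply Cmod_triangle|]. rewrite Cmod_mult, Cmod_R.
    assert (Hm : 0 < x ^ m) by (apply pow_lt; lra). rewrite Rabs_pos_eq by lra.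
    assert (x ^ m <= x ^ S m) by (simpl; nra).
    set (d := Cmod (c m / RtoC (INR (fact m)))%C) in *. nra.
Qed.

(** This is the Taylor polynomial about the moving centre th x, evaluated at x. Differentiating in
    th makes the terms telescope, and only the top derivative remains. *)
Lemma taylor_integral (F : nat -> R -> C) (x : R) :
  (forall j y, cderiv (F j) y (F (S j) y)) -> forall m th,
  cderiv (fun th => taylor_poly (S m) (fun k => (RtoC (x ^ k) * F k (th * x)%R)%C) (1 - th)) th
    (RtoC ((1 - th) ^ m) * (RtoC (x ^ S m) / RtoC (INR (fact m)) * F (S m) (th * x)%R))%C.
Proof.
  intros HF. 
  assert (D : forall k th, cderiv (fun th => F k (th * x)%R) th (RtoC x * F (S k) (th * x)%R)%C).
  { intros k th. apply (cderiv_comp (F k) (fun th => th * x)); [|apply HF]. auto_derive; auto; ring. }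
  induction m as [|m IH]; intros th.
  - apply (cderiv_ext_loc (fun th => F O (th * x)%R)).
    { apply filter_forall. intros t. simpl. field. }
    evar_last; [apply D|]. simpl. rewrite Rmult_1_r. field.
  - apply (cderiv_ext_loc (fun th => (taylor_poly (S m) (fun k => RtoC (x ^ k) * F k (th * x)%R)%C (1 - th) +
        RtoC (x ^ S m) / RtoC (INR (fact (S m))) * (F (S m) (th * x)%R * RtoC ((1 - th) ^ S m)))%C)).
    { apply filter_forall. intros t.
      match goal with |- _ = taylor_poly (S (S m)) ?c ?y =>
        change (taylor_poly (S (S m)) c y) with
          (taylor_poly (S m) c y + c (S m) / RtoC (INR (fact (S m))) * RtoC (y ^ S m))%C end.
      unfold Cdiv. ring. }
    evar_last.
    { apply (cderiv_plus (fun th => taylor_poly (S m) (fun k => (RtoC (x ^ k) * F k (th * x)%R)%C) (1 - th))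
        (fun th => (RtoC (x ^ S m) / RtoC (INR (fact (S m))) * (F (S m) (th * x)%R * RtoC ((1 - th) ^ S m)))%C)).
      - apply IH.
      - apply cderiv_scal. apply cderiv_mult; [apply D|].
        apply (cderiv_RtoC (fun th => (1 - th) ^ S m) th (- (INR (S m) * (1 - th) ^ m))).
        auto_derive; [exact I|]. unfold Rminus; destruct m; simpl; ring. }
    rewrite fact_simpl, mult_INR. change (x ^ S (S m)) with (x * x ^ S m). change ((1 - th) ^ S m) with ((1 - th) * (1 - th) ^ m).
    rewrite RtoC_opp, !RtoC_mult. field. split; [apply RtoC_fact_neq_0|].
    intros E. apply RtoC_inj in E. now apply (not_0_INR (S m)).
Qed.

Lemma taylor_poly_scale m c x :
  taylor_poly m (fun k => RtoC (x ^ k) * c k)%C 1 = taylor_poly m c x.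
Proof.
  induction m as [|m IH]; [reflexivity|]. simpl. rewrite IH, pow1. f_equal. unfold Cdiv. ring.
Qed.

Lemma taylor_poly_ext m c d x : (forall k, (k < m)%nat -> c k = d k) -> taylor_poly m c x = taylor_poly m d x.
Proof.
  induction m as [|m IH]; intros H; [reflexivity|]. simpl. rewrite IH, H by auto. reflexivity.
Qed.

(** Integrate [taylor_integral] over [0, 1]: the centre x leaves the value at x, the centre 0 the
    Taylor polynomial. All later estimates use x^n [a_tilde] in this form, so nothing is
    differentiated under the integral sign. *)
Lemma a_tilde_taylor a phi n x : smooth (fun y => a y * phi y)%C -> (1 <= n)%nat ->
  (RtoC (x ^ n) * a_tilde a phi n x =
   a x * phi x - taylor_poly n (fun k => CDerive_n (fun y => a y * phi y) k 0) x)%C.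
Proof.
  intros Hs Hn. destruct n as [|m]; [lia|]. clear Hn.
  set (F := CDerive_n (fun y => (a y * phi y)%C)).
  assert (HF : forall j y, cderiv (F j) y (F (S j) y)) by now apply smooth_cderiv.
  unfold a_tilde. fold F. replace (S m - 1)%nat with m by lia.
  set (f := fun theta => (RtoC ((1 - theta) ^ m) * F (S m) (theta * x)%R)%C).
  assert (Cf : forall t, ccont f t).
  { intros t. apply ccont_mult.
    - apply ccont_RtoC. apply (ex_derive_continuous (fun t => (1 - t) ^ m)). auto_derive. exact I.
    - eapply cderiv_ccont. apply (cderiv_comp (F (S m)) (fun t => t * x)); [|apply HF].
      auto_derive; [exact I|reflexivity]. }
  assert (I1 : is_RInt (V := C_R_NormedModule) f 0 1 (RInt (V := C_R_CompleteNormedModule) f 0 1)).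
  { apply (RInt_correct (V := C_R_CompleteNormedModule)).
    apply (ex_RInt_continuous (V := C_R_CompleteNormedModule)). intros z _. apply Cf. }
  set (g := fun th => taylor_poly (S m) (fun k => (RtoC (x ^ k) * F k (th * x)%R)%C) (1 - th)).
  assert (I2 : is_RInt (V := C_R_NormedModule)
    (fun th => (RtoC (x ^ S m) / RtoC (INR (fact m)) * f th)%C) 0 1
    (minus (G := C_R_NormedModule) (g 1) (g 0))).
  { apply (is_RInt_derive (V := C_R_CompleteNormedModule) g).
    - intros th _. evar_last; [apply (taylor_integral F x HF m th)|]. unfold f, Cdiv. ring.
    - intros th _. apply ccont_mult; [apply continuous_const|apply Cf]. }
  pose proof (is_RInt_Cscal (RtoC (x ^ S m) / RtoC (INR (fact m)))%C f 0 1 _ I1) as I3.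
  pose proof (is_RInt_unique (V := C_R_CompleteNormedModule) _ _ _ _ I2) as E2.
  pose proof (is_RInt_unique (V := C_R_CompleteNormedModule) _ _ _ _ I3) as E3.
  assert (E : (RtoC (x ^ S m) / RtoC (INR (fact m)) * RInt (V := C_R_CompleteNormedModule) f 0 1)%C = (g 1 - g 0)%C).
  { rewrite E2 in E3. exact (eq_sym E3). }
  transitivity (g 1 - g 0)%C; [rewrite <- E; unfold Cdiv; ring|].
  f_equal; [|f_equal].
  - unfold g. rewrite Rminus_diag, taylor_poly_0, Rmult_1_l. simpl. unfold F. rewrite CDerive_n_0. ring.
  - unfold g. rewrite Rminus_0_r, taylor_poly_scale. apply taylor_poly_ext. intros k _. now rewrite Rmult_0_l.
Qed.

(** Starting from the bounded H n, each descent to a lower derivative vanishing at 0 gains a factor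
    |x|, by [cderiv_increment]. *)
Lemma taylor_remainder_small (H : nat -> R -> C) n :
  (forall j x, cderiv (H j) x (H (S j) x)) -> (forall j, (j < n)%nat -> H j 0 = RtoC 0) ->
  (exists K, forall x, Cmod (H n x) <= K) ->
  forall m j, (j + m = n)%nat -> exists K, 0 <= K /\ forall x, Cmod (H j x) <= K * Rabs x ^ m.
Proof.
  intros HH H0 [K0 HK0]. induction m as [|m IH]; intros j Hj.
  - exists K0. replace n with j in HK0 by lia. split.
    + eapply Rle_trans; [apply (Cmod_ge_0 (H j 0))|apply HK0].
    + intros x. simpl. rewrite Rmult_1_r. apply HK0.
  - destruct (IH (S j) ltac:(lia)) as (K & HK & HB). exists (2 * K). split; [lra|].
    intros x. replace (H j x) with (H j x - H j 0)%C by (rewrite (H0 j) by lia; ring).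
    eapply Rle_trans; [apply (cderiv_increment (H j) (H (S j)) (K * Rabs x ^ m) 0 x (HH j))|].
    + intros t Ht. rewrite !Rminus_0_r in Ht. eapply Rle_trans; [apply HB|].
      apply Rmult_le_compat_l; [exact HK|]. apply pow_incr. split; [apply Rabs_pos|exact Ht].
    + rewrite Rminus_0_r. simpl. right; ring.
Qed.

(** The remainder vanishes to order n at 0, and at infinity it grows like its Taylor polynomial, at
    most like x^n. Each derivative lowers both orders by 1, which is admissible at infinity since
    delta >= -1. *)
Lemma taylor_remainder_sym p delta h n n' : -1 <= delta -> schwartz h ->
  exists M, sym p (delta + 1 - p) n' (INR n) (INR n) M
    (fun x => h x - taylor_poly n (fun k => CDerive_n h k 0) x)%C.
Proof.
  intros Hd [Hs HS].
  set (c := fun k => CDerive_n h k 0).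
  (* [H j] is the j-th derivative of the remainder; the truncated n - j makes the polynomial vanish
     once j >= n. *)
  set (H := fun j x => (CDerive_n h j x - taylor_poly (n - j) (fun i => c (i + j)%nat) x)%C).
  assert (HH : forall j x, cderiv (H j) x (H (S j) x)).
  { intros j x. unfold H.
    replace (CDerive_n h (S j) x - taylor_poly (n - S j) (fun i => c (i + S j)%nat) x)%C
      with (CDerive_n h (S j) x + - RtoC 1 * taylor_poly (n - S j) (fun i => c (i + S j)%nat) x)%C by ring.
    apply (cderiv_ext_loc (fun x => (CDerive_n h j x + - RtoC 1 * taylor_poly (n - j) (fun i => c (i + j)%nat) x)%C)).
    { apply filter_forall. intros; ring. }
    apply cderiv_plus; [now apply smooth_cderiv|]. apply cderiv_scal.
    destruct (n - j)%nat as [|i] eqn:E.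
    - replace (n - S j)%nat with O by lia. apply (cderiv_const (RtoC 0)).
    - replace (n - S j)%nat with i by lia.
      replace (taylor_poly i (fun i0 => c (i0 + S j)%nat) x) with (taylor_poly i (fun k => c (S k + j)%nat) x).
      + apply (cderiv_taylor_poly i (fun k => c (k + j)%nat)).
      + apply taylor_poly_ext. intros k _. f_equal. lia. }
  assert (Hbig : forall j, (n <= j)%nat -> forall x, H j x = CDerive_n h j x).
  { intros j Hj x. unfold H. replace (n - j)%nat with O by lia. simpl. ring. }
  assert (Hbd : forall k, exists K, 0 <= K /\ forall x, Cmod (CDerive_n h k x) <= K).
  { intros k. destruct (HS O k) as [K HK]. exists K. split.
    - eapply Rle_trans; [apply (Cmod_ge_0 (CDerive_n h k 0))|]. specialize (HK 0). simpl in HK. lra.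
    - intros x. specialize (HK x). simpl in HK. lra. }
  destruct (nat_choice (fun j K => 0 <= K /\ forall x, 0 < x ->
    Cmod (H j x) <= K * wt (INR n - INR j) (INR n + delta * INR j) x)) as [Mj HMj].
  { intros j.
    assert (HS1 : exists K1, 0 <= K1 /\ forall x, 0 < x -> x < 1 -> Cmod (H j x) <= K1 * Rpower x (INR n - INR j)).
    { destruct (Compare_dec.le_lt_dec n j) as [L|L].
      - destruct (Hbd j) as (K & HK & HB). exists K. split; [exact HK|]. intros x Hx Hx1.
        rewrite Hbig by exact L. eapply Rle_trans; [apply HB|].
        assert (1 <= Rpower x (INR n - INR j)); [|nra].
        rewrite <- (Rpower_O x Hx). apply Rpower_le_small; try lra. apply le_INR in L. lra.
      - destruct (taylor_remainder_small H n HH) with (m := (n - j)%nat) (j := j) as (K & HK & HB).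
        + intros i Hi. unfold H. destruct (n - i)%nat as [|k] eqn:E; [lia|].
          rewrite taylor_poly_0. unfold c. simpl. ring.
        + destruct (Hbd n) as (K & _ & HB). exists K. intros x. rewrite Hbig by lia. apply HB.
        + lia.
        + exists K. split; [exact HK|]. intros x Hx Hx1.
          rewrite <- minus_INR by lia. rewrite Rpower_pow by exact Hx.
          specialize (HB x). rewrite Rabs_pos_eq in HB by lra. exact HB. }
    assert (HS2 : exists K2, 0 <= K2 /\ forall x, 1 <= x -> Cmod (H j x) <= K2 * Rpower x (INR n + delta * INR j)).
    { destruct (HS j j) as [K HK].
      destruct (taylor_poly_bound (n - j) (fun i => c (i + j)%nat)) as (T & HT & HTb).
      assert (HK0 : 0 <= K).
      { eapply Rle_trans; [|apply (HK 0)]. apply Rmult_le_pos; [apply pow_le, Rabs_pos|apply Cmod_ge_0]. }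
      exists (K + T). split; [lra|]. intros x Hx. specialize (HK x). rewrite Rabs_pos_eq in HK by lra.
      assert (Hxj : 0 < x ^ j) by (apply pow_lt; lra).
      assert (W1 : / x ^ j <= Rpower x (INR n + delta * INR j)).
      { rewrite <- Rpower_pow, <- Rpower_Ropp by lra. apply Rle_Rpower; [lra|].
        pose proof (pos_INR j). pose proof (pos_INR n). nra. }
      assert (HD : Cmod (CDerive_n h j x) <= K * / x ^ j).
      { apply (Rmult_le_reg_l (x ^ j)); [exact Hxj|]. replace (x ^ j * (K * / x ^ j)) with K by (field; lra). exact HK. }
      assert (HT2 : Cmod (taylor_poly (n - j) (fun i => c (i + j)%nat) x) <= T * Rpower x (INR n + delta * INR j)).
      { destruct (Compare_dec.le_lt_dec n j) as [L|L].
        - replace (n - j)%nat with O by lia. simpl. rewrite Cmod_0.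
          apply Rmult_le_pos; [exact HT|left; apply Rpower_pos].
        - eapply Rle_trans; [apply HTb, Hx|]. apply Rmult_le_compat_l; [exact HT|].
          rewrite <- Rpower_pow by lra. apply Rle_Rpower; [lra|]. rewrite minus_INR by lia.
          pose proof (pos_INR j). nra. }
      unfold H. eapply Rle_trans; [apply Cmod_triangle|]. rewrite Cmod_opp.
      assert (K * / x ^ j <= K * Rpower x (INR n + delta * INR j)) by now apply Rmult_le_compat_l. lra. }
    destruct HS1 as (K1 & HK1 & B1). destruct HS2 as (K2 & HK2 & B2).
    exists (K1 + K2). split; [lra|]. intros x Hx. pose proof (wt_pos (INR n - INR j) (INR n + delta * INR j) x) as HW.
    unfold wt in *. destruct (Rlt_dec x 1) as [L|L].
    - specialize (B1 x Hx L). nra.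
    - specialize (B2 x ltac:(lra)). nra. }
  destruct (sym_of_derivs p delta n' Hd (INR n) (INR n) Mj (fun j => proj1 (HMj j))) as (C0 & HC0 & HC).
  exists (C0 * 1). apply (sym_ext p _ n' (INR n) (INR n) (C0 * 1) (H O)).
  { intros x _. unfold H. rewrite CDerive_n_0, Nat.sub_0_r.
    rewrite (taylor_poly_ext n (fun i => c (i + 0)%nat) c); [reflexivity|].
    intros k _. now rewrite Nat.add_0_r. }
  apply HC; [lra|auto|]. intros j x Hx. rewrite Rmult_1_l. now apply HMj.
Qed.

(** * The expansion on the half-line *)

Lemma filterlimi_imp {T U} (F : (T -> Prop) -> Prop) {FF : Filter F} (G : (U -> Prop) -> Prop)
  (f g : T -> U -> Prop) :
  (forall x y, f x y -> g x y) -> filterlimi f F G -> filterlimi g F G.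
Proof.
  intros H Hf P HP. unfold filtermapi. eapply filter_imp; [|exact (Hf P HP)].
  intros x (y & Hy & HPy). exists y; auto.
Qed.

Lemma is_Os_ext Fa Fb {FFa : Filter Fa} {FFb : Filter Fb} f g l :
  filter_prod Fa Fb (fun ab => forall x, Rmin (fst ab) (snd ab) < x < Rmax (fst ab) (snd ab) -> f x = g x) ->
  is_Os_int Fa Fb f l -> is_Os_int Fa Fb g l.
Proof.
  intros E H chi Hc H1. specialize (H chi Hc H1). revert H. apply filterlimi_imp; [typeclasses eauto|].
  intros eps v Hv. eapply (is_RInt_gen_ext (V := C_R_NormedModule)); [|exact Hv].
  eapply filter_imp; [|exact E]. intros ab Hab x Hx. now rewrite Hab.
Qed.

Lemma is_Os_plus Fa Fb {FFa : Filter Fa} {FFb : Filter Fb} f g l k :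
  is_Os_int Fa Fb f l -> is_Os_int Fa Fb g k -> is_Os_int Fa Fb (fun x => f x + g x)%C (l + k)%C.
Proof.
  intros Hf Hg chi Hc H1 P HP. specialize (Hf chi Hc H1). specialize (Hg chi Hc H1).
  destruct (filterlim_plus (V := C_R_NormedModule) l k P HP) as [Q R1 HQ HR HQR].
  pose proof (Hf Q HQ) as A1. pose proof (Hg R1 HR) as A2. unfold filtermapi in *.
  eapply filter_imp; [|exact (filter_and _ _ A1 A2)].
  intros eps [(u & Hu & Qu) (v & Hv & Rv)]. exists (u + v)%C. split; [|exact (HQR u v Qu Rv)].
  eapply (is_RInt_gen_ext (V := C_R_NormedModule));
    [|exact (is_RInt_gen_plus (V := C_R_NormedModule) _ _ _ _ Hu Hv)].
  apply filter_forall. intros ab x _.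
  match goal with |- plus ?a ?b = _ => change (a + b = (f x + g x) * chi (eps * x)%R)%C end. ring.
Qed.

Lemma is_Os_scal Fa Fb {FFa : Filter Fa} {FFb : Filter Fb} c f l :
  is_Os_int Fa Fb f l -> is_Os_int Fa Fb (fun x => c * f x)%C (c * l)%C.
Proof.
  intros Hf chi Hc H1 P HP. specialize (Hf chi Hc H1).
  unfold filtermapi. eapply filter_imp; [|exact (Hf _ (Cmult_continuous c l P HP))].
  intros eps (u & Hu & Qu). exists (c * u)%C. split; [|exact Qu].
  eapply (is_RInt_gen_ext (V := C_R_NormedModule)); [|exact (cintg_scal c _ _ _ _ Hu)].
  apply filter_forall. intros ab x _. apply Cmult_assoc.
Qed.

(** [phi] witnesses that some admissible test function exists; without one, [is_Os_int] would hold
    vacuously for every value. In the theorem the cut-off itself plays this part. *)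
Lemma is_Os_unique Fa Fb {FFa : ProperFilter' Fa} {FFb : ProperFilter' Fb} phi f l k :
  schwartz phi -> phi 0 = RtoC 1 ->
  is_Os_int Fa Fb f l -> is_Os_int Fa Fb f k -> l = k.
Proof.
  intros Hs H0 Hl Hk. specialize (Hl phi Hs H0). specialize (Hk phi Hs H0).
  eapply (filterlimi_locally_unique (V := C_R_NormedModule) (F := at_right 0)); [|exact Hl|exact Hk].
  apply filter_forall. intros e v w Hv Hw. exact (cintg_unique _ _ _ _ _ Hv Hw).
Qed.

Lemma Os_int_eq Fa Fb {FFa : ProperFilter' Fa} {FFb : ProperFilter' Fb} phi f l :
  schwartz phi -> phi 0 = RtoC 1 -> is_Os_int Fa Fb f l -> Os_int Fa Fb f = l.
Proof.
  intros Hs H0 Hl. apply (iota_unique (V := C_R_CompleteNormedModule)); [|exact Hl].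
  intros y Hy. exact (is_Os_unique _ _ phi f y l Hs H0 Hy Hl).
Qed.

Lemma Os_int_correct Fa Fb {FFa : ProperFilter' Fa} {FFb : ProperFilter' Fb} phi f :
  schwartz phi -> phi 0 = RtoC 1 -> ex_Os_int Fa Fb f -> is_Os_int Fa Fb f (Os_int Fa Fb f).
Proof. intros Hs H0 [l Hl]. now rewrite (Os_int_eq _ _ phi f l). Qed.

(** Convergence along every regularizer, so that one [l] can be evaluated by exponential damping and
    read as an Os-integral. *)
Definition osc_lim (p rho s lam : R) (f : R -> C) (l : C) : Prop :=
  forall th, regularizer p rho th ->
    filterlimi (fun eps => is_RInt_gen (V := C_R_NormedModule)
      (osc s lam p (fun x => f x * th eps x)%C) (at_right 0) (Rbar_locally p_infty))
      (at_right 0) (locally (T := C_UniformSpace) l).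

Lemma osc_lim_is_Os p delta s lam q b l : 0 < p -> -1 <= delta -> delta < p - 1 ->
  osc_lim p (delta + 1 - p) s lam (fun x => RtoC (Rpower x (q - p)) * b x)%C l ->
  is_Os_int (at_right 0) (Rbar_locally p_infty) (I_integrand s p q b lam) l.
Proof.
  intros Hp Hd1 Hd2 Hl chi Hchi H0.
  specialize (Hl _ (schwartz_regularizer p delta chi Hp Hd1 Hd2 Hchi H0)).
  revert Hl. apply filterlimi_imp; [typeclasses eauto|]. intros eps v Hv.
  eapply (is_RInt_gen_ext (V := C_R_NormedModule)); [|exact Hv].
  apply filter_forall. intros ab x _. unfold osc, I_integrand.
  replace (q - 1) with (q - p + (p - 1)) by ring. rewrite Rpower_plus, RtoC_mult.
  match goal with |- ?a = ?b => change (@eq C a b) end. ring.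
Qed.

Lemma filter_prod_pos (P : R -> Prop) : (forall x, 0 < x -> P x) ->
  filter_prod (at_right 0) (Rbar_locally p_infty)
    (fun ab => forall x, Rmin (fst ab) (snd ab) < x < Rmax (fst ab) (snd ab) -> P x).
Proof.
  intros H. exists (fun x => 0 < x) (fun x => 0 < x); [apply at_right_pos_id|exists 0; auto|].
  intros a b Ha Hb x Hx. apply H. simpl in Hx.
  apply Rlt_trans with (2 := proj1 Hx). now apply Rmin_case.
Qed.

Lemma Os_power s lam p k : s = 1 \/ s = -1 -> 0 < lam -> 0 < p ->
  is_Os_int (at_right 0) (Rbar_locally p_infty) (I_integrand s p (INR k + 1) (fun _ => RtoC 1) lam)
    (I_const_value s p k * RtoC (Rpower lam (- ((INR k + 1) / p))))%C.
Proof.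
  intros Hs Hl Hp. set (q := INR k + 1). assert (Hq : 0 < q) by (unfold q; pose proof (pos_INR k); lra).
  (* This is rho for delta = -1, a choice that suits pure powers and satisfies delta < p - 1 for
     every p > 0. *)
  assert (Hf : forall n, exists M, sym p (-1 + 1 - p) n (q - p) (q - p) M
    (fun x => RtoC (Rpower x (q - p)) * RtoC 1)%C).
  { intros n. destruct (sym_Rpower p (-1 + 1 - p) n ltac:(lra) (q - p)) as (M & _ & H).
    exists M. eapply sym_ext; [|exact H]. intros x _. simpl. ring. }
  assert (Hreg := exp_regularizer p (-1 + 1 - p) Hp ltac:(lra) ltac:(lra)).
  destruct (osc_limit_exists p (-1 + 1 - p) s lam (q - p) (q - p) _ _ Hp ltac:(lra) ltac:(lra) ltac:(lra) Hl Hs Hf Hreg)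
    as [l Hlim].
  pose proof (osc_lim_is_Os p (-1) s lam q (fun _ => RtoC 1) l Hp ltac:(lra) ltac:(lra) Hlim) as HO.
  replace (I_const_value s p k * RtoC (Rpower lam (- (q / p))))%C with l; [exact HO|].
  rewrite (osc_power_value s lam p q l Hs Hl Hp Hq).
  - unfold I_const_value. fold q. rewrite !RtoC_mult. ring.
  - specialize (Hlim _ Hreg). revert Hlim. apply filterlimi_imp; [typeclasses eauto|]. intros eps v Hv.
    eapply (is_RInt_gen_ext (V := C_R_NormedModule)); [|exact Hv].
    apply filter_forall. intros ab x _. unfold osc.
    match goal with |- ?a = ?b => change (@eq C a b) end. ring.
Qed.

Lemma Os_taylor_poly s lam p c m : s = 1 \/ s = -1 -> 0 < lam -> 0 < p ->
  is_Os_int (at_right 0) (Rbar_locally p_infty) (I_integrand s p 1 (taylor_poly (S m) c) lam)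
    (sum_n_m (fun k => (I_const_value s p k * (c k / RtoC (INR (fact k)))
       * RtoC (Rpower lam (- ((INR k + 1) / p))))%C) 0 m).
Proof.
  intros Hs Hl Hp.
  assert (Hterm : forall k, is_Os_int (at_right 0) (Rbar_locally p_infty)
    (I_integrand s p 1 (fun x => c k / RtoC (INR (fact k)) * RtoC (x ^ k))%C lam)
    (I_const_value s p k * (c k / RtoC (INR (fact k))) * RtoC (Rpower lam (- ((INR k + 1) / p))))%C).
  { intros k.
    replace (I_const_value s p k * (c k / RtoC (INR (fact k))) * RtoC (Rpower lam (- ((INR k + 1) / p))))%C
      with (c k / RtoC (INR (fact k)) * (I_const_value s p k * RtoC (Rpower lam (- ((INR k + 1) / p)))))%C by ring.
    eapply (is_Os_ext (at_right 0) (Rbar_locally p_infty)); [|apply (is_Os_scal (at_right 0) (Rbar_locally p_infty)), Os_power; auto].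
    apply filter_prod_pos. intros x Hx. unfold I_integrand.
    rewrite Rminus_diag, Rpower_O by exact Hx. replace (INR k + 1 - 1) with (INR k) by ring.
    rewrite Rpower_pow by exact Hx. ring. }
  induction m as [|m IH].
  - rewrite sum_n_n. eapply (is_Os_ext (at_right 0) (Rbar_locally p_infty)); [|apply (Hterm O)].
    apply filter_prod_pos. intros x Hx. unfold I_integrand.
    change (taylor_poly 1 c x) with (RtoC 0 + c O / RtoC (INR (fact O)) * RtoC (x ^ 0))%C.
    now rewrite Cplus_0_l.
  - rewrite sum_n_Sm by lia.
    eapply (is_Os_ext (at_right 0) (Rbar_locally p_infty)); [|apply (is_Os_plus _ _ _ _ _ _ IH (Hterm (S m)))].
    apply filter_prod_pos. intros x Hx. unfold I_integrand. 
    change (taylor_poly (S (S m)) c x) with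
      (taylor_poly (S m) c x + c (S m) / RtoC (INR (fact (S m))) * RtoC (x ^ S m))%C. ring.
Qed.

Lemma nat_part_le p : 0 < p -> INR (nat_part p) <= p.
Proof.
  intros Hp. unfold nat_part. destruct (base_Int_part p) as [H1 H2].
  assert (0 <= Int_part p)%Z.
  { assert (IZR (-1) < IZR (Int_part p)) by (simpl; lra). apply lt_IZR in H. lia. }
  rewrite INR_IZR_INZ, Z2Nat.id by assumption. exact H1.
Qed.

Lemma nat_part_INR m : nat_part (INR m) = m.
Proof.
  unfold nat_part. replace (Int_part (INR m)) with (Z.of_nat m); [apply Nat2Z.id|].
  destruct (base_Int_part (INR m)) as [H1 H2]. rewrite INR_IZR_INZ in *.
  apply le_IZR in H1. 
  assert (IZR (Z.of_nat m) < IZR (Int_part (IZR (Z.of_nat m)) + 1)) by (rewrite plus_IZR; lra).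
  apply lt_IZR in H. lia.
Qed.

(** The parameter [t] will be the pair (s, lam), for which one [K] must serve. The empty range does
    occur: for p < 1 the sum from N to N + [p] - 1 has no terms. *)
Lemma Cmod_sum_n_m_bound {T} (u : T -> nat -> C) (w : T -> R) (P : T -> Prop) a b :
  (forall k, (a <= k)%nat -> exists K, 0 <= K /\ forall t, P t -> Cmod (u t k) <= K * w t) ->
  exists K, 0 <= K /\ forall t, P t -> 0 <= w t -> Cmod (sum_n_m (u t) a b) <= K * w t.
Proof.
  intros H.
  assert (Z : forall b', (b' < a)%nat -> exists K, 0 <= K /\ forall t, P t -> 0 <= w t -> Cmod (sum_n_m (u t) a b') <= K * w t).
  { intros b' Hb. exists 0. split; [lra|]. intros t _ _. rewrite sum_n_m_zero by exact Hb.
    change (Cmod (RtoC 0) <= 0 * w t). rewrite Cmod_0. lra. }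
  induction b as [|b (K & HK & IH)].
  - destruct a; [|apply Z; lia]. destruct (H O (le_n _)) as (K & HK & HB). exists K. split; [exact HK|].
    intros t Ht _. rewrite sum_n_n. auto.
  - destruct (Compare_dec.le_lt_dec a (S b)) as [L|L]; [|now apply Z].
    destruct (H (S b) L) as (K' & HK' & HB). exists (K + K'). split; [lra|].
    intros t Ht Hw. rewrite sum_n_Sm by exact L.
    eapply Rle_trans; [apply Cmod_triangle|]. specialize (IH t Ht Hw). specialize (HB t Ht). lra.
Qed.

Lemma half_line_expansion (phi : R -> C) (r0 r1 : R)
  (hphi_smooth : smooth phi) (hphi_supp : compact_support phi)
  (hr0 : 1 <= r0)
  (hphi1 : forall x : R, Rabs x <= r0 -> phi x = RtoC 1) :
  forall (p tau delta : R) (a : R -> C),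
     0 < p -> -1 <= delta -> delta < p - 1 -> amplitude tau delta a ->
     forall N : nat, (1 <= N)%nat ->
     (forall s : R, s = 1 \/ s = -1 ->
        (forall k : nat,
           ex_I_const s p k /\ I_const s p k = I_const_value s p k) /\
        (forall lam : R, 0 < lam ->
           ex_I s p 1 a lam /\
           ex_I s p (INR (N + nat_part p + 1))
             (a_tilde a phi (N + nat_part p)) lam /\
           ex_I s p 1 (a_psi a phi) lam /\
           I_osc s p 1 a lam =
             (sum_n_m (fun k => expansion_term (I_const s p k) p a lam k)
                0 (N - 1)
              + R_rem s p N a phi lam)%C)) /\
     (exists M : R, 0 < M /\
        forall s lam : R, s = 1 \/ s = -1 -> 1 <= lam ->
          Cmod (R_rem s p N a phi lam) <=
            M * Rpower lam (- ((INR N + 1 - (p - INR (nat_part p))) / p))).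
Proof.
  intros p tau delta a Hp Hd1 Hd2 Ha N HN.
  assert (Sphi : schwartz phi) by now apply schwartz_of_compact_support.
  assert (P0 : phi 0 = RtoC 1) by (apply hphi1; rewrite Rabs_R0; lra).
  set (n := (N + nat_part p)%nat). assert (Hn : (1 <= n)%nat) by (unfold n; lia).
  set (h := fun y => (a y * phi y)%C).
  assert (Sh : schwartz h).
  { apply schwartz_of_compact_support; [apply smooth_mult; [apply Ha|exact hphi_smooth]|].
    destruct hphi_supp as [r Hr]. exists r. intros x Hx. unfold h. rewrite Hr by exact Hx. ring. }
  (* phi = 1 near 0, so a phi and a have the same Taylor coefficients there. *)
  assert (Hder : forall k, CDerive_n h k 0 = CDerive_n a k 0).
  { intros k. apply CDerive_n_ext_loc.
    assert (H0 : Rabs 0 < r0) by (rewrite Rabs_R0; lra).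
    eapply filter_imp; [|exact (locally_Rabs_lt 0 r0 H0)]. intros t Ht. unfold h.
    rewrite hphi1 by lra. ring. }
  set (rho := delta + 1 - p).
  assert (Hrho1 : - p <= rho) by (unfold rho; lra). assert (Hrho2 : rho < 0) by (unfold rho; lra).
  assert (Hreg := exp_regularizer p rho Hp Hrho1 Hrho2).
  assert (HnpR : INR (nat_part p) <= p) by now apply nat_part_le.
  (* x^{n+1-p} [a_tilde] is x^{1-p} times the Taylor remainder, which has order n at both ends. Thus
     A + p = n + 1. *)
  assert (Sat : forall n', exists M, sym p rho n' (1 - p + INR n) (1 - p + INR n) M
    (fun x => RtoC (Rpower x (INR (n + 1) - p)) * a_tilde a phi n x)%C).
  { intros n'. destruct (sym_Rpower p rho n' Hrho1 (1 - p)) as (M1 & _ & H1).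
    destruct (taylor_remainder_sym p delta h n n' Hd1 Sh) as [M2 H2].
    eexists. eapply sym_ext; [|exact (sym_mult _ _ _ _ _ _ _ _ _ _ _ H1 H2)].
    intros x Hx. simpl. rewrite plus_INR. change (INR 1) with 1.
    replace (INR n + 1 - p) with (1 - p + INR n) by ring. rewrite Rpower_plus, Rpower_pow, RtoC_mult by exact Hx.
    rewrite <- Cmult_assoc, (a_tilde_taylor a phi n x) by (try exact Hn; apply Sh). reflexivity. }
  (* The free exponent of 1 - phi at 0 is set to N, so that A + p = N + 1 yields the decay
     lam^{-(N+1)/p}. *)
  assert (Sap : forall n', exists M, sym p rho n' (1 - p + (0 + INR N)) (1 - p + (tau + 0)) M
    (fun x => RtoC (Rpower x (1 - p)) * a_psi a phi x)%C).
  { intros n'. destruct (sym_Rpower p rho n' Hrho1 (1 - p)) as (M1 & _ & H1).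
    destruct (amplitude_sym p tau delta a n' Hd1 Ha) as [M2 H2].
    destruct (cutoff_complement_sym p delta phi r0 n' (INR N) Hd1 Sphi hr0 hphi1) as [M3 H3].
    eexists. exact (sym_mult _ _ _ _ _ _ _ _ _ _ _ H1 (sym_mult _ _ _ _ _ _ _ _ _ _ _ H2 H3)). }
  assert (HINRN : 0 <= INR N) by apply pos_INR. assert (HINRn : 0 <= INR n) by apply pos_INR.
  assert (HA1 : 0 < 1 - p + INR n + p) by lra.
  assert (HA2 : 0 < 1 - p + (0 + INR N) + p) by lra.
  assert (Lat : forall s lam, s = 1 \/ s = -1 -> 0 < lam ->
    exists l, osc_lim p rho s lam (fun x => RtoC (Rpower x (INR (n + 1) - p)) * a_tilde a phi n x)%C l).
  { intros s lam Hs Hl.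
    exact (osc_limit_exists p rho s lam _ _ _ _ Hp Hrho1 Hrho2 HA1 Hl Hs Sat Hreg). }
  assert (Lap : forall s lam, s = 1 \/ s = -1 -> 0 < lam ->
    exists l, osc_lim p rho s lam (fun x => RtoC (Rpower x (1 - p)) * a_psi a phi x)%C l).
  { intros s lam Hs Hl.
    exact (osc_limit_exists p rho s lam _ _ _ _ Hp Hrho1 Hrho2 HA2 Hl Hs Sap Hreg). }
  assert (Iat : forall s lam l, osc_lim p rho s lam (fun x => RtoC (Rpower x (INR (n + 1) - p)) * a_tilde a phi n x)%C l ->
    is_Os_int (at_right 0) (Rbar_locally p_infty) (I_integrand s p (INR (n + 1)) (a_tilde a phi n) lam) l).
  { intros s lam l. now apply osc_lim_is_Os. }
  assert (Iap : forall s lam l, osc_lim p rho s lam (fun x => RtoC (Rpower x (1 - p)) * a_psi a phi x)%C l ->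
    is_Os_int (at_right 0) (Rbar_locally p_infty) (I_integrand s p 1 (a_psi a phi) lam) l).
  { intros s lam l. now apply osc_lim_is_Os. }
  assert (Hconst : forall s, s = 1 \/ s = -1 -> forall k,
    ex_I_const s p k /\ I_const s p k = I_const_value s p k).
  { intros s Hs k. pose proof (Os_power s 1 p k Hs Rlt_0_1 Hp) as H.
    rewrite Rpower_1_l, Cmult_1_r in H. split; [now eexists; exact H|].
    exact (Os_int_eq _ _ phi _ _ Sphi P0 H). }
  split.
  - intros s Hs. split; [now apply Hconst|]. intros lam Hl.
    destruct (Lat s lam Hs Hl) as [l1 H1]. destruct (Lap s lam Hs Hl) as [l2 H2].
    apply Iat in H1. apply Iap in H2.
    pose proof (Os_taylor_poly s lam p (fun k => CDerive_n h k 0) (n - 1) Hs Hl Hp) as H3.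
    replace (S (n - 1)) with n in H3 by lia.
    match type of H3 with is_Os_int _ _ _ ?v => set (l3 := v) in * end.
    assert (H : is_Os_int (at_right 0) (Rbar_locally p_infty) (I_integrand s p 1 a lam) (l3 + l1 + l2)%C).
    { eapply (is_Os_ext (at_right 0) (Rbar_locally p_infty)); [|exact (is_Os_plus _ _ _ _ _ _ (is_Os_plus _ _ _ _ _ _ H3 H1) H2)].
      apply filter_prod_pos. intros x Hx. unfold I_integrand.
      rewrite Rminus_diag, Rpower_O by exact Hx. rewrite plus_INR. change (INR 1) with 1.
      replace (INR n + 1 - 1) with (INR n) by ring. rewrite Rpower_pow by exact Hx.
      set (e := Cexpi _).
      replace (e * RtoC (x ^ n) * a_tilde a phi n x)%C with (e * (RtoC (x ^ n) * a_tilde a phi n x))%C by ring.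
      rewrite (a_tilde_taylor a phi n x) by (try exact Hn; apply Sh). unfold a_psi. fold h. ring. }
    split; [now exists (l3 + l1 + l2)%C|]. split; [now exists l1|]. split; [now exists l2|].
    unfold R_rem, I_osc. fold n.
    rewrite (Os_int_eq _ _ phi _ _ Sphi P0 H), (Os_int_eq _ _ phi _ _ Sphi P0 H1), (Os_int_eq _ _ phi _ _ Sphi P0 H2).
    assert (E3 : l3 = sum_n_m (fun k => expansion_term (I_const s p k) p a lam k) 0 (n - 1)).
    { unfold l3. apply sum_n_m_ext. intros k. unfold expansion_term.
      rewrite (proj2 (Hconst s Hs k)), Hder. reflexivity. }
    rewrite E3. rewrite (sum_n_m_Chasles _ 0 (N - 1) (n - 1)) by (unfold n; lia).
    replace (S (N - 1)) with N by lia.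
    match goal with |- (plus ?x ?y + l1 + l2)%C = _ => change (x + y + l1 + l2 = x + (y + l1 + l2))%C end. ring.
  - set (w := fun lam => Rpower lam (- ((INR N + 1 - (p - INR (nat_part p))) / p))).
    (* All three pieces of the remainder decay at least like lam^{-(N+1)/p}; [p] <= p turns this
       into the stated rate. *)
    assert (Hw : forall lam e, 1 <= lam -> INR N + 1 <= e -> Rpower lam (- (e / p)) <= w lam).
    { intros lam e Hl He. apply Rle_Rpower; [exact Hl|]. apply Ropp_le_contravar.
      apply Rmult_le_compat_r; [left; now apply Rinv_0_lt_compat|]. lra. }
    destruct (Cmod_sum_n_m_bound (fun t k => expansion_term (I_const (fst t) p k) p a (snd t) k)
      (fun t => w (snd t)) (fun t => (fst t = 1 \/ fst t = -1) /\ 1 <= snd t) N (n - 1)) as (K3 & HK3 & B3).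
    { intros k Hk. exists (/ p * Rabs (Gamma ((INR k + 1) / p)) * Cmod (CDerive_n a k 0 / RtoC (INR (fact k)))%C).
      assert (Hip : 0 < / p) by now apply Rinv_0_lt_compat.
      assert (Hnn : 0 <= / p * Rabs (Gamma ((INR k + 1) / p)) * Cmod (CDerive_n a k 0 / RtoC (INR (fact k)))%C).
      { apply Rmult_le_pos; [|apply Cmod_ge_0]. apply Rmult_le_pos; [lra|apply Rabs_pos]. }
      split; [exact Hnn|].
      intros [s lam] [Hs Hl]. simpl in Hs, Hl |- *. unfold expansion_term.
      rewrite (proj2 (Hconst s Hs k)). unfold I_const_value.
      rewrite !Cmod_mult, Cmod_Cexpi, !Cmod_R, (Rabs_pos_eq (/ p)), Rmult_1_r by lra.
      rewrite (Rabs_pos_eq (Rpower _ _)) by (left; apply Rpower_pos).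
      apply Rmult_le_compat_l; [exact Hnn|]. apply Hw; [exact Hl|]. apply le_INR in Hk. lra. }
    destruct (osc_limit_bound p rho _ _ _ Hp Hrho1 Hrho2 HA1 Sat) as (K1 & HK1 & B1).
    destruct (osc_limit_bound p rho _ _ _ Hp Hrho1 Hrho2 HA2 Sap) as (K2 & HK2 & B2).
    exists (K3 + K1 + K2 + 1). split; [lra|]. intros s lam Hs Hl.
    destruct (Lat s lam Hs ltac:(lra)) as [l1 H1]. destruct (Lap s lam Hs ltac:(lra)) as [l2 H2].
    specialize (B1 s lam l1 Hs Hl H1). specialize (B2 s lam l2 Hs Hl H2).
    specialize (B3 (s, lam) (conj Hs Hl)). simpl in B3.
    apply Iat in H1. apply Iap in H2.
    unfold R_rem, I_osc. fold n.
    rewrite (Os_int_eq _ _ phi _ _ Sphi P0 H1), (Os_int_eq _ _ phi _ _ Sphi P0 H2).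
    assert (Hw0 : 0 < w lam) by apply Rpower_pos. specialize (B3 (Rlt_le _ _ Hw0)).
    pose proof (Hw lam (1 - p + INR n + p) Hl) as W1. pose proof (Hw lam (1 - p + (0 + INR N) + p) Hl ltac:(lra)) as W2.
    assert (HnN : INR N <= INR n) by (apply le_INR; unfold n; lia). specialize (W1 ltac:(lra)).
    fold (w lam).
    eapply Rle_trans; [apply Cmod_triangle|]. eapply Rle_trans; [apply Rplus_le_compat_r, Cmod_triangle|].
    assert (K1 * Rpower lam (- ((1 - p + INR n + p) / p)) <= K1 * w lam) by now apply Rmult_le_compat_l.
    assert (K2 * Rpower lam (- ((1 - p + (0 + INR N) + p) / p)) <= K2 * w lam) by now apply Rmult_le_compat_l.
    lra.
Qed.

(** * The expansion on the line *)

Lemma Cball_components (v w : C) (e : posreal) :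
  ball (M := C_UniformSpace) v e w <-> Rabs (Re w - Re v) < e /\ Rabs (Im w - Im v) < e.
Proof. reflexivity. Qed.

(** Gluing two half-lines needs the endpoint 0 itself, not a limit from the right; continuity of [g]
    at 0 makes the two agree. *)
Lemma cintg_from_0 (g : R -> C) (v : C) : (forall x, ccont g x) ->
  cintg g (at_right 0) (Rbar_locally p_infty) v -> cintg g (at_point 0) (Rbar_locally p_infty) v.
Proof.
  intros Hg Hv.
  set (G := fun x => RInt (V := C_R_CompleteNormedModule) g 0 x).
  assert (Ig : forall a b, is_RInt (V := C_R_NormedModule) g a b (RInt (V := C_R_CompleteNormedModule) g a b)).
  { intros a b. apply (RInt_correct (V := C_R_CompleteNormedModule)).
    apply (ex_RInt_continuous (V := C_R_CompleteNormedModule)). auto. }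
  assert (DG : forall x, cderiv G x (g x)).
  { intros x. apply (is_derive_RInt (V := C_R_NormedModule) g G 0 x); [|apply Hg].
    apply filter_forall. intros y. apply Ig. }
  assert (E : forall a b y, is_RInt (V := C_R_NormedModule) g a b y -> y = (G b - G a)%C).
  { intros a b y Hy.
    pose proof (is_RInt_derive (V := C_R_CompleteNormedModule) G g a b (fun x _ => DG x) (fun x _ => Hg x)) as H.
    rewrite <- (is_RInt_unique (V := C_R_CompleteNormedModule) _ _ _ _ Hy).
    exact (is_RInt_unique (V := C_R_CompleteNormedModule) _ _ _ _ H). }
  assert (L : filterlim G (Rbar_locally p_infty) (locally (T := C_UniformSpace) (v + G 0)%C)).
  { apply (filterlim_locally (U := C_UniformSpace)). intros eps.
    pose proof (proj1 (filterlimi_locally (U := C_UniformSpace) _ _) Hv (pos_div_2 eps)) as [Q R1 HQ HR HQR].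
    pose proof (cderiv_ccont _ _ _ (DG 0)) as C0.
    pose proof (proj1 (filterlim_locally (U := C_UniformSpace) _ _) C0 (pos_div_2 eps)) as B0.
    assert (B1 : at_right 0 (fun a => ball (M := C_UniformSpace) (G 0) (pos_div_2 eps) (G a))).
    { exact (filter_le_within _ _ B0). }
    destruct (filter_ex _ (filter_and _ _ HQ B1)) as (a & Qa & Ba).
    eapply filter_imp; [|exact HR]. intros X HX. destruct (HQR a X Qa HX) as (y & Hy & By).
    simpl in Hy. rewrite (E _ _ _ Hy) in By.
    apply (Cball_components _ _ (pos_div_2 eps)) in Ba.
    apply (Cball_components _ _ (pos_div_2 eps)) in By.
    apply Cball_components. clearbody G. destruct (G 0), (G a), (G X), v. simpl in *.
    destruct Ba as [Ba1 Ba2], By as [By1 By2].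
    apply Rabs_def2 in Ba1, Ba2, By1, By2. unfold minus, plus, opp in *. simpl in *.
    split; apply Rabs_def1; lra. }
  replace v with ((v + G 0) - G 0)%C by ring.
  apply (RInt_gen_of_primitive (V := C_R_CompleteNormedModule) (fun _ => True) _ _ G); auto.
  - reflexivity.
  - now exists 0.
  - apply (filterlim_at_point (V := C_R_CompleteNormedModule)).
Qed.

Lemma cintg_whole_line (g : R -> C) (v w : C) : (forall x, ccont g x) ->
  cintg g (at_right 0) (Rbar_locally p_infty) v ->
  cintg (fun x => g (- x)) (at_right 0) (Rbar_locally p_infty) w ->
  cintg g (Rbar_locally m_infty) (Rbar_locally p_infty) (v + w)%C.
Proof.
  intros Hg Hv Hw.
  apply cintg_from_0 in Hv; [|exact Hg].
  apply cintg_from_0 in Hw.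
  2:{ intros x. apply (continuous_comp (fun x => - x) g); [|apply Hg].
      apply (continuous_opp (V := R_NormedModule)), continuous_id. }
  replace (v + w)%C with (w + v)%C by ring.
  refine (is_RInt_gen_Chasles (V := C_R_NormedModule) g 0 w v _ Hv).
  intros P HP. destruct (Hw P HP) as [Q R1 HQ HR HQR].
  exists (fun x => R1 (- x)) (fun b => b = 0).
  - destruct HR as [M HM]. exists (- M). intros x Hx. apply HM. lra.
  - reflexivity.
  - intros a b Ra ->. destruct (HQR 0 (- a) HQ Ra) as (y & Hy & HPy). exists y. split; [|exact HPy].
    simpl in *.
    pose proof (is_RInt_comp_opp (V := C_R_NormedModule) (fun x => g (- x)) 0 a y) as H.
    rewrite Ropp_0 in H. apply H in Hy. clear H.
    apply (is_RInt_swap (V := C_R_NormedModule)), (is_RInt_opp (V := C_R_NormedModule)) in Hy.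
    rewrite opp_opp in Hy. revert Hy. apply (is_RInt_ext (V := C_R_NormedModule)).
    intros x _. rewrite Ropp_involutive. apply opp_opp.
Qed.

(** * Reflection x -> -x and reduction of the line to two half-lines *)

Lemma reflect_chain f : smooth f -> forall j x,
  cderiv (fun x => (RtoC ((-1) ^ j) * CDerive_n f j (- x))%C) x
    (RtoC ((-1) ^ S j) * CDerive_n f (S j) (- x))%C.
Proof.
  intros Hf j x. replace (RtoC ((-1) ^ S j) * CDerive_n f (S j) (- x))%C
    with (RtoC ((-1) ^ j) * (RtoC (-1) * CDerive_n f (S j) (- x)))%C
    by (simpl; rewrite RtoC_mult; ring).
  apply cderiv_scal. apply (cderiv_comp (CDerive_n f j) (fun x => - x)); [|now apply smooth_cderiv].
  auto_derive; [exact I|reflexivity].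
Qed.

Lemma reflect_ext (f : R -> C) x : (RtoC ((-1) ^ 0) * CDerive_n f 0 (- x))%C = f (- x).
Proof. simpl. rewrite CDerive_n_0. ring. Qed.

Lemma smooth_reflect f : smooth f -> smooth (fun x => f (- x)).
Proof.
  intros Hf. apply smooth_ext with (fun x => (RtoC ((-1) ^ 0) * CDerive_n f 0 (- x))%C).
  - apply reflect_ext.
  - exact (chain_smooth _ (reflect_chain f Hf)).
Qed.

Lemma CDerive_n_reflect f j x : smooth f ->
  CDerive_n (fun x => f (- x)) j x = (RtoC ((-1) ^ j) * CDerive_n f j (- x))%C.
Proof.
  intros Hf. rewrite <- (chain_CDerive_n _ (reflect_chain f Hf) j x).
  apply CDerive_n_ext_loc. apply filter_forall. intros t. symmetry. apply reflect_ext.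
Qed.

Lemma Cmod_sign_mult j z : Cmod (RtoC ((-1) ^ j) * z)%C = Cmod z.
Proof. rewrite Cmod_mult, Cmod_R, pow_1_abs. ring. Qed.

Lemma schwartz_reflect f : schwartz f -> schwartz (fun x => f (- x)).
Proof.
  intros [Hs HS]. split; [now apply smooth_reflect|]. intros j k. destruct (HS j k) as [M HM].
  exists M. intros x. rewrite CDerive_n_reflect, Cmod_sign_mult, <- Rabs_Ropp by exact Hs. apply HM.
Qed.

Lemma amplitude_reflect tau delta f : amplitude tau delta f -> amplitude tau delta (fun x => f (- x)).
Proof.
  intros [Hs HA]. split; [now apply smooth_reflect|]. intros k. destruct (HA k) as (M & HM & HB).
  exists M. split; [exact HM|]. intros x. rewrite CDerive_n_reflect, Cmod_sign_mult by exact Hs.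
  specialize (HB (- x)). unfold japanese in *. now rewrite Rabs_Ropp in HB.
Qed.

Lemma taylor_poly_reflect m c x :
  taylor_poly m (fun k => RtoC ((-1) ^ k) * c k)%C x = taylor_poly m c (- x).
Proof.
  induction m as [|m IH]; [reflexivity|]. simpl. rewrite IH.
  replace (- x) with (-1 * x) by ring. rewrite Rpow_mult_distr, RtoC_mult. f_equal. unfold Cdiv. ring.
Qed.

Lemma smooth_ccont f x : smooth f -> ccont f x.
Proof.
  intros Hf. apply (continuous_ext (CDerive_n f 0)); [apply CDerive_n_0|].
  eapply cderiv_ccont. now apply smooth_cderiv.
Qed.

(** On the left half-line the test function becomes chi(-x), which is again admissible; the common
    limit for all test functions is what allows the two halves to be added. *)
Lemma is_Os_whole_line f l1 l2 : (forall x, ccont f x) ->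
  is_Os_int (at_right 0) (Rbar_locally p_infty) f l1 ->
  is_Os_int (at_right 0) (Rbar_locally p_infty) (fun x => f (- x)) l2 ->
  is_Os_int (Rbar_locally m_infty) (Rbar_locally p_infty) f (l1 + l2)%C.
Proof.
  intros Hf H1 H2 chi Hchi H0 P HP.
  specialize (H1 chi Hchi H0). 
  specialize (H2 (fun x => chi (- x)) (schwartz_reflect chi Hchi)).
  cbv beta in H2. rewrite Ropp_0 in H2. specialize (H2 H0).
  destruct (filterlim_plus (V := C_R_NormedModule) l1 l2 P HP) as [Q R1 HQ HR HQR].
  pose proof (H1 Q HQ) as A1. pose proof (H2 R1 HR) as A2. unfold filtermapi in *.
  eapply filter_imp; [|exact (filter_and _ _ A1 A2)].
  intros eps [(u & Hu & Qu) (v & Hv & Rv)]. exists (u + v)%C. split; [|exact (HQR u v Qu Rv)].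
  apply cintg_whole_line; [|exact Hu|].
  - intros x. apply ccont_mult; [apply Hf|].
    apply (continuous_comp (fun x => eps * x) chi).
    + apply (continuous_scal_r (V := R_NormedModule) eps (fun x => x)), continuous_id.
    + apply smooth_ccont, Hchi.
  - eapply (is_RInt_gen_ext (V := C_R_NormedModule)); [|exact Hv].
    apply filter_forall. intros ab x _. now rewrite Ropp_mult_distr_r.
Qed.

(** (-x)^m = (-1)^m x^m changes the sign [s] into s (-1)^m. Continuity and reflection are asked of
    the product with x^{q-1} only, because for [a_tilde] Taylor's formula describes just that
    product. *)
Lemma J_Os s m q b b' lam l1 l2 : (1 <= q)%nat ->
  (forall x, ccont (fun x => RtoC (x ^ (q - 1)) * b x)%C x) ->
  (forall x, 0 < x -> (RtoC (x ^ (q - 1)) * b' x = RtoC ((- x) ^ (q - 1)) * b (- x)%R)%C) ->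
  is_Os_int (at_right 0) (Rbar_locally p_infty) (I_integrand s (INR m) (INR q) b lam) l1 ->
  is_Os_int (at_right 0) (Rbar_locally p_infty) (I_integrand (s * (-1) ^ m) (INR m) (INR q) b' lam) l2 ->
  is_Os_int (Rbar_locally m_infty) (Rbar_locally p_infty) (J_integrand s m q b lam) (l1 + l2)%C.
Proof.
  intros Hq Hc Hb H1 H2. apply is_Os_whole_line.
  - intros x. unfold J_integrand.
    apply (continuous_ext (fun x => Cexpi (s * lam * x ^ m) * (RtoC (x ^ (q - 1)) * b x))%C).
    { intros y. apply Cmult_assoc. }
    apply ccont_mult; [|apply Hc]. apply ccont_Cexpi.
    apply (ex_derive_continuous (fun x => s * lam * x ^ m)). auto_derive. exact I.
  - eapply (is_Os_ext (at_right 0) (Rbar_locally p_infty)); [|exact H1].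
    apply filter_prod_pos. intros x Hx. unfold I_integrand, J_integrand.
    replace (INR q - 1) with (INR (q - 1)) by (rewrite minus_INR by exact Hq; reflexivity). now rewrite !Rpower_pow by exact Hx.
  - eapply (is_Os_ext (at_right 0) (Rbar_locally p_infty)); [|exact H2].
    apply filter_prod_pos. intros x Hx. unfold I_integrand, J_integrand.
    replace (INR q - 1) with (INR (q - 1)) by (rewrite minus_INR by exact Hq; reflexivity). rewrite !Rpower_pow by exact Hx.
    rewrite <- !Cmult_assoc, Hb by exact Hx. f_equal. f_equal.
    replace (- x) with (-1 * x) by ring. rewrite Rpow_mult_distr. ring.
Qed.

Lemma sign_pow s m : s = 1 \/ s = -1 -> s * (-1) ^ m = 1 \/ s * (-1) ^ m = -1.
Proof.
  intros Hs. assert (H : (-1) ^ m = 1 \/ (-1) ^ m = -1).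
  { induction m as [|m [IH|IH]]; simpl; [now left|right|left]; rewrite IH; ring. }
  destruct Hs as [-> | ->], H as [-> | ->]; [left|right|right|left]; ring.
Qed.

(** The (-1)^k in [c_const] is the one relating the k-th derivatives at 0 of a(-x) and of a. *)
Lemma expansion_term_c_const s m a lam k : smooth a ->
  expansion_term (c_const s m k) (INR m) a lam k =
  (expansion_term (I_const s (INR m) k) (INR m) a lam k +
   expansion_term (I_const (s * (-1) ^ m) (INR m) k) (INR m) (fun x => a (- x)%R) lam k)%C.
Proof.
  intros Ha. unfold expansion_term, c_const. rewrite CDerive_n_reflect, Ropp_0 by exact Ha.
  unfold Cdiv. ring.
Qed.

Lemma sum_expansion_c_const s m a lam i j : smooth a ->
  sum_n_m (fun k => expansion_term (c_const s m k) (INR m) a lam k) i j =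
  (sum_n_m (fun k => expansion_term (I_const s (INR m) k) (INR m) a lam k) i j +
   sum_n_m (fun k => expansion_term (I_const (s * (-1) ^ m) (INR m) k) (INR m) (fun x => a (- x)%R) lam k) i j)%C.
Proof.
  intros Ha.
  rewrite (sum_n_m_ext _ _ i j (fun k => expansion_term_c_const s m a lam k Ha)).
  exact (sum_n_m_plus (G := C_AbelianGroup) _ _ i j).
Qed.

Theorem theorem6p1 (phi : R -> C) (r0 r1 : R)
  (hphi_smooth : smooth phi) (hphi_supp : compact_support phi)
  (hr0 : 1 <= r0) (hr1 : r0 < r1)
  (hphi1 : forall x : R, Rabs x <= r0 -> phi x = RtoC 1)
  (hphi0 : forall x : R, r1 <= Rabs x -> phi x = RtoC 0) :
  (forall (p tau delta : R) (a : R -> C),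
     0 < p -> -1 <= delta -> delta < p - 1 -> amplitude tau delta a ->
     forall N : nat, (1 <= N)%nat ->
     (forall s : R, s = 1 \/ s = -1 ->
        (forall k : nat,
           ex_I_const s p k /\ I_const s p k = I_const_value s p k) /\
        (forall lam : R, 0 < lam ->
           ex_I s p 1 a lam /\
           ex_I s p (INR (N + nat_part p + 1))
             (a_tilde a phi (N + nat_part p)) lam /\
           ex_I s p 1 (a_psi a phi) lam /\
           I_osc s p 1 a lam =
             (sum_n_m (fun k => expansion_term (I_const s p k) p a lam k)
                0 (N - 1)
              + R_rem s p N a phi lam)%C)) /\
     (exists M : R, 0 < M /\
        forall s lam : R, s = 1 \/ s = -1 -> 1 <= lam ->
          Cmod (R_rem s p N a phi lam) <=
            M * Rpower lam (- ((INR N + 1 - (p - INR (nat_part p))) / p)))) /\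
  (forall (m : nat) (tau delta : R) (a : R -> C),
     (1 <= m)%nat -> -1 <= delta -> delta < INR m - 1 -> amplitude tau delta a ->
     forall N : nat, (1 <= N)%nat ->
     (forall s : R, s = 1 \/ s = -1 ->
        (forall k : nat,
           ex_I_const s (INR m) k /\
           I_const s (INR m) k = I_const_value s (INR m) k /\
           ex_I_const (s * (-1) ^ m) (INR m) k /\
           I_const (s * (-1) ^ m) (INR m) k
             = I_const_value (s * (-1) ^ m) (INR m) k) /\
        (forall lam : R, 0 < lam ->
           ex_J s m 1 a lam /\
           ex_J s m (N + m + 1) (a_tilde a phi (N + m)) lam /\
           ex_J s m 1 (a_psi a phi) lam /\
           J_osc s m 1 a lam =
             (sum_n_m (fun k => expansion_term (c_const s m k) (INR m) a lam k)
                0 (N - 1)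
              + R_tilde_rem s m N a phi lam)%C)) /\
     (exists M : R, 0 < M /\
        forall s lam : R, s = 1 \/ s = -1 -> 1 <= lam ->
          Cmod (R_tilde_rem s m N a phi lam) <=
            M * Rpower lam (- ((INR N + 1) / INR m)))).
Proof.
  split; [exact (half_line_expansion phi r0 r1 hphi_smooth hphi_supp hr0 hphi1)|].
  intros m tau delta a Hm Hd1 Hd2 Ha N HN.
  assert (Hm0 : 0 < INR m) by (apply lt_0_INR; lia).
  set (phi' := fun x => phi (- x)). set (a' := fun x => a (- x)).
  assert (Sphi : schwartz phi) by now apply schwartz_of_compact_support.
  assert (P0 : phi 0 = RtoC 1) by (apply hphi1; rewrite Rabs_R0; lra).
  assert (Sphi' : smooth phi') by now apply smooth_reflect.
  assert (Cphi' : compact_support phi').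
  { destruct hphi_supp as [r Hr]. exists r. intros x Hx. apply Hr. now rewrite Rabs_Ropp. }
  assert (Hphi1' : forall x, Rabs x <= r0 -> phi' x = RtoC 1).
  { intros x Hx. apply hphi1. now rewrite Rabs_Ropp. }
  assert (Ha' : amplitude tau delta a') by now apply amplitude_reflect.
  assert (Sh : smooth (fun y => a y * phi y)%C) by (apply smooth_mult; [apply Ha|exact hphi_smooth]).
  assert (Sh' : smooth (fun y => a' y * phi' y)%C) by (apply smooth_mult; [apply Ha'|exact Sphi']).
  destruct (half_line_expansion phi r0 r1 hphi_smooth hphi_supp hr0 hphi1 (INR m) tau delta a Hm0 Hd1 Hd2 Ha N HN)
    as [A (M1 & HM1 & B1)].
  destruct (half_line_expansion phi' r0 r1 Sphi' Cphi' hr0 Hphi1' (INR m) tau delta a' Hm0 Hd1 Hd2 Ha' N HN)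
    as [A' (M2 & HM2 & B2)].
  rewrite nat_part_INR in *.
  set (n := (N + m)%nat) in *. assert (Hn : (1 <= n)%nat) by (unfold n; lia).
  (* By [a_tilde_taylor] both sides are the Taylor remainder of a phi at -x. *)
  assert (Hat : forall x, 0 < x -> (RtoC (x ^ (n + 1 - 1)) * a_tilde a' phi' n x =
    RtoC ((- x) ^ (n + 1 - 1)) * a_tilde a phi n (- x)%R)%C).
  { intros x _. replace (n + 1 - 1)%nat with n by lia.
    rewrite !a_tilde_taylor by assumption. f_equal.
    rewrite <- taylor_poly_reflect. apply taylor_poly_ext. intros k _.
    pose proof (CDerive_n_reflect (fun y => a y * phi y)%C k 0 Sh) as E. rewrite Ropp_0 in E. exact E. }
  assert (Cat : forall x, ccont (fun x => RtoC (x ^ (n + 1 - 1)) * a_tilde a phi n x)%C x).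
  { intros x. replace (n + 1 - 1)%nat with n by lia.
    apply (continuous_ext (fun x => a x * phi x + - RtoC 1 * taylor_poly n (fun k => CDerive_n (fun y => a y * phi y) k 0) x)%C).
    { intros y. rewrite a_tilde_taylor by assumption.
      match goal with |- ?u = ?v => change (@eq C u v) end. ring. }
    apply ccont_plus; [now apply (smooth_ccont (fun x => a x * phi x)%C)|].
    apply ccont_mult; [apply continuous_const|].
    replace n with (S (n - 1)) by lia. eapply cderiv_ccont. apply cderiv_taylor_poly. }
  assert (HJ : forall s lam, s = 1 \/ s = -1 -> 0 < lam ->
    is_Os_int (Rbar_locally m_infty) (Rbar_locally p_infty) (J_integrand s m 1 a lam)
      (I_osc s (INR m) 1 a lam + I_osc (s * (-1) ^ m) (INR m) 1 a' lam)%C /\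
    is_Os_int (Rbar_locally m_infty) (Rbar_locally p_infty) (J_integrand s m (n + 1) (a_tilde a phi n) lam)
      (I_osc s (INR m) (INR (n + 1)) (a_tilde a phi n) lam + I_osc (s * (-1) ^ m) (INR m) (INR (n + 1)) (a_tilde a' phi' n) lam)%C /\
    is_Os_int (Rbar_locally m_infty) (Rbar_locally p_infty) (J_integrand s m 1 (a_psi a phi) lam)
      (I_osc s (INR m) 1 (a_psi a phi) lam + I_osc (s * (-1) ^ m) (INR m) 1 (a_psi a' phi') lam)%C).
  { intros s lam Hs Hl.
    destruct (proj2 (A s Hs) lam Hl) as (E1 & E2 & E3 & _).
    destruct (proj2 (A' _ (sign_pow s m Hs)) lam Hl) as (E1' & E2' & E3' & _).
    split; [|split].
    - apply J_Os with a'; [lia| |reflexivity| |].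
      + intros x. apply ccont_mult; [apply continuous_const|]. apply smooth_ccont, Ha.
      + exact (Os_int_correct _ _ phi _ Sphi P0 E1).
      + exact (Os_int_correct _ _ phi _ Sphi P0 E1').
    - apply J_Os with (a_tilde a' phi' n); [lia|exact Cat|exact Hat| |].
      + exact (Os_int_correct _ _ phi _ Sphi P0 E2).
      + exact (Os_int_correct _ _ phi _ Sphi P0 E2').
    - apply J_Os with (a_psi a' phi'); [lia| |reflexivity| |].
      + intros x. apply ccont_mult; [apply continuous_const|]. unfold a_psi.
        apply ccont_mult; [apply smooth_ccont, Ha|].
        apply (continuous_ext (fun x => RtoC 1 + - RtoC 1 * phi x)%C).
        { intros y. match goal with |- ?u = ?v => change (@eq C u v) end. ring. }
        apply ccont_plus; [apply continuous_const|].
        apply ccont_mult; [apply continuous_const|now apply smooth_ccont].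
      + exact (Os_int_correct _ _ phi _ Sphi P0 E3).
      + exact (Os_int_correct _ _ phi _ Sphi P0 E3'). }
  (* The remainder on the line is the sum of the half-line remainders of (a, phi) and of their
     reflections, the latter with sign s (-1)^m; hence both the identity and the estimate. *)
  assert (HR : forall s lam, s = 1 \/ s = -1 -> 0 < lam ->
    R_tilde_rem s m N a phi lam = (R_rem s (INR m) N a phi lam + R_rem (s * (-1) ^ m) (INR m) N a' phi' lam)%C).
  { intros s lam Hs Hl. destruct (HJ s lam Hs Hl) as (_ & J2 & J3).
    unfold R_tilde_rem, R_rem, J_osc. rewrite nat_part_INR. fold n.
    rewrite (Os_int_eq _ _ phi _ _ Sphi P0 J2), (Os_int_eq _ _ phi _ _ Sphi P0 J3).
    rewrite sum_expansion_c_const by apply Ha. fold a'. ring. }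
  split.
  - intros s Hs. pose proof (sign_pow s m Hs) as Hs'. split.
    + intros k. destruct (proj1 (A s Hs) k) as [K1 K2]. destruct (proj1 (A _ Hs') k) as [K3 K4].
      repeat split; assumption.
    + intros lam Hl. destruct (HJ s lam Hs Hl) as (J1 & J2 & J3).
      split; [eexists; exact J1|]. split; [eexists; exact J2|]. split; [eexists; exact J3|].
      rewrite (HR s lam Hs Hl), sum_expansion_c_const by apply Ha. fold a'.
      unfold J_osc. rewrite (Os_int_eq _ _ phi _ _ Sphi P0 J1).
      destruct (proj2 (A s Hs) lam Hl) as (_ & _ & _ & ->).
      destruct (proj2 (A' _ Hs') lam Hl) as (_ & _ & _ & ->). ring.
  - exists (M1 + M2). split; [lra|]. intros s lam Hs Hl. rewrite (HR s lam Hs ltac:(lra)).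
    specialize (B1 s lam Hs Hl). specialize (B2 _ lam (sign_pow s m Hs) Hl).
    replace (INR N + 1 - (INR m - INR m)) with (INR N + 1) in B1, B2 by ring.
    eapply Rle_trans; [apply Cmod_triangle|]. lra.
Qed.
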